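(* Let $\mathbf{K} = \big(B = A^{\mathrm{co}(H)}, \Omega^{\bullet}, \Omega^{(\bullet,\bullet)}, \kappa\big)$ be a factorisable irreducible CQH-Kähler space, and let $(\mathcal{E}, h_{\mathcal{E}}, \overline{\partial}_{\mathcal{E}})$ be an Hermitian holomorphic relative line module over $B$, with Chern connection $\nabla$. Then precisely one of the following three possibilities holds: (i) $\mathcal{E} > 0$ (that is, $\mathcal{E}$ is positive: there is $\theta \in \mathbb{R}_{>0}$ with $\nabla^2(e) = -\theta \mathbf{i} \kappa \otimes e$ for all $e \in \mathcal{E}$); (ii) $\mathcal{E}$ is flat (that is, $\nabla^2 = 0$); (iii) $\mathcal{E} < 0$ (that is, $\mathcal{E}$ is negative: there is $\theta \in \mathbb{R}_{>0}$ with $\nabla^2(e) = \theta \mathbf{i} \kappa \otimes e$ for all $e \in \mathcal{E}$).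
   Context: Conventions. Algebras are unital over $\mathbb{C}$, unadorned tensor products are over $\mathbb{C}$, $\mathbf{i} = \sqrt{-1}$, and Sweedler notation is used. Differential calculi. A differential calculus over an algebra $B$ is a differential graded algebra $(\Omega^\bullet = \bigoplus_{k\ge 0}\Omega^k, \mathrm{d})$ with $\Omega^0 = B$, generated as an algebra by the elements $a, \mathrm{d}b$ for $a,b\in B$. It has total degree $m$ if $\Omega^m \neq 0$ and $\Omega^k=0$ for $k>m$. If $B$ is a $*$-algebra, a differential $*$-calculus is a calculus for which $*$ extends to a conjugate-linear involution of $\Omega^\bullet$ with $\mathrm{d}(\omega^* ) = (\mathrm{d}\omega)^*$ and $(\omega\wedge\nu)^* = (-1)^{kl}\nu^*\wedge\omega^*$ for $\omega\in\Omega^k$, $\nu\in\Omega^l$. A complex structure is a $\mathbb{Z}_{\ge0}^2$-algebra grading $\Omega^\bullet=\bigoplus \Omega^{(a,b)}$ with $\Omega^k=\bigoplus_{a+b=k}\Omega^{(a,b)}$, $(\Omega^{(a,b)})^*=\Omega^{(b,a)}$, $\mathrm{d}\Omega^{(a,b)}\subseteq\Omega^{(a+1,b)}\oplus\Omega^{(a,b+1)}$; write $\mathrm{d}=\partial+\overline\partial$ with $\partial$ of degree $(1,0)$ and $\overline\partial$ of degree $(0,1)$. It is factorisable if multiplication gives $B$-bimodule isomorphisms $\Omega^{(a,0)}\otimes_B\Omega^{(0,b)}\simeq\Omega^{(a,b)}$ and $\Omega^{(0,b)}\otimes_B\Omega^{(a,0)}\simeq\Omega^{(a,b)}$ for all $a,b$.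 Hermitian and Kähler structures. For a differential $*$-calculus of even total degree $2n$, an Hermitian structure is a pair $(\Omega^{(\bullet,\bullet)},\sigma)$ of a complex structure and a central real ($\sigma^*=\sigma$) form $\sigma\in\Omega^{(1,1)}$ such that, with $L(\omega)=\sigma\wedge\omega$, the maps $L^{n-k}:\Omega^k\to\Omega^{2n-k}$ are isomorphisms for $k=0,\dots,n-1$. It is a Kähler structure if $\mathrm{d}\sigma=0$ (and then $\sigma$ is usually denoted $\kappa$). The primitive forms are $P^{(a,b)}=\{\alpha\in\Omega^{(a,b)}: L^{n-a-b+1}(\alpha)=0\}$ for $a+b\le n$, and $0$ otherwise. The Hodge map $*_\sigma:\Omega^\bullet\to\Omega^\bullet$ is the $B$-bimodule map with $*_\sigma(L^j(\omega))=(-1)^{k(k+1)/2}\mathbf{i}^{a-b}\frac{j!}{(n-j-k)!}L^{n-j-k}(\omega)$ for $\omega\in P^{(a,b)}$, $k=a+b$. The Hermitian metric is $g_\sigma(\omega,\nu)=*_\sigma(\omega\wedge*_\sigma(\nu^* ))$ for $\omega,\nu$ homogeneous of equal degree, and $0$ for homogeneous forms of different degree. Quantum homogeneous spaces. A compact quantum group algebra (CQGA) is a cosemisimple Hopf $*$-algebra $A$ whose Haar functional $\mathbf{h}$ satisfies $\mathbf{h}(a^*a)>0$ for $a\ne0$. A CQGA-homogeneous space is $B=A^{\mathrm{co}(H)}=\{a\in A: (\mathrm{id}\otimes\pi)\Delta(a)=a\otimes1\}$ for a surjective Hopf $*$-algebra map $\pi:A\to H$ between CQGAs. Write $B^+=B\cap\ker\varepsilon$.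 The category ${}^A_B\mathrm{mod}_0$ has as objects the $B$-bimodules $\mathcal{F}$, finitely generated as left $B$-modules, with a left $A$-comodule structure $\Delta_L$ satisfying $\Delta_L(bfc)=\Delta(b)\Delta_L(f)\Delta(c)$ and $B^+\mathcal{F}=\mathcal{F}B^+$; morphisms are left $A$-comodule $B$-bimodule maps. Takeuchi's functor $\Phi(\mathcal{F})=\mathcal{F}/B^+\mathcal{F}$, with left $H$-coaction $[f]\mapsto\pi(f_{(-1)})\otimes[f_{(0)}]$, is a monoidal equivalence from ${}^A_B\mathrm{mod}_0$ to finite-dimensional left $H$-comodules. A calculus over $B$ is (left $A$-)covariant if the coaction of $B$ extends to make $\Omega^\bullet$ a left $A$-comodule algebra with $\mathrm{d}$ a comodule map; a complex structure is covariant if each $\Omega^{(a,b)}$ is a subcomodule; an Hermitian structure is covariant if moreover $\Delta_L(\sigma)=1\otimes\sigma$. CQH spaces. A CQH-Hermitian space is a quadruple $(B=A^{\mathrm{co}(H)},\Omega^\bullet,\Omega^{(\bullet,\bullet)},\sigma)$ where $B$ is a CQGA-homogeneous space; $\Omega^\bullet$ is a left $A$-covariant differential $*$-calculus over $B$ that is an object of ${}^A_B\mathrm{mod}_0$, of total degree $2n$ with $n\in\mathbb{Z}_{>0}$; $(\Omega^{(\bullet,\bullet)},\sigma)$ is a covariant Hermitian structure with $\mathbf{h}( *_\sigma(\mathrm{d}\omega))=0$ for all $\omega\in\Omega^{2n-1}$; and $(\Omega^\bullet,g_\sigma)$ is an Hermitian module (in the sense below, i.e. $g_\sigma(\omega,\omega)\in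 B_{>0}$ for all $\omega\ne0$). It is a CQH-Kähler space if the Hermitian structure is Kähler, factorisable if the complex structure is factorisable, and irreducible if $\Omega^{(1,0)}$ (equivalently $\Omega^{(0,1)}$) is irreducible in ${}^A_B\mathrm{mod}_0$. Modules. Let $B_{\ge0}=\{\sum_i b_i^*b_i\}$ (finite sums) and $B_{>0}=B_{\ge0}\setminus\{0\}$. For a left $B$-module $\mathcal{F}$, ${}^\vee\mathcal{F}={}_B\mathrm{Hom}(\mathcal{F},B)$ with right action $(\phi b)(f)=\phi(f)b$, and $\overline{\mathcal{F}}$ is the conjugate right module, $\overline{f}b=\overline{b^*f}$. An Hermitian module is a pair $(\mathcal{F},h_{\mathcal{F}})$ with $\mathcal{F}$ a finitely generated projective left $B$-module and $h_{\mathcal{F}}:\overline{\mathcal{F}}\to{}^\vee\mathcal{F}$ a right $B$-module isomorphism such that $h_{\mathcal{F}}(f,k):=h_{\mathcal{F}}(\overline{k})(f)$ satisfies $h_{\mathcal{F}}(f,k)=h_{\mathcal{F}}(k,f)^*$ and $h_{\mathcal{F}}(f,f)\in B_{>0}$ for all non-zero $f,k$. A connection on $\mathcal{F}$ is a linear map $\nabla:\mathcal{F}\to\Omega^1\otimes_B\mathcal{F}$ with $\nabla(bf)=\mathrm{d}b\otimes f+b\nabla f$, extended to $\Omega^\bullet\otimes_B\mathcal{F}$ by $\nabla(\omega\otimes f)=\mathrm{d}\omega\otimes f+(-1)^{|\omega|}\omega\wedge\nabla f$; its curvature is $\nabla^2:\mathcal{F}\to\Omega^2\otimes_B\mathcal{F}$,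 and it is flat if $\nabla^2=0$. A $(0,1)$-connection is a connection with respect to $(\Omega^{(0,\bullet)},\overline\partial)$. A holomorphic module is a finitely generated projective left $B$-module with a flat $(0,1)$-connection $\overline\partial_{\mathcal{F}}$ (a holomorphic structure). For a holomorphic Hermitian module $(\mathcal{F},h_{\mathcal{F}},\overline\partial_{\mathcal{F}})$, the Chern connection is the unique connection $\nabla$ that is Hermitian, i.e. $\mathrm{d}\,h_{\mathcal{F}}(f,g)=\mathfrak{h}(\nabla f,1\otimes g)+\mathfrak{h}(1\otimes f,\nabla g)$ with $\mathfrak{h}(\omega\otimes f,\nu\otimes g)=\omega h_{\mathcal{F}}(f,g)\wedge\nu^*$, and that satisfies $\overline\partial_{\mathcal{F}}=(\mathrm{proj}_{\Omega^{(0,1)}}\otimes\mathrm{id})\circ\nabla$. Relative versions. A holomorphic relative Hopf module is a holomorphic module $(\mathcal{F},\overline\partial_{\mathcal{F}})$ with $\mathcal{F}\in{}^A_B\mathrm{mod}_0$ and $\overline\partial_{\mathcal{F}}$ a left $A$-comodule map. An Hermitian relative Hopf module is an Hermitian module with $\mathcal{F}\in{}^A_B\mathrm{mod}_0$ and $\overline{f}\mapsto h_{\mathcal{F}}(\cdot,f)$ a morphism $\overline{\mathcal{F}}\to{}^\vee\mathcal{F}$ in ${}^A_B\mathrm{mod}_0$, where $\overline{\mathcal{F}}$ has $b\overline{f}c=\overline{c^*fb^*}$, $\Delta_L(\overline{f})=(f_{(-1)})^*\otimes\overline{f_{(0)}}$, and ${}^\vee\mathcal{F}$ carries the structure of the right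 dual (so that evaluation $\mathcal{F}\otimes_B{}^\vee\mathcal{F}\to B$ is a morphism). A relative line module is an object $\mathcal{E}$ of ${}^A_B\mathrm{mod}_0$ with $\dim\Phi(\mathcal{E})=1$; an Hermitian holomorphic relative line module $(\mathcal{E},h_{\mathcal{E}},\overline\partial_{\mathcal{E}})$ is a relative line module that is both an Hermitian and a holomorphic relative Hopf module. *)

(* Defs.v *)
From HB Require Import structures.
From mathcomp Require Import all_boot all_order all_algebra.
From mathcomp Require Import boolp classical_sets.
From mathcomp Require Import reals complex.

Set Implicit Arguments.
Unset Strict Implicit.
Unset Printing Implicit Defensive.

Import GRing.Theory Num.Theory.
Local Open Scope ring_scope.
Local Open Scope quotient_scope.

Record bimodule (C : numClosedFieldType) (B : algType C) := Bimodule {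
  bm_car :> lmodType C;
  lact : B -> bm_car -> bm_car;
  ract : bm_car -> B -> bm_car;
  lactDr : forall b x y, lact b (x + y) = lact b x + lact b y;
  lactPl : forall c b b' x, lact (c *: b + b') x = c *: lact b x + lact b' x;
  lact1 : forall x, lact 1 x = x;
  lactA : forall a b x, lact (a * b) x = lact a (lact b x);
  ractDl : forall b x y, ract (x + y) b = ract x b + ract y b;
  ractPr : forall c b b' x, ract x (c *: b + b') = c *: ract x b + ract x b';
  ract1 : forall x, ract x 1 = x;
  ractA : forall a b x, ract x (a * b) = ract (ract x a) b;
  lract : forall a x b, ract (lact a x) b = lact a (ract x b)
}.

Arguments lact {C B F} _ _ : rename.
Arguments ract {C B F} _ _ : rename.

Section BimoduleTheory.
Context {C : numClosedFieldType} {B : algType C}.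
Implicit Types (F : bimodule B).

Lemma lact_scalel F c (b : B) (x : F) : lact (c *: b) x = c *: lact b x.
Proof.
have h0 : lact (0 : B) x = 0.
  apply: (addrI (lact (0 : B) x)); rewrite addr0.
  by rewrite -{1}[lact 0 x]scale1r -lactPl scaler0 addr0.
by rewrite -[c *: b]addr0 lactPl h0 addr0.
Qed.

Lemma ract_scaler F c (b : B) (x : F) : ract x (c *: b) = c *: ract x b.
Proof.
have h0 : ract x (0 : B) = 0.
  apply: (addrI (ract x (0 : B))); rewrite addr0.
  by rewrite -{1}[ract x 0]scale1r -ractPr scaler0 addr0.
by rewrite -[c *: b]addr0 ractPr h0 addr0.
Qed.

Lemma lact_scaler F c (b : B) (x : F) : lact b (c *: x) = c *: lact b x.
Proof.
by rewrite -{1}[x]lact1 -lact_scalel -lactA -scalerAr mulr1 lact_scalel.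
Qed.

Lemma ract_scalel F c (b : B) (x : F) : ract (c *: x) b = c *: ract x b.
Proof.
by rewrite -{1}[x]ract1 -ract_scaler -ractA -scalerAl mul1r ract_scaler.
Qed.

End BimoduleTheory.

Definition scalar_alg (C : numClosedFieldType) : algType C := C^o.

Section VectorSpaceBimodule.
Context {C : numClosedFieldType} (V : lmodType C).

Fact vs_actDr (c : scalar_alg C) (x y : V) : c *: (x + y) = c *: x + c *: y.
Proof. exact: scalerDr. Qed.
Fact vs_actP (c : C) (b b' : scalar_alg C) (x : V) :
  ((c *: b + b' : scalar_alg C) : C) *: x = c *: ((b : C) *: x) + (b' : C) *: x.
Proof. by rewrite scalerDl scalerA. Qed.
Fact vs_act1 (x : V) : (1 : scalar_alg C) *: x = x.
Proof. exact: scale1r. Qed.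
Fact vs_actA (a b : scalar_alg C) (x : V) :
  (a * b : C) *: x = (a : C) *: ((b : C) *: x).
Proof. by rewrite scalerA. Qed.
Fact vs_ractA (a b : scalar_alg C) (x : V) :
  (a * b : C) *: x = (b : C) *: ((a : C) *: x).
Proof. by rewrite scalerA mulrC. Qed.
Fact vs_lract (a : scalar_alg C) (x : V) (b : scalar_alg C) :
  (b : C) *: ((a : C) *: x) = (a : C) *: ((b : C) *: x).
Proof. by rewrite !scalerA mulrC. Qed.

(* A vector space as a symmetric bimodule over the scalars: tensor products
   over [scalar_alg C] are the unadorned ones. *)
Definition vs : bimodule (scalar_alg C) :=
  @Bimodule C (scalar_alg C) V (fun c x => (c : C) *: x)
    (fun x c => (c : C) *: x)
    vs_actDr vs_actP vs_act1 vs_actA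
    (fun c x y => vs_actDr c x y) vs_actP vs_act1 vs_ractA vs_lract.

End VectorSpaceBimodule.

Definition balanced (C : numClosedFieldType) (B : algType C)
    (M N : bimodule B) (V : zmodType) (f : M -> N -> V) : Prop :=
  [/\ forall m m' n, f (m + m') n = f m n + f m' n,
      forall m n n', f m (n + n') = f m n + f m n' &
      forall m b n, f (ract m b) n = f m (lact b n)].

Section Tensor.
Context {C : numClosedFieldType} {B : algType C} (M N : bimodule B).

Definition formal_eval (V : zmodType) (f : M -> N -> V) (s : seq (M * N)) : V :=
  \sum_(x <- s) f x.1 x.2.

(* The kernel of the universal balanced map: formal sums of pairs are
   identified when no balanced map separates them. *)
Definition formal_eq (s t : seq (M * N)) : bool :=
  `[< forall (V : zmodType) (f : M -> N -> V), balanced f ->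
        formal_eval f s = formal_eval f t >].

Fact formal_eq_refl : reflexive formal_eq.
Proof. by move=> s; apply/asboolP. Qed.
Fact formal_eq_sym : symmetric formal_eq.
Proof.
move=> s t; apply/idP/idP => /asboolP h; apply/asboolP => V f bf;
  by rewrite (h V f bf).
Qed.
Fact formal_eq_trans : transitive formal_eq.
Proof.
move=> t s u /asboolP h1 /asboolP h2; apply/asboolP => V f bf.
by rewrite (h1 V f bf) (h2 V f bf).
Qed.

Canonical formal_equiv :=
  EquivRel formal_eq formal_eq_refl formal_eq_sym formal_eq_trans.

Definition tensor : Type := {eq_quot formal_equiv}.
HB.instance Definition _ := Choice.on tensor.
HB.instance Definition _ := EqQuotient.on tensor.

Definition tclass (s : seq (M * N)) : tensor := \pi_tensor s.
Definition pure (m : M) (n : N) : tensor := tclass [:: (m, n)].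

(* The map out of the tensor product induced by [f]; meaningful when [f] is
   balanced, see [tlift_pure]. *)
Definition tlift (V : zmodType) (f : M -> N -> V) (t : tensor) : V :=
  formal_eval f (repr t).

Lemma tclassP s t : (forall (V : zmodType) (f : M -> N -> V), balanced f ->
  formal_eval f s = formal_eval f t) <-> tclass s = tclass t.
Proof.
split=> [h|/eqmodP /asboolP //].
by apply/eqmodP/asboolP.
Qed.

Lemma tlift_class (V : zmodType) (f : M -> N -> V) s : balanced f ->
  tlift f (tclass s) = formal_eval f s.
Proof.
move=> bf; have /tclassP h : tclass (repr (tclass s)) = tclass s.
  exact: reprK.
exact: h.
Qed.

Lemma tlift_pure (V : zmodType) (f : M -> N -> V) m n : balanced f ->
  tlift f (pure m n) = f m n.
Proof. by move=> bf; rewrite tlift_class// /formal_eval big_seq1. Qed.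

Definition tadd (t u : tensor) : tensor := tclass (repr t ++ repr u).
Definition topp (t : tensor) : tensor :=
  tclass [seq (- x.1, x.2) | x <- repr t].
Definition tzero : tensor := tclass [::].
Definition tscale (c : C) (t : tensor) : tensor :=
  tclass [seq (c *: x.1, x.2) | x <- repr t].

Lemma tensorP (t u : tensor) : (forall (V : zmodType) (f : M -> N -> V),
  balanced f -> tlift f t = tlift f u) -> t = u.
Proof.
move=> h; rewrite -[t]reprK -[u]reprK.
by apply/tclassP => V f bf; apply: h.
Qed.

Lemma balancedN (V : zmodType) (f : M -> N -> V) m n : balanced f ->
  f (- m) n = - f m n.
Proof.
case=> fD _ _; have f0 : f 0 n = 0.
  by apply: (addrI (f 0 n)); rewrite -fD !addr0.
by apply/eqP; rewrite -addr_eq0 -fD addNr f0.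
Qed.

Lemma balanced_scale (V : zmodType) (f : M -> N -> V) c : balanced f ->
  balanced (fun m n => f (c *: m) n).
Proof.
case=> fDl fDr fB; split=> [m m' n|m n n'|m b n].
- by rewrite scalerDr fDl.
- by rewrite fDr.
- by rewrite -fB ract_scalel.
Qed.

Lemma tlift_add (V : zmodType) (f : M -> N -> V) t u : balanced f ->
  tlift f (tadd t u) = tlift f t + tlift f u.
Proof. by move=> bf; rewrite tlift_class// /formal_eval big_cat. Qed.

Lemma tlift_opp (V : zmodType) (f : M -> N -> V) t : balanced f ->
  tlift f (topp t) = - tlift f t.
Proof.
move=> bf; rewrite tlift_class// /formal_eval big_map -sumrN /=.
by apply: eq_bigr => x _; rewrite balancedN.
Qed.

Lemma tlift_zero (V : zmodType) (f : M -> N -> V) : balanced f ->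
  tlift f tzero = 0.
Proof. by move=> bf; rewrite tlift_class// /formal_eval big_nil. Qed.

Lemma tlift_scale (V : zmodType) (f : M -> N -> V) c t : balanced f ->
  tlift f (tscale c t) = tlift (fun m n => f (c *: m) n) t.
Proof. by move=> bf; rewrite tlift_class// /formal_eval big_map. Qed.

Fact taddA : associative tadd.
Proof.
by move=> t u v; apply: tensorP => V f bf; rewrite !tlift_add// addrA.
Qed.
Fact taddC : commutative tadd.
Proof.
by move=> t u; apply: tensorP => V f bf; rewrite !tlift_add// addrC.
Qed.
Fact tadd0 : left_id tzero tadd.
Proof.
by move=> t; apply: tensorP => V f bf; rewrite tlift_add// tlift_zero// add0r.
Qed.
Fact taddN : left_inverse tzero topp tadd.
Proof.
move=> t; apply: tensorP => V f bf.
by rewrite tlift_add// tlift_opp// tlift_zero// addNr.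
Qed.

HB.instance Definition _ :=
  GRing.isZmodule.Build tensor taddA taddC tadd0 taddN.

Lemma tliftD (V : zmodType) (f : M -> N -> V) t u : balanced f ->
  tlift f (t + u) = tlift f t + tlift f u.
Proof. exact: tlift_add. Qed.

Fact tscaleA a b t : tscale a (tscale b t) = tscale (a * b) t.
Proof.
apply: tensorP => V f bf.
rewrite tlift_scale// [LHS]tlift_scale; last exact: balanced_scale.
rewrite tlift_scale//; congr (tlift _ t).
by apply: funext => m; apply: funext => n; rewrite scalerA.
Qed.
Fact tscale1 : left_id 1 tscale.
Proof.
move=> t; apply: tensorP => V f bf; rewrite tlift_scale//.
by congr (tlift _ t); apply: funext => m; apply: funext => n; rewrite scale1r.
Qed.
Fact tscaleDr : right_distributive tscale +%R.
Proof.
move=> c t u; apply: tensorP => V f bf.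
have bcf := balanced_scale c bf.
by rewrite tlift_scale// !tliftD// !tlift_scale.
Qed.
Fact tscaleDl v : {morph tscale^~ v : a b / a + b}.
Proof.
move=> a b; apply: tensorP => V f bf.
rewrite tliftD// !tlift_scale// /tlift /formal_eval -big_split /=.
by apply: eq_bigr => x _; case: bf => fD _ _; rewrite scalerDl fD.
Qed.

HB.instance Definition _ := GRing.Zmodule_isLmodule.Build C tensor
  tscaleA tscale1 tscaleDr tscaleDl.

Lemma pure_balanced : balanced pure.
Proof.
split=> [m m' n|m n n'|m b n]; apply: tensorP => V f bf;
  case: (bf) => fDl fDr fB.
- by rewrite tliftD// !tlift_pure.
- by rewrite tliftD// !tlift_pure.
- by rewrite !tlift_pure.
Qed.

Lemma scale_pure c m n : c *: pure m n = pure (c *: m) n.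
Proof.
apply: tensorP => V f bf; rewrite tlift_scale// !tlift_pure//.
exact: balanced_scale.
Qed.

Lemma tensor_sum (t : tensor) : t = \sum_(x <- repr t) pure x.1 x.2.
Proof.
apply: tensorP => V f bf; rewrite {1}/tlift /formal_eval.
elim: (repr t) => [|x s IHs]; first by rewrite !big_nil tlift_zero.
by rewrite !big_cons tliftD// tlift_pure// IHs.
Qed.

Lemma tensor_ind (P : tensor -> Prop) : (forall m n, P (pure m n)) ->
  P 0 -> (forall t u, P t -> P u -> P (t + u)) -> forall t, P t.
Proof.
move=> Pp P0 PD t; rewrite [t]tensor_sum.
by apply: (big_ind P) => // x _; apply: Pp.
Qed.

Lemma tlift0 (V : zmodType) (f : M -> N -> V) : balanced f -> tlift f 0 = 0.
Proof. exact: tlift_zero. Qed.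

(* The span of the [pure m n] with [m] in [P] and [n] in [Q]. *)
Definition tspan (P : M -> Prop) (Q : N -> Prop) (t : tensor) : Prop :=
  exists2 s : seq (M * N),
    (forall x, x \in s -> P x.1 /\ Q x.2) & t = \sum_(x <- s) pure x.1 x.2.

End Tensor.

Notation "V ⊗ W" := (tensor (vs V) (vs W))
  (at level 40, left associativity) : type_scope.
Notation "v ⊗ w" := (@pure _ _ (vs _) (vs _) v w)
  (at level 40, left associativity) : ring_scope.

Notation vlift f t := (@tlift _ _ (vs _) (vs _) _ f t).

Section VectorSpaceTensor.
Context {C : numClosedFieldType}.
Implicit Types (U V W X Y Z : lmodType C).

Definition tmap U V W X (f : U -> W) (g : V -> X) (t : U ⊗ V) : W ⊗ X :=
  vlift (fun u v => f u ⊗ g v) t.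

Definition tprod U V W X Y Z (f : U -> V -> W) (g : X -> Y -> Z)
    (s : U ⊗ X) (t : V ⊗ Y) : W ⊗ Z :=
  vlift (fun u x => vlift (fun v y => f u v ⊗ g x y) t) s.

Definition bilin U V W (f : U -> V -> W) : Prop :=
  (forall v, linear (f^~ v)) /\ (forall u, linear (f u)).

Definition semilin U V (f : U -> V) : Prop :=
  forall c u u', f (c *: u + u') = c^* *: f u + f u'.

Lemma linZ U V (f : U -> V) : linear f -> forall c u, f (c *: u) = c *: f u.
Proof.
move=> lf c u; have f0 : f 0 = 0.
  by apply: (addrI (f 0)); rewrite addr0 -{1}[f 0]scale1r -lf scaler0 addr0.
by rewrite -[c *: u]addr0 lf f0 addr0.
Qed.

Lemma linD U V (f : U -> V) : linear f -> forall u v, f (u + v) = f u + f v.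
Proof. by move=> lf u v; rewrite -[u in LHS]scale1r lf scale1r. Qed.

Lemma semilinZ U V (f : U -> V) : semilin f ->
  forall c u, f (c *: u) = c^* *: f u.
Proof.
move=> lf c u; have f0 : f 0 = 0.
  apply: (addrI (f 0)); rewrite addr0 -{1}[f 0]scale1r -[X in X *: _]conjC1.
  by rewrite -lf scaler0 addr0.
by rewrite -[c *: u]addr0 lf f0 addr0.
Qed.

Lemma semilinD U V (f : U -> V) : semilin f ->
  forall u v, f (u + v) = f u + f v.
Proof. by move=> lf u v; rewrite -[u in LHS]scale1r lf conjC1 scale1r. Qed.

Lemma vpureDl U V (u u' : U) (v : V) : (u + u') ⊗ v = u ⊗ v + u' ⊗ v.
Proof. by have [h _ _] := pure_balanced (vs U) (vs V); apply: h. Qed.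
Lemma vpureDr U V (u : U) (v v' : V) : u ⊗ (v + v') = u ⊗ v + u ⊗ v'.
Proof. by have [_ h _] := pure_balanced (vs U) (vs V); apply: h. Qed.
Lemma vpureZ U V c (u : U) (v : V) : (c *: u) ⊗ v = u ⊗ (c *: v).
Proof. by have [_ _ h] := pure_balanced (vs U) (vs V); apply: (h u c v). Qed.
Lemma vpureZl U V c (u : U) (v : V) : (c *: u) ⊗ v = c *: (u ⊗ v).
Proof. by rewrite scale_pure. Qed.
Lemma vpureZr U V c (u : U) (v : V) : u ⊗ (c *: v) = c *: (u ⊗ v).
Proof. by rewrite -vpureZ vpureZl. Qed.

Lemma balanced_lin U V W X (f : U -> W) (g : V -> X) : linear f -> linear g ->
  balanced (M := vs U) (N := vs V) (fun u v => f u ⊗ g v).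
Proof.
move=> lf lg; split=> [u u' v|u v v'|u c v] /=.
- by rewrite linD// vpureDl.
- by rewrite linD// vpureDr.
- by rewrite (linZ lf) (linZ lg); exact: vpureZ.
Qed.

Lemma balanced_semilin U V W X (f : U -> W) (g : V -> X) :
  semilin f -> semilin g ->
  balanced (M := vs U) (N := vs V) (fun u v => f u ⊗ g v).
Proof.
move=> lf lg; split=> [u u' v|u v v'|u c v] /=.
- by rewrite semilinD// vpureDl.
- by rewrite semilinD// vpureDr.
- by rewrite (semilinZ lf) (semilinZ lg); exact: vpureZ.
Qed.

Lemma tlift_eq (B : algType C) (M N : bimodule B) (V : zmodType)
    (f g : M -> N -> V) t : (forall m n, f m n = g m n) ->
  tlift f t = tlift g t.
Proof. by move=> fg; rewrite /tlift /formal_eval; apply: eq_bigr. Qed.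

Section TProd.
Variables (U V W X Y Z : lmodType C) (f : U -> V -> W) (g : X -> Y -> Z).
Hypotheses (bf : bilin f) (bg : bilin g).

Lemma tprod_bal1 u x :
  balanced (M := vs V) (N := vs Y) (fun v y => f u v ⊗ g x y).
Proof. by apply: balanced_lin; [apply: bf.2|apply: bg.2]. Qed.

Lemma tprod_bal2 t : balanced (M := vs U) (N := vs X)
  (fun u x => vlift (fun v y => f u v ⊗ g x y) t : W ⊗ Z).
Proof.
split=> [u u' x|u x x'|u c x] /=; rewrite /tlift /formal_eval.
- rewrite -big_split; apply: eq_bigr => z _ /=.
  by rewrite (linD (bf.1 _)) vpureDl.
- rewrite -big_split; apply: eq_bigr => z _ /=.
  by rewrite (linD (bg.1 _)) vpureDr.
- apply: eq_bigr => z _ /=.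
  by rewrite (linZ (bf.1 _)) (linZ (bg.1 _)); exact: vpureZ.
Qed.

Lemma tprod_pure u x v y : tprod f g (u ⊗ x) (v ⊗ y) = f u v ⊗ g x y.
Proof.
rewrite /tprod (tlift_pure _ _ (tprod_bal2 _)).
by rewrite (tlift_pure _ _ (tprod_bal1 _ _)).
Qed.

Lemma tprodDl s s' t : tprod f g (s + s') t = tprod f g s t + tprod f g s' t.
Proof. by rewrite /tprod (tliftD _ _ (tprod_bal2 _)). Qed.

Lemma tprodDr s t t' : tprod f g s (t + t') = tprod f g s t + tprod f g s t'.
Proof.
rewrite /tprod {1 3 5}/tlift /formal_eval -big_split; apply: eq_bigr => z _.
by rewrite (tliftD _ _ (tprod_bal1 _ _)).
Qed.

Lemma tprod0l t : tprod f g 0 t = 0.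
Proof. by apply: (addrI (tprod f g 0 t)); rewrite -tprodDl !addr0. Qed.

Lemma tprod0r s : tprod f g s 0 = 0.
Proof. by apply: (addrI (tprod f g s 0)); rewrite -tprodDr !addr0. Qed.

End TProd.
End VectorSpaceTensor.

Record star_alg (C : numClosedFieldType) := StarAlg {
  sa_alg :> algType C;
  star : sa_alg -> sa_alg;
  star_semilin : semilin star;
  starM : forall x y, star (x * y) = star y * star x;
  starK : involutive star
}.

Arguments star {C s}.

Section Coactions.
Context {C : numClosedFieldType}.

Definition coassociative (A F : lmodType C) (Delta : A -> A ⊗ A)
    (delta : F -> A ⊗ F) : Prop := forall f,
  vlift (fun a f0 => a ⊗ delta f0) (delta f) =
  vlift (fun a f0 => vlift (fun a1 a2 => a1 ⊗ (a2 ⊗ f0)) (Delta a)) (delta f)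
    :> (A ⊗ (A ⊗ F))%type.

Definition counital (A F : lmodType C) (eps : A -> C) (delta : F -> A ⊗ F) :=
  forall f, vlift (fun a f0 => eps a *: f0) (delta f) = f.

End Coactions.

Record hopf_star_alg (C : numClosedFieldType) := HopfStarAlg {
  ha_alg :> star_alg C;
  Delta : {linear ha_alg -> (ha_alg ⊗ ha_alg)%type};
  eps : {scalar ha_alg};
  antipode : {linear ha_alg -> ha_alg};
  Delta_coassoc : coassociative Delta Delta;
  Delta_counitl : counital eps Delta;
  Delta_counitr : forall a,
    vlift (fun a1 a2 => eps a2 *: a1) (Delta a) = a;
  DeltaM : forall a b, Delta (a * b) = tprod *%R *%R (Delta a) (Delta b);
  Delta1 : Delta 1 = 1 ⊗ 1;
  epsM : forall a b, eps (a * b) = eps a * eps b;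
  eps1 : eps 1 = 1;
  antipodel : forall a,
    vlift (fun a1 a2 => antipode a1 * a2) (Delta a) = eps a *: 1;
  antipoder : forall a,
    vlift (fun a1 a2 => a1 * antipode a2) (Delta a) = eps a *: 1;
  Delta_star : forall a,
    Delta (star a) = tmap star star (Delta a)
}.

Arguments Delta {C h}.
Arguments eps {C h}.
Arguments antipode {C h}.

Section Cosemisimple.
Context {C : numClosedFieldType} (A : hopf_star_alg C).

Definition subspace (V : lmodType C) (D : V -> Prop) : Prop :=
  D 0 /\ forall c x y, D x -> D y -> D (c *: x + y).

Definition subcoalgebra (D : A -> Prop) : Prop :=
  subspace D /\ forall a, D a -> tspan (M := vs A) (N := vs A) D D (Delta a).

Definition simple_subcoalgebra (D : A -> Prop) : Prop :=
  [/\ subcoalgebra D, exists2 a, D a & a != 0 &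
      forall E : A -> Prop, subcoalgebra E -> (forall a, E a -> D a) ->
        (forall a, E a -> a = 0) \/ (forall a, D a -> E a)].

Definition cosemisimple : Prop := forall a : A, exists2 s : seq A,
  (forall x, x \in s -> exists2 D, simple_subcoalgebra D & D x) &
  a = \sum_(x <- s) x.

End Cosemisimple.

Record cqga (C : numClosedFieldType) := CQGA {
  cqga_hopf :> hopf_star_alg C;
  cqga_cosemisimple : cosemisimple cqga_hopf;
  haar : {scalar cqga_hopf};
  haar1 : haar 1 = 1;
  haarl : forall a,
    vlift (fun a1 a2 => haar a1 *: a2) (Delta a) = haar a *: 1;
  haarr : forall a,
    vlift (fun a1 a2 => haar a2 *: a1) (Delta a) = haar a *: 1;
  haar_pos : forall a, a != 0 -> 0 < haar (star a * a)
}.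

Arguments haar {C c}.

Record hopf_star_map (C : numClosedFieldType) (A H : hopf_star_alg C) :=
  HopfStarMap {
  hm_map :> {lrmorphism A -> H};
  hm_Delta : forall a, Delta (hm_map a) = tmap hm_map hm_map (Delta a);
  hm_eps : forall a, eps (hm_map a) = eps a;
  hm_antipode : forall a, hm_map (antipode a) = antipode (hm_map a);
  hm_star : forall a, hm_map (star a) = star (hm_map a)
}.

Record qhs (C : numClosedFieldType) := QHS {
  qhsA : cqga C;
  qhsH : cqga C;
  qpi : hopf_star_map qhsA qhsH;
  qpi_surj : forall h, exists a, qpi a = h
}.

Section BaseAlgebra.
Context {C : numClosedFieldType} (K : qhs C).
Local Notation A := (qhsA K).
Local Notation H := (qhsH K).
Local Notation pi := (@qpi C K).

Definition id_pi (t : A ⊗ A) : A ⊗ H := tmap idfun pi t.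

Definition coinv : {pred A} := fun a => `[< id_pi (Delta a) = a ⊗ 1 >].

Lemma coinvP a : reflect (id_pi (Delta a) = a ⊗ 1) (a \in coinv).
Proof. exact: asboolP. Qed.

Lemma id_pi_bal :
  balanced (M := vs A) (N := vs A) (fun a b => (a : A) ⊗ pi b).
Proof. by apply: balanced_lin => // c x y; rewrite linearP. Qed.

Lemma id_pi_pure a b : id_pi (a ⊗ b) = a ⊗ pi b.
Proof. exact: (tlift_pure _ _ id_pi_bal). Qed.
Lemma id_piD t u : id_pi (t + u) = id_pi t + id_pi u.
Proof. exact: (tliftD _ _ id_pi_bal). Qed.
Lemma id_pi0 : id_pi 0 = 0.
Proof. exact: (tlift0 id_pi_bal). Qed.
Lemma id_piZ c t : id_pi (c *: t) = c *: id_pi t.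
Proof.
elim/(@tensor_ind _ _ (vs A) (vs A)): t => [a b||t u IHt IHu].
- by rewrite -vpureZl !id_pi_pure vpureZl.
- by rewrite scaler0 id_pi0 scaler0.
- by rewrite scalerDr !id_piD IHt IHu scalerDr.
Qed.

Lemma bilin_mul (D : algType C) : bilin (fun x y : D => x * y).
Proof.
by split=> [y|x] c u v; rewrite ?mulrDl ?mulrDr -?scalerAl -?scalerAr.
Qed.

Lemma id_piM s t : id_pi (tprod *%R *%R s t) =
  tprod *%R *%R (id_pi s) (id_pi t).
Proof.
have bA := bilin_mul A; have bH := bilin_mul H.
elim/(@tensor_ind _ _ (vs A) (vs A)): s => [a b||s s' IHs IHs'].
- elim/(@tensor_ind _ _ (vs A) (vs A)): t => [a' b'||t t' IHt IHt'].
  + by rewrite tprod_pure// !id_pi_pure tprod_pure// rmorphM.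
  + by rewrite tprod0r// !id_pi0 tprod0r.
  + by rewrite tprodDr// !id_piD tprodDr// IHt IHt'.
- by rewrite tprod0l// !id_pi0 tprod0l.
- by rewrite tprodDl// !id_piD tprodDl// IHs IHs'.
Qed.

Lemma id_pi_star t : id_pi (tmap star star t) = tmap star star (id_pi t).
Proof.
have bA : balanced (M := vs A) (N := vs A) (fun u v => star u ⊗ star v).
  by apply: balanced_semilin; apply: star_semilin.
have bH : balanced (M := vs A) (N := vs H) (fun u v => star u ⊗ star v).
  by apply: balanced_semilin; apply: star_semilin.
elim/(@tensor_ind _ _ (vs A) (vs A)): t => [a b||t u IHt IHu].
- rewrite id_pi_pure /tmap (tlift_pure _ _ bA) (tlift_pure _ _ bH).
  by rewrite id_pi_pure hm_star.
- by rewrite id_pi0 /tmap (tlift0 bA) (tlift0 bH) id_pi0.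
- rewrite id_piD /tmap (tliftD _ _ bA) (tliftD _ _ bH) -/(tmap _ _ _).
  by rewrite id_piD IHt IHu.
Qed.

Lemma star1 (D : star_alg C) : star (1 : D) = 1.
Proof. by rewrite -[LHS]mulr1 -[X in _ * X]starK -starM mulr1 starK. Qed.

Fact coinv_subalg : GRing.subalg_closed coinv.
Proof.
split=> [|c x y|x y].
- by apply/coinvP; rewrite Delta1 id_pi_pure rmorph1.
- move=> /coinvP hx /coinvP hy; apply/coinvP.
  by rewrite linearP id_piD id_piZ hx hy vpureDl vpureZl.
- move=> /coinvP hx /coinvP hy; apply/coinvP; rewrite DeltaM id_piM hx hy.
  by rewrite tprod_pure ?mulr1//; apply: bilin_mul.
Qed.

HB.instance Definition _ := GRing.isSubalgClosed.Build C A coinv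
  (GRing.subalg_closed_semi coinv_subalg).

Fact coinv_star a : a \in coinv -> star a \in coinv.
Proof.
move=> /coinvP ha; apply/coinvP; rewrite Delta_star id_pi_star ha.
have bH : balanced (M := vs A) (N := vs H) (fun u v => star u ⊗ star v).
  by apply: balanced_semilin; apply: star_semilin.
by rewrite /tmap (tlift_pure _ _ bH) star1.
Qed.

Record base_type := Base { base_val : A; base_valP : base_val \in coinv }.

HB.instance Definition _ := [isSub for base_val].
HB.instance Definition _ := [Choice of base_type by <:].
HB.instance Definition _ := [SubChoice_isSubAlgebra of base_type by <:].

Definition base_star (b : base_type) : base_type :=
  Base (coinv_star (base_valP b)).

Fact base_star_semilin : semilin base_star.
Proof. by move=> c x y; apply: val_inj; rewrite /= star_semilin. Qed.
Fact base_starM x y : base_star (x * y) = base_star y * base_star x.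
Proof. by apply: val_inj; rewrite /= starM. Qed.
Fact base_starK : involutive base_star.
Proof. by move=> x; apply: val_inj; rewrite /= starK. Qed.

Definition base : star_alg C :=
  StarAlg base_star_semilin base_starM base_starK.

End BaseAlgebra.

(* Delta(b) lies in the image of the injection of A ⊗ B into A ⊗ A; this is
   its preimage. *)
Definition base_coact (C : numClosedFieldType) (K : qhs C) (b : base K) :
    (qhsA K ⊗ base K)%type :=
  xget 0 [set t | tmap idfun (@base_val C K) t = Delta (base_val b)]%classic.

Section LeftModule.
Context {C : numClosedFieldType} {B : algType C} (F : bimodule B).

Definition left_mod : Type := F.
HB.instance Definition _ := GRing.Zmodule.copy left_mod F.

Fact left_scaleA (a b : B) (x : left_mod) :
  lact a (lact b (x : F)) = lact (a * b) (x : F).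
Proof. by rewrite lactA. Qed.
Fact left_scale1 : left_id 1 (lact : B -> left_mod -> left_mod).
Proof. exact: lact1. Qed.
Fact left_scaleDr : right_distributive (lact : B -> left_mod -> left_mod) +%R.
Proof. by move=> b x y; apply: lactDr. Qed.
Fact left_scaleDl (x : left_mod) : {morph (lact (F:=F))^~ x : a b / a + b}.
Proof. by move=> a b; rewrite -[a in LHS]scale1r lactPl scale1r. Qed.
HB.instance Definition _ := GRing.Zmodule_isLmodule.Build B left_mod
  left_scaleA left_scale1 left_scaleDr left_scaleDl.

Definition fingen (P : F -> Prop) : Prop :=
  exists n, exists2 e : 'I_n -> F, (forall i, P (e i)) &
    forall x, P x -> exists b : 'I_n -> B, x = \sum_i lact (b i) (e i).

Definition projective : Prop :=
  forall (M N : lmodType B) (p : {linear M -> N}) (g : {linear left_mod -> N}),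
    (forall y, exists x, p x = y) ->
    exists h : {linear left_mod -> M}, forall x, p (h x) = g x.

Definition left_linear (phi : F -> B) : Prop :=
  (forall x y, phi (x + y) = phi x + phi y) /\
  (forall b x, phi (lact b x) = b * phi x).

End LeftModule.

Section Dual.
Context {C : numClosedFieldType} {B : algType C} (F : bimodule B).

Record dual_type := Dual {
  dual_fun :> F -> B;
  dualP : left_linear dual_fun
}.

Lemma dual_ext (phi psi : dual_type) : (forall x, phi x = psi x) -> phi = psi.
Proof.
case: phi psi => [f hf] [g hg] /= fg; have e : f = g by apply: funext.
by move: hf hg; rewrite e => hf hg; rewrite (Prop_irrelevance hf hg).
Qed.

HB.instance Definition _ := gen_eqMixin dual_type.
HB.instance Definition _ := gen_choiceMixin dual_type.

Lemma dualD (phi : dual_type) x y : phi (x + y) = phi x + phi y.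
Proof. exact: (dualP phi).1. Qed.
Lemma dual_lact (phi : dual_type) b x : phi (lact b x) = b * phi x.
Proof. exact: (dualP phi).2. Qed.
Lemma dual_scale (phi : dual_type) c x : phi (c *: x) = c *: phi x.
Proof.
by rewrite -{1}[x]lact1 -lact_scalel dual_lact -scalerAl mul1r.
Qed.

Fact dual_add_subproof (phi psi : dual_type) :
  left_linear (fun x => phi x + psi x).
Proof.
by split=> [x y|b x]; rewrite ?dualD ?dual_lact ?mulrDr// addrACA.
Qed.
Fact dual_opp_subproof (phi : dual_type) : left_linear (fun x => - phi x).
Proof. by split=> [x y|b x]; rewrite ?dualD ?dual_lact ?mulrN// opprD. Qed.
Fact dual_zero_subproof : left_linear (fun _ : F => 0 : B).
Proof. by split=> [x y|b x]; rewrite ?addr0 ?mulr0. Qed.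
Fact dual_scale_subproof c (phi : dual_type) :
  left_linear (fun x => c *: phi x).
Proof.
by split=> [x y|b x]; rewrite ?dualD ?dual_lact ?scalerDr// scalerAr.
Qed.

Definition dual_add phi psi := Dual (dual_add_subproof phi psi).
Definition dual_opp phi := Dual (dual_opp_subproof phi).
Definition dual_zero := Dual dual_zero_subproof.
Definition dual_scl c phi := Dual (dual_scale_subproof c phi).

Fact dual_addA : associative dual_add.
Proof. by move=> f g h; apply: dual_ext => x /=; rewrite addrA. Qed.
Fact dual_addC : commutative dual_add.
Proof. by move=> f g; apply: dual_ext => x /=; rewrite addrC. Qed.
Fact dual_add0 : left_id dual_zero dual_add.
Proof. by move=> f; apply: dual_ext => x /=; rewrite add0r. Qed.
Fact dual_addN : left_inverse dual_zero dual_opp dual_add.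
Proof. by move=> f; apply: dual_ext => x /=; rewrite addNr. Qed.
HB.instance Definition _ :=
  GRing.isZmodule.Build dual_type dual_addA dual_addC dual_add0 dual_addN.

Fact dual_sclA a b f : dual_scl a (dual_scl b f) = dual_scl (a * b) f.
Proof. by apply: dual_ext => x /=; rewrite scalerA. Qed.
Fact dual_scl1 : left_id 1 dual_scl.
Proof. by move=> f; apply: dual_ext => x /=; rewrite scale1r. Qed.
Fact dual_sclDr : right_distributive dual_scl +%R.
Proof. by move=> c f g; apply: dual_ext => x /=; rewrite scalerDr. Qed.
Fact dual_sclDl f : {morph dual_scl^~ f : a b / a + b}.
Proof. by move=> a b; apply: dual_ext => x /=; rewrite scalerDl. Qed.
HB.instance Definition _ := GRing.Zmodule_isLmodule.Build C dual_type
  dual_sclA dual_scl1 dual_sclDr dual_sclDl.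

Fact dual_lact_subproof (b : B) (phi : dual_type) :
  left_linear (fun x => phi (ract x b)).
Proof.
by split=> [x y|a x]; rewrite ?ractDl ?dualD// lract dual_lact.
Qed.
Fact dual_ract_subproof (phi : dual_type) (b : B) :
  left_linear (fun x => phi x * b).
Proof. by split=> [x y|a x]; rewrite ?dualD ?mulrDl// dual_lact mulrA. Qed.

Definition dual_lactf b phi := Dual (dual_lact_subproof b phi).
Definition dual_ractf phi b := Dual (dual_ract_subproof phi b).

Definition dual : bimodule B.
refine (@Bimodule C B dual_type dual_lactf dual_ractf _ _ _ _ _ _ _ _ _);
  move=> *; apply: dual_ext => z /=.
- by [].
- by rewrite ractPr dualD dual_scale.
- by rewrite ract1.
- by rewrite ractA.
- by rewrite mulrDl.
- by rewrite mulrDr scalerAr.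
- by rewrite mulr1.
- by rewrite mulrA.
- by [].
Defined.

End Dual.

Section Conjugate.
Context {C : numClosedFieldType} {B : star_alg C} (F : bimodule B).

Definition conj_type : Type := F.
HB.instance Definition _ := GRing.Zmodule.copy conj_type F.

Definition conj_scale (c : C) (x : conj_type) : conj_type := c^* *: (x : F).

Fact conj_scaleA a b x : conj_scale a (conj_scale b x) = conj_scale (a * b) x.
Proof. by rewrite /conj_scale scalerA rmorphM. Qed.
Fact conj_scale1 : left_id 1 conj_scale.
Proof. by move=> x; rewrite /conj_scale conjC1 scale1r. Qed.
Fact conj_scaleDr : right_distributive conj_scale +%R.
Proof. by move=> c x y; rewrite /conj_scale; apply: scalerDr. Qed.
Fact conj_scaleDl x : {morph conj_scale^~ x : a b / a + b}.
Proof. by move=> a b; rewrite /conj_scale rmorphD; apply: scalerDl. Qed.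
HB.instance Definition _ := GRing.Zmodule_isLmodule.Build C conj_type
  conj_scaleA conj_scale1 conj_scaleDr conj_scaleDl.

Definition conj_lact (b : B) (x : conj_type) : conj_type :=
  ract (x : F) (star b).
Definition conj_ract (x : conj_type) (b : B) : conj_type :=
  lact (star b) (x : F).

Definition conj_mod : bimodule B.
refine (@Bimodule C B conj_type conj_lact conj_ract _ _ _ _ _ _ _ _ _);
  rewrite /conj_lact /conj_ract.
- by move=> b x y; apply: ractDl.
- by move=> c b b' x; rewrite star_semilin; apply: ractPr.
- by move=> x; rewrite star1 ract1.
- by move=> a b x; rewrite starM ractA.
- by move=> b x y; apply: lactDr.
- by move=> c b b' x; rewrite star_semilin; apply: lactPl.
- by move=> x; rewrite star1 lact1.
- by move=> a b x; rewrite starM lactA.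
- by move=> a x b; rewrite lract.
Defined.

Definition cj (x : F) : conj_mod := x.

End Conjugate.

Definition star_nonneg (C : numClosedFieldType) (B : star_alg C) (b : B) :=
  exists s : seq B, b = \sum_(x <- s) star x * x.

Definition star_pos (C : numClosedFieldType) (B : star_alg C) (b : B) :=
  star_nonneg b /\ b != 0.

(* [h (cj k) f] is the value h(f, k) of the associated sesquilinear form. *)
Record hermitian_module (C : numClosedFieldType) (B : star_alg C)
    (F : bimodule B) (h : conj_mod F -> dual F) : Prop := HermitianModule {
  hermm_fingen : fingen (fun _ : F => True);
  hermm_projective : projective F;
  hermm_add : forall x y, h (x + y) = h x + h y;
  hermm_ract : forall x b, h (ract x b) = ract (h x) b;
  hermm_bij : bijective h;
  hermm_sym : forall f k : F, h (cj k) f = star (h (cj f) k);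
  hermm_pos : forall f : F, f != 0 -> star_pos (h (cj f) f)
}.

Section RelativeHopf.
Context {C : numClosedFieldType} {K : qhs C}.
Local Notation A := (qhsA K).
Local Notation B := (base K).

Definition augm (b : B) : Prop := eps (base_val b) = 0.

Section Object.
Context (F : bimodule B).

Definition augm_lspan (P : F -> Prop) (x : F) : Prop :=
  exists2 s : seq (B * F), (forall z, z \in s -> augm z.1 /\ P z.2) &
    x = \sum_(z <- s) lact z.1 z.2.
Definition augm_rspan (P : F -> Prop) (x : F) : Prop :=
  exists2 s : seq (F * B), (forall z, z \in s -> P z.1 /\ augm z.2) &
    x = \sum_(z <- s) ract z.1 z.2.

Record rel_hopf (delta : F -> A ⊗ F) : Prop := RelHopf {
  rh_linear : linear delta;
  rh_coassoc : coassociative Delta delta;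
  rh_counital : counital eps delta;
  rh_compat : forall b f c, delta (lact b (ract f c)) =
    tprod *%R (@ract C B F)
      (tprod *%R (@lact C B F) (base_coact b) (delta f)) (base_coact c);
  rh_fingen : fingen (fun _ : F => True);
  rh_augm : forall x,
    augm_lspan (fun _ => True) x <-> augm_rspan (fun _ => True) x
}.

Record rel_hopf_sub (delta : F -> A ⊗ F) (P : F -> Prop) : Prop := RelHopfSub {
  rhs_subspace : subspace P;
  rhs_lact : forall b x, P x -> P (lact b x);
  rhs_ract : forall x b, P x -> P (ract x b);
  rhs_coact : forall x, P x ->
    tspan (M := vs A) (N := vs F) (fun _ => True) P (delta x);
  rhs_fingen : fingen P;
  rhs_augm : forall x, augm_lspan P x <-> augm_rspan P x
}.

(* [P] is a subobject of [F] that is a simple object of the category. *)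
Definition irreducible_sub (delta : F -> A ⊗ F) (P : F -> Prop) : Prop :=
  [/\ rel_hopf_sub delta P, exists2 x, P x & x != 0 &
      forall Q : F -> Prop, rel_hopf_sub delta Q -> (forall x, Q x -> P x) ->
        (forall x, Q x -> x = 0) \/ (forall x, P x -> Q x)].

(* dim Phi(F) = n, with Phi(F) the quotient of F by B^+ F: some [n] vectors
   become a basis modulo B^+ F. *)
Definition dim_Phi (n : nat) : Prop :=
  exists v : 'I_n -> F, forall f, exists! c : 'rV[C]_n,
    augm_lspan (fun _ => True) (f - \sum_i c ord0 i *: v i).

End Object.

Record rel_hopf_mor (F G : bimodule B) (deltaF : F -> A ⊗ F)
    (deltaG : G -> A ⊗ G) (u : F -> G) : Prop := RelHopfMor {
  rhm_linear : linear u;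
  rhm_lact : forall b f, u (lact b f) = lact b (u f);
  rhm_ract : forall f b, u (ract f b) = ract (u f) b;
  rhm_coact : forall f, deltaG (u f) = tmap idfun u (deltaF f)
}.

Definition conj_coact (F : bimodule B) (delta : F -> A ⊗ F)
    (f : conj_mod F) : A ⊗ conj_mod F :=
  vlift (fun (a : A) (x : F) => star a ⊗ cj x) (delta f).

(* A coaction on the dual for which it is the right dual of [F]: evaluation
   F ⊗_B dual F -> B is a comodule map. *)
Definition dual_coaction (F : bimodule B) (delta : F -> A ⊗ F)
    (delta' : dual F -> A ⊗ dual F) : Prop :=
  rel_hopf delta' /\
  forall (f : F) (phi : dual F),
    tprod *%R (fun (x : F) (psi : dual F) => psi x) (delta f) (delta' phi) =
    base_coact (phi f).

Definition hermitian_rel_hopf (F : bimodule B) (delta : F -> A ⊗ F)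
    (h : conj_mod F -> dual F) : Prop :=
  [/\ rel_hopf delta, hermitian_module h &
      exists2 delta' : dual F -> A ⊗ dual F, dual_coaction delta delta' &
        rel_hopf_mor (conj_coact delta) delta' h].

End RelativeHopf.

(* The grading is given by the projections [deg k] onto its summands: Om^k is
   the set of the [w] with [deg k w = w]. [emb] identifies B with Om^0. *)
Record calculus (C : numClosedFieldType) (B : algType C) := Calculus {
  cal_alg :> algType C;
  emb : {lrmorphism B -> cal_alg};
  deg : nat -> {linear cal_alg -> cal_alg};
  dif : {linear cal_alg -> cal_alg};
  deg_deg : forall k l w, deg k (deg l w) = if k == l then deg k w else 0;
  deg_sum : forall w, exists m, w = \sum_(k < m) deg k w;
  emb_inj : injective emb;
  deg0P : forall w, deg 0 w = w <-> exists b, w = emb b;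
  degM : forall k l v w, deg k v = v -> deg l w = w ->
    deg (k + l) (v * w) = v * w;
  deg_dif : forall k w, deg k w = w -> deg k.+1 (dif w) = dif w;
  dif_dif : forall w, dif (dif w) = 0;
  difM : forall k v w, deg k v = v ->
    dif (v * w) = dif v * w + (-1) ^+ k *: (v * dif w);
  cal_gen : forall P : cal_alg -> Prop,
    (forall b, P (emb b)) -> (forall b, P (dif (emb b))) ->
    (forall c v w, P v -> P w -> P (c *: v + w)) ->
    (forall v w, P v -> P w -> P (v * w)) -> forall w, P w
}.

Section CalculusBimodule.
Context {C : numClosedFieldType} {B : algType C} (Om : calculus B).

Definition total_degree (m : nat) : Prop :=
  (exists2 w : Om, deg Om m w = w & w != 0) /\
  (forall k (w : Om), (m < k)%N -> deg Om k w = 0).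

Definition cal_lact (b : B) (w : Om) : Om := emb Om b * w.
Definition cal_ract (w : Om) (b : B) : Om := w * emb Om b.

Definition cal_mod : bimodule B.
refine (@Bimodule C B Om cal_lact cal_ract _ _ _ _ _ _ _ _ _);
  rewrite /cal_lact /cal_ract.
- by move=> b x y; rewrite mulrDr.
- by move=> c b b' x; rewrite linearP mulrDl scalerAl.
- by move=> x; rewrite rmorph1 mul1r.
- by move=> a b x; rewrite rmorphM mulrA.
- by move=> b x y; rewrite mulrDl.
- by move=> c b b' x; rewrite linearP mulrDr scalerAr.
- by move=> x; rewrite rmorph1 mulr1.
- by move=> a b x; rewrite rmorphM mulrA.
- by move=> a x b; rewrite mulrA.
Defined.

End CalculusBimodule.

Record star_calculus (C : numClosedFieldType) (B : star_alg C) :=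
  StarCalculus {
  sc_cal :> calculus B;
  cstar : sc_cal -> sc_cal;
  cstar_semilin : semilin cstar;
  cstarK : involutive cstar;
  cstar_emb : forall b, cstar (emb sc_cal b) = emb sc_cal (star b);
  cstar_dif : forall w, dif sc_cal (cstar w) = cstar (dif sc_cal w);
  cstarM : forall k l v w, deg sc_cal k v = v -> deg sc_cal l w = w ->
    cstar (v * w) = (-1) ^+ (k * l) *: (cstar w * cstar v)
}.

(* Likewise [bideg a b] is the projection onto Om^(a,b). *)
Record complex_structure (C : numClosedFieldType) (B : star_alg C)
    (Om : star_calculus B) := ComplexStructure {
  bideg : nat -> nat -> {linear Om -> Om};
  bideg_bideg : forall a b a' b' w,
    bideg a b (bideg a' b' w) =
    if (a == a') && (b == b') then bideg a b w else 0;
  deg_bideg : forall k w, deg Om k w = \sum_(a < k.+1) bideg a (k - a) w;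
  bidegM : forall a b a' b' v w, bideg a b v = v -> bideg a' b' w = w ->
    bideg (a + a') (b + b') (v * w) = v * w;
  bideg_star : forall a b w, bideg a b w = w ->
    bideg b a (cstar w) = cstar w;
  bideg_dif : forall a b w, bideg a b w = w ->
    dif Om w = bideg a.+1 b (dif Om w) + bideg a b.+1 (dif Om w)
}.

Section HermitianStructure.
Context {C : numClosedFieldType} {B : star_alg C} {Om : star_calculus B}.
Variable cs : complex_structure Om.

Definition form_mul (t : tensor (cal_mod Om) (cal_mod Om)) : Om :=
  tlift (fun v w : cal_mod Om => (v : Om) * (w : Om)) t.

(* Each [Om^(a,b)] is a direct summand of [Om] as a bimodule, so the tensor
   product of two of them over [B] is the span of the corresponding pure
   tensors inside the tensor square of [Om]. *)
Definition mul_iso (P Q R : Om -> Prop) : Prop :=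
  (forall t, tspan (M := cal_mod Om) (N := cal_mod Om) P Q t ->
     form_mul t = 0 -> t = 0) /\
  (forall w, R w <->
     exists2 t, tspan (M := cal_mod Om) (N := cal_mod Om) P Q t &
       form_mul t = w).

Definition bihom a b (w : Om) : Prop := bideg cs a b w = w.

Definition factorisable_cs : Prop := forall a b,
  mul_iso (bihom a 0) (bihom 0 b) (bihom a b) /\
  mul_iso (bihom 0 b) (bihom a 0) (bihom a b).

(* The component of [dif] of bidegree (0,1), for a calculus of total degree at
   most [m]. *)
Definition delbar (m : nat) (w : Om) : Om :=
  \sum_(a < m.+1) \sum_(b < m.+1) bideg cs a b.+1 (dif Om (bideg cs a b w)).

Variables (n : nat) (sigma : Om).

Definition lefschetz (w : Om) : Om := sigma * w.

Record hermitian_structure : Prop := HermitianStructure {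
  sigma_bideg : bideg cs 1 1 sigma = sigma;
  sigma_central : forall w, sigma * w = w * sigma;
  sigma_real : cstar sigma = sigma;
  lefschetz_inj : forall k w, (k < n)%N -> deg Om k w = w ->
    iter (n - k) lefschetz w = 0 -> w = 0;
  lefschetz_surj : forall k v, (k < n)%N -> deg Om (n.*2 - k) v = v ->
    exists2 w, deg Om k w = w & iter (n - k) lefschetz w = v
}.

Definition primitive a b (w : Om) : Prop :=
  if (a + b <= n)%N then
    bideg cs a b w = w /\ iter (n - (a + b)).+1 lefschetz w = 0
  else w = 0.

(* At most one map satisfies this, by the Lefschetz decomposition. *)
Definition hodge_map (hs : Om -> Om) : Prop :=
  [/\ linear hs,
      forall b w c, hs (emb Om b * w * emb Om c) =
        emb Om b * hs w * emb Om c &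
      forall a b w j, primitive a b w -> (j + (a + b) <= n)%N ->
        hs (iter j lefschetz w) =
        ((-1) ^+ ((a + b) * (a + b).+1)./2 * 'i ^ (a%:Z - b%:Z) *
          (j`!%:R / (n - j - (a + b))`!%:R)) *:
        iter (n - j - (a + b)) lefschetz w].

(* Sesquilinear over the degree decomposition, so that forms of different
   degrees are orthogonal. *)
Definition metric (hs : Om -> Om) (v w : Om) : Om :=
  \sum_(k < n.*2.+1) hs (deg Om k v * hs (cstar (deg Om k w))).

End HermitianStructure.

Section Covariance.
Context {C : numClosedFieldType} {K : qhs C} {Om : star_calculus (base K)}.
Local Notation A := (qhsA K).
Variable delta : Om -> A ⊗ Om.

Record covariant_calculus : Prop := CovariantCalculus {
  cov_linear : linear delta;
  cov_coassoc : coassociative Delta delta;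
  cov_counital : counital eps delta;
  cov_mul : forall v w, delta (v * w) = tprod *%R *%R (delta v) (delta w);
  cov_emb : forall b, delta (emb Om b) =
    tmap idfun (emb Om) (base_coact b);
  cov_dif : forall w, delta (dif Om w) = tmap idfun (dif Om) (delta w)
}.

Definition covariant_cs (cs : complex_structure Om) : Prop :=
  forall a b w, bihom cs a b w ->
    tspan (M := vs A) (N := vs Om) (fun _ => True) (bihom cs a b) (delta w).

End Covariance.

Record cqh_hermitian (C : numClosedFieldType) := CQHHermitian {
  cqh_qhs : qhs C;
  cqh_om : star_calculus (base cqh_qhs);
  cqh_coact : cqh_om -> (qhsA cqh_qhs ⊗ cqh_om)%type;
  cqh_cov : covariant_calculus cqh_coact;
  cqh_mod0 : rel_hopf (F := cal_mod cqh_om) cqh_coact;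
  cqh_n : nat;
  cqh_n_gt0 : (0 < cqh_n)%N;
  cqh_total : total_degree cqh_om cqh_n.*2;
  cqh_cs : complex_structure cqh_om;
  cqh_cov_cs : covariant_cs cqh_coact cqh_cs;
  cqh_sigma : cqh_om;
  cqh_herm : hermitian_structure cqh_cs cqh_n cqh_sigma;
  cqh_cov_sigma : cqh_coact cqh_sigma = 1 ⊗ cqh_sigma;
  cqh_hodge : cqh_om -> cqh_om;
  cqh_hodgeP : hodge_map cqh_cs cqh_n cqh_sigma cqh_hodge;
  cqh_closed : forall w b, deg cqh_om cqh_n.*2.-1 w = w ->
    emb cqh_om b = cqh_hodge (dif cqh_om w) -> haar (base_val b) = 0;
  cqh_metric : exists2 h : conj_mod (cal_mod cqh_om) -> dual (cal_mod cqh_om),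
    hermitian_module h &
    forall v w : cqh_om, emb cqh_om (h (cj (F := cal_mod cqh_om) w) v) =
      metric cqh_n cqh_hodge v w
}.

Section CQH.
Context {C : numClosedFieldType} (X : cqh_hermitian C).

Definition kaehler : Prop := dif (cqh_om X) (cqh_sigma X) = 0.
Definition factorisable : Prop := factorisable_cs (cqh_cs X).
Definition irreducible : Prop :=
  irreducible_sub (F := cal_mod (cqh_om X)) (@cqh_coact C X)
    (bihom (cqh_cs X) 1 0).

End CQH.

Section Connections.
Context {C : numClosedFieldType} (X : cqh_hermitian C).
Local Notation B := (base (cqh_qhs X)).
Local Notation A := (qhsA (cqh_qhs X)).
Local Notation Om := (cqh_om X).
Local Notation n := (cqh_n X).
Context (F : bimodule B).

(* All of Om^• ⊗_B F. As Om^k is a direct summand of Om^• as a bimodule,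
   Om^k ⊗_B F is the span of the pure tensors with left leg in Om^k. *)
Definition mforms : lmodType C := tensor (cal_mod Om) F.

Definition mform (w : Om) (f : F) : mforms := pure (M := cal_mod Om) w f.

Definition wedge (w : Om) (t : mforms) : mforms :=
  tlift (fun (v : cal_mod Om) f => mform (w * v) f) t.

(* The grading involution, w |-> (-1)^|w| w. *)
Definition gsign (w : Om) : Om :=
  \sum_(k < n.*2.+1) (-1) ^+ k *: deg Om k w.

(* [dd] and [P] are the differential and the space of 1-forms: [dif] and
   [Om^1], or [delbar] and [Om^(0,1)]. *)
Definition connection (dd : Om -> Om) (P : Om -> Prop) (nabla : F -> mforms) :=
  [/\ linear nabla,
      forall f, tspan (M := cal_mod Om) (N := F) P (fun _ => True) (nabla f) &
      forall b f, nabla (lact b f) =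
        mform (dd (emb Om b)) f + wedge (emb Om b) (nabla f)].

Definition conn_ext (dd : Om -> Om) (nabla : F -> mforms) (t : mforms) :
    mforms :=
  tlift (fun (w : cal_mod Om) f => mform (dd w) f + wedge (gsign w) (nabla f)) t.

Definition curvature (dd : Om -> Om) (nabla : F -> mforms) (f : F) : mforms :=
  conn_ext dd nabla (nabla f).

Definition one_form (w : Om) : Prop := deg Om 1 w = w.
Definition delb : Om -> Om := delbar (cqh_cs X) n.*2.

Definition holomorphic (dbF : F -> mforms) : Prop :=
  [/\ fingen (fun _ : F => True), projective F,
      connection delb (bihom (cqh_cs X) 0 1) dbF &
      forall f, curvature delb dbF f = 0].

Definition mforms_coact (delta : F -> A ⊗ F) (t : mforms) :
    (A ⊗ mforms)%type :=
  tlift (fun (w : cal_mod Om) f => tprod *%R mform (cqh_coact w) (delta f)) t.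

Definition holomorphic_rel_hopf (delta : F -> A ⊗ F) (dbF : F -> mforms) :=
  [/\ rel_hopf delta, holomorphic dbF &
      forall f, mforms_coact delta (dbF f) = tmap idfun dbF (delta f)].

Definition herm_pairing (h : conj_mod F -> dual F) (t u : mforms) : Om :=
  tlift (fun (w : cal_mod Om) f => tlift (fun (v : cal_mod Om) g =>
    (w : Om) * emb Om (h (cj g) f) * cstar (v : Om)) u) t.

Definition chern_connection (h : conj_mod F -> dual F) (dbF : F -> mforms)
    (nabla : F -> mforms) : Prop :=
  [/\ connection (dif Om) one_form nabla,
      forall f g, dif Om (emb Om (h (cj g) f)) =
        herm_pairing h (nabla f) (mform 1 g) +
        herm_pairing h (mform 1 f) (nabla g) &
      forall f, dbF f =
        tlift (fun (w : cal_mod Om) k => mform (bideg (cqh_cs X) 0 1 w) k)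
          (nabla f)].

Definition flat_conn (nabla : F -> mforms) : Prop :=
  forall f, curvature (dif Om) nabla f = 0.

(* In a [numClosedFieldType] [0 < theta] entails that [theta] is real. *)
Definition positive_conn (nabla : F -> mforms) : Prop :=
  exists2 theta : C, 0 < theta &
    forall f, curvature (dif Om) nabla f =
      (- theta * 'i) *: mform (cqh_sigma X) f.

Definition negative_conn (nabla : F -> mforms) : Prop :=
  exists2 theta : C, 0 < theta &
    forall f, curvature (dif Om) nabla f =
      (theta * 'i) *: mform (cqh_sigma X) f.

End Connections.

Record herm_hol_line (C : numClosedFieldType) (X : cqh_hermitian C) :=
  HermHolLine {
  line_mod :> bimodule (base (cqh_qhs X));
  line_coact : line_mod -> (qhsA (cqh_qhs X) ⊗ line_mod)%type;
  line_dim : dim_Phi line_mod 1;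
  line_h : conj_mod line_mod -> dual line_mod;
  line_hermitian : hermitian_rel_hopf line_coact line_h;
  line_delbar : line_mod -> mforms line_mod;
  line_holomorphic : holomorphic_rel_hopf line_coact line_delbar
}.

Arguments line_coact {C X} E _ : rename.
Arguments line_h {C X} E _ : rename.
Arguments line_delbar {C X} E _ : rename.

Definition exactly_one (P Q R : Prop) : Prop :=
  [\/ P, Q | R] /\ [/\ ~ (P /\ Q), ~ (P /\ R) & ~ (Q /\ R)].

(* Main.v *)
Require Import Defs.
From mathcomp Require Import all_boot all_order all_algebra.
From mathcomp Require Import reals complex.
From HB Require Import structures.
From mathcomp Require Import boolp classical_sets.

(* For a line module the curvature form [S(e, g) = h(nabla^2 e, g)] is
   sesquilinear over B and covariant, so modulo B^+ it is a multiple of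
   [h(e, g)]; covariance propagates this from the fibre to
   [S(e, g) = h(e, g) rho] with [rho] a single A-coinvariant, hence central,
   form. It has bidegree (1,1), since its (0,2)-part is the curvature of the
   flat (0,1)-connection and [S(e, g)^* = - S(g, e)]. By factorisability [rho]
   is the product of a tensor in Om^(0,1) ⊗_B Om^(1,0), and contracting with it
   (by means of the metric) is an endomorphism of the simple object Om^(1,0),
   which is a scalar by Schur's lemma. The contraction determines [rho], so the
   coinvariant (1,1)-forms are one-dimensional and spanned by [sigma]. Hence the
   curvature is [k sigma ⊗ e], and [S(e, g)^* = - S(g, e)] makes [k] imaginary.

   Exactness of the fibre functor enters only through an explicit left inverse
   of [F -> A ⊗ F / B^+ F], built from the Haar functional of H ([unfiber]). *)

(** Neither the Chern connection nor the Hodge map nor the star on forms is colinear by definition;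
    each case of colinearity is derived where it is used. For the connection this is done on scalar
    forms: the Hermitian condition expresses h(nabla e, g) through the metric and the
    (0,1)-connection, both covariant. The curvature also involves h(nabla e, nabla g), where a frame
    has to be inserted between the two factors; this is harmless because the Casimir element of the
    frame is coinvariant. A tensor representing [rho] is not visibly coinvariant. Averaging it with
    the Haar functional of A makes it so and keeps its product, so injectivity of the multiplication
    is needed only to see that the averaged tensor commutes with B. Schur's lemma must produce an
    eigenvalue without a basis of the fibre: only generators over B are at hand, so coordinates are
    not unique, and Nakayama's lemma replaces the passage to the fibre. *)

Set Implicit Arguments.
Unset Strict Implicit.
Unset Printing Implicit Defensive.

Import Order.TTheory GRing.Theory Num.Theory.
Local Open Scope ring_scope.

(** * Sweedler sums *)

(* [\sw_(a, x <- delta w) f a x] is [f (w_(-1), w_(0))] in Sweedler notation. *)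
Notation "'\sw_' ( a , x <- t ) F" := (vlift (fun a x => F) t)
  (at level 41, F at level 41, a name, x name, t at level 50,
   format "'[' \sw_ ( a ,  x  <-  t ) '/  '  F ']'") : ring_scope.

(** * Closure properties of linear maps *)

Section Linear.
Context {C : numClosedFieldType}.
Implicit Types (U V W X : lmodType C).

Lemma lin_id U : linear (fun x : U => x).
Proof. by []. Qed.

Lemma lin0 U V (f : U -> V) : linear f -> f 0 = 0.
Proof. by move=> lf; have := linZ lf 0 0; rewrite !scale0r. Qed.

Lemma lin_add U V (f g : U -> V) : linear f -> linear g ->
  linear (fun x => f x + g x).
Proof. by move=> lf lg c x y; rewrite lf lg scalerDr addrACA. Qed.

Lemma lin_opp U V (f : U -> V) : linear f -> linear (fun x => - f x).
Proof. by move=> lf c x y; rewrite lf opprD scalerN. Qed.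

Lemma lin_scale U V c (f : U -> V) : linear f -> linear (fun x => c *: f x).
Proof. by move=> lf a x y; rewrite lf scalerDr !scalerA mulrC. Qed.

Lemma lin_scalel U V (f : U -> C^o) (v : V) : linear f ->
  linear (fun x => (f x : C) *: v).
Proof. by move=> lf a x y; rewrite lf scalerDl scalerA. Qed.

Lemma lin_mull U (A : algType C) (f : U -> A) (b : A) : linear f ->
  linear (fun x => f x * b).
Proof. by move=> lf a x y; rewrite lf mulrDl -scalerAl. Qed.

Lemma lin_mulr U (A : algType C) (f : U -> A) (b : A) : linear f ->
  linear (fun x => b * f x).
Proof. by move=> lf a x y; rewrite lf mulrDr -scalerAr. Qed.

Lemma lin_purel U V W (f : U -> V) (w : W) : linear f ->
  linear (fun x => f x ⊗ w).
Proof. by move=> lf a x y; rewrite lf vpureDl vpureZl. Qed.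

Lemma lin_purer U V W (f : U -> V) (w : W) : linear f ->
  linear (fun x => w ⊗ f x).
Proof. by move=> lf a x y; rewrite lf vpureDr vpureZr. Qed.

Lemma lin_lactl U (B : algType C) (F : bimodule B) (f : U -> B) (x : F) :
  linear f -> linear (fun u => lact (f u) x).
Proof. by move=> lf a u v; rewrite lf lactPl. Qed.

Lemma lin_lactr U (B : algType C) (F : bimodule B) (f : U -> F) (b : B) :
  linear f -> linear (fun u => lact b (f u)).
Proof. by move=> lf a u v; rewrite lf lactDr lact_scaler. Qed.

Lemma lin_ractl U (B : algType C) (F : bimodule B) (f : U -> F) (b : B) :
  linear f -> linear (fun u => ract (f u) b).
Proof. by move=> lf a u v; rewrite lf ractDl ract_scalel. Qed.

Lemma lin_ractr U (B : algType C) (F : bimodule B) (f : U -> B) (x : F) :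
  linear f -> linear (fun u => ract x (f u)).
Proof. by move=> lf a u v; rewrite lf ractPr. Qed.

Lemma lin_comp U V W (g : V -> W) (f : U -> V) : linear g -> linear f ->
  linear (fun x => g (f x)).
Proof. by move=> lg lf c x y; rewrite lf lg. Qed.

Lemma lin_dual U (B : algType C) (F : bimodule B) (phi : dual F) (f : U -> F) :
  linear f -> linear (fun u => phi (f u)).
Proof. by move=> lf c x y; rewrite lf dualD dual_scale. Qed.

Lemma lin_sum U V (I : Type) (r : seq I) (P : pred I) (f : I -> U -> V) :
  (forall i, linear (f i)) -> linear (fun x => \sum_(i <- r | P i) f i x).
Proof.
move=> lf c x y; rewrite scaler_sumr -big_split; apply: eq_bigr => i _.
exact: lf.
Qed.

Lemma bilin_balanced U V W (f : U -> V -> W) :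
  (forall v, linear (f^~ v)) -> (forall u, linear (f u)) ->
  balanced (M := vs U) (N := vs V) f.
Proof.
move=> fl fr; split=> [u u' v|u v v'|u c v] /=.
- exact: (linD (fl v)).
- exact: (linD (fr u)).
- by rewrite (linZ (fl v)) (linZ (fr u)).
Qed.

Lemma lin_swf U V W X (f : X -> U -> V -> W) (t : U ⊗ V) :
  (forall u v, linear (fun x => f x u v)) -> linear (fun x => vlift (f x) t).
Proof.
move=> lf c x y; rewrite /tlift /formal_eval scaler_sumr -big_split.
by apply: eq_bigr => p _; exact: lf.
Qed.

Lemma lin_swt U V W X (f : U -> V -> W) (g : X -> (U ⊗ V)%type) :
  (forall v, linear (f^~ v)) -> (forall u, linear (f u)) -> linear g ->
  linear (fun x => vlift f (g x)).
Proof.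
move=> fl fr lg c x y; rewrite lg; have bf := bilin_balanced fl fr.
rewrite (tliftD _ _ bf); congr (_ + _).
rewrite (tlift_scale _ _ bf) /tlift /formal_eval scaler_sumr.
by apply: eq_bigr => p _; rewrite (linZ (fl _)).
Qed.

End Linear.

(* Besides the structural rules, [lin_tac] uses the linearity facts found in the
   context, which is why proofs record some that they never name again. *)
Ltac lin_tac := cbv beta;
  first
  [ assumption
  | match goal with
    | H : forall _, _ |- _ => solve [exact: H]
    end
  | match goal with
  | |- forall _, _ => intro; lin_tac
  | |- @GRing.linear_for ?R ?U ?V ?s (@GRing.mul ?A ?u) =>
     change (@GRing.linear_for R U V s (fun x => @GRing.mul A u x)); lin_tac
  | |- @GRing.linear_for ?R ?U ?V ?s (@pure ?C ?B ?M ?N ?u) =>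
     change (@GRing.linear_for R U V s (fun x => @pure C B M N u x)); lin_tac
  | |- @GRing.linear_for ?R ?U ?V ?s (@lact ?C ?B ?M ?u) =>
     change (@GRing.linear_for R U V s (fun x => @lact C B M u x)); lin_tac
  | |- @GRing.linear_for ?R ?U ?V ?s (@ract ?C ?B ?M ?u) =>
     change (@GRing.linear_for R U V s (fun x => @ract C B M u x)); lin_tac
  | |- @GRing.linear_for ?R ?U ?V ?s (@GRing.scale ?A ?M ?u) =>
     change (@GRing.linear_for R U V s (fun x => @GRing.scale A M u x)); lin_tac
  | |- @GRing.linear_for ?R ?U ?V ?s (@tlift ?C ?B ?M ?N ?Z ?u) =>
     change (@GRing.linear_for R U V s (fun x => @tlift C B M N Z u x)); lin_tac
  | |- @GRing.linear_for _ _ _ _ (fun x => x) => exact: lin_id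
  | |- @GRing.linear_for _ _ _ _ (fun x => _ + _) => apply: lin_add; lin_tac
  | |- @GRing.linear_for _ _ _ _ (fun x => - _) => apply: lin_opp; lin_tac
  | |- @GRing.linear_for _ _ _ _ (fun x => \sum_(i <- _ | _) _) => apply:
    lin_sum; lin_tac
  | |- @GRing.linear_for _ _ _ _ (fun x => _ *: _) =>
     first [apply: lin_scale; lin_tac | apply: lin_scalel; lin_tac]
  | |- @GRing.linear_for _ _ _ _ (fun x => _ * _) =>
     first [apply: lin_mull; lin_tac | apply: lin_mulr; lin_tac]
  | |- @GRing.linear_for _ _ _ _ (fun x => @pure _ _ _ _ _ _) =>
     first [apply: lin_purel; lin_tac | apply: lin_purer; lin_tac]
  | |- @GRing.linear_for _ _ _ _ (fun x => @lact _ _ _ _ _) =>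
     first [apply: lin_lactl; lin_tac | apply: lin_lactr; lin_tac]
  | |- @GRing.linear_for _ _ _ _ (fun x => @ract _ _ _ _ _) =>
     first [apply: lin_ractl; lin_tac | apply: lin_ractr; lin_tac]
  | |- @GRing.linear_for _ _ _ _ (fun x => @dual_fun _ _ _ _ _) =>
     apply: lin_dual; lin_tac
  | |- @GRing.linear_for _ _ _ _ (fun x => @tlift _ _ _ _ _ _ _) =>
     first [apply: lin_swf; lin_tac | apply: lin_swt; lin_tac]
  | |- @GRing.linear_for _ _ _ _ (fun x => ?g (@?f x)) =>
     lazymatch f with (fun x => x) => fail | _ => idtac end;
     first [refine (@lin_comp _ _ _ _ g f _ _) |
            refine (@lin_comp _ _ _ _ _ f _ _)]; lin_tac
  | |- @GRing.linear_for _ _ _ _ (fun x => ?g (@?f x) ?y) =>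
     lazymatch f with (fun x => x) => fail | _ => idtac end;
     refine (@lin_comp _ _ _ _ (fun z => g z y) f _ _); lin_tac
  | |- @GRing.linear_for _ _ _ _ (fun x => ?g (@?f x) ?y ?z) =>
     lazymatch f with (fun x => x) => fail | _ => idtac end;
     refine (@lin_comp _ _ _ _ (fun t => g t y z) f _ _); lin_tac
  | |- @GRing.linear_for _ _ _ _ _ => exact: linearP
  end ].

(** * Rules for computing with Sweedler sums *)

Section Sweedler.
Context {C : numClosedFieldType}.
Implicit Types (U V W X : lmodType C).

(** Holds by definition, as [tlift] sums over a chosen representative. Hence sums over a fixed
    tensor can be exchanged and compared termwise for arbitrary [f]; bilinearity is needed only to
    rewrite the tensor itself. *)
Lemma swE U V (W : zmodType) (f : U -> V -> W) (t : U ⊗ V) :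
  vlift f t = \sum_(p <- repr t) f p.1 p.2.
Proof. by []. Qed.

Lemma sw_exchange U V U' V' W (f : U -> V -> U' -> V' -> W) (t : U ⊗ V)
    (s : U' ⊗ V') :
  \sw_(a, x <- t) \sw_(b, y <- s) f a x b y =
  \sw_(b, y <- s) \sw_(a, x <- t) f a x b y.
Proof. exact: exchange_big. Qed.

Lemma eq_sw U V (W : zmodType) (f g : U -> V -> W) (t : U ⊗ V) :
  (forall a x, f a x = g a x) -> vlift f t = vlift g t.
Proof. by move=> fg; rewrite !swE; apply: eq_bigr. Qed.

Lemma sw_pure U V W (f : U -> V -> W) u v :
  (forall v, linear (f^~ v)) -> (forall u, linear (f u)) ->
  vlift f (u ⊗ v) = f u v.
Proof. by move=> fl fr; rewrite (tlift_pure _ _ (bilin_balanced fl fr)). Qed.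

Lemma sw_sum U V W (f : U -> V -> W) (I : Type) (r : seq I)
    (t : I -> (U ⊗ V)%type) :
  (forall v, linear (f^~ v)) -> (forall u, linear (f u)) ->
  vlift f (\sum_(i <- r) t i) = \sum_(i <- r) vlift f (t i).
Proof.
move=> fl fr; have bf := bilin_balanced fl fr.
elim: r => [|i r IHr]; first by rewrite !big_nil (tlift0 bf).
by rewrite !big_cons (tliftD _ _ bf) IHr.
Qed.

Lemma sw_sw U V U' V' W (f : U -> V -> W) (u : U' -> V' -> U)
  (v : U' -> V' -> V)
    (t : U' ⊗ V') :
  (forall v, linear (f^~ v)) -> (forall u, linear (f u)) ->
  vlift f (\sw_(a, x <- t) u a x ⊗ v a x) = \sw_(a, x <- t) f (u a x) (v a x).
Proof.
move=> fl fr.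
rewrite -[LHS]/(vlift f (\sum_(p <- repr t) u p.1 p.2 ⊗ v p.1 p.2)) sw_sum//.
by apply: eq_bigr => p _; rewrite sw_pure.
Qed.

Lemma sw_id U V (t : U ⊗ V) : \sw_(a, x <- t) a ⊗ x = t.
Proof. by rewrite [RHS]tensor_sum. Qed.

Lemma lin_sumE U V (f : U -> V) (I : Type) (r : seq I) (g : I -> U) :
  linear f -> f (\sum_(i <- r) g i) = \sum_(i <- r) f (g i).
Proof.
move=> lf; elim: r => [|i r IHr].
  by rewrite !big_nil; have := linZ lf 0 0; rewrite !scale0r.
by rewrite !big_cons (linD lf) IHr.
Qed.

Lemma lin_sw U V W X (f : W -> X) (g : U -> V -> W) (t : U ⊗ V) :
  linear f -> f (vlift g t) = \sw_(a, x <- t) f (g a x).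
Proof. by move=> lf; rewrite swE lin_sumE. Qed.

Lemma lin_tmap U V W X (f : U -> W) (g : V -> X) : linear f -> linear g ->
  linear (@tmap C U V W X f g).
Proof. by move=> lf lg; rewrite /tmap; lin_tac. Qed.

Lemma tmap_pure U V W X (f : U -> W) (g : V -> X) u v : linear f -> linear g ->
  tmap f g (u ⊗ v) = f u ⊗ g v.
Proof. by move=> lf lg; rewrite /tmap sw_pure//; lin_tac. Qed.

Lemma tmap_sw U V W X U' V' (f : U -> W) (g : V -> X) (u : U' -> V' -> U)
  (v : U' -> V' -> V) (t : U' ⊗ V') : linear f -> linear g ->
  tmap f g (\sw_(a, x <- t) u a x ⊗ v a x) = \sw_(a, x <- t) f (u a x) ⊗ g
    (v a x).
Proof. by move=> lf lg; rewrite /tmap sw_sw//; lin_tac. Qed.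

Lemma coassocE (A F : lmodType C) (Delta : A -> (A ⊗ A)%type)
    (delta : F -> (A ⊗ F)%type) W (f : A -> A -> F -> W) :
  coassociative Delta delta ->
  (forall b x, linear (fun a => f a b x)) ->
  (forall a x, linear (fun b => f a b x)) -> (forall a b, linear (f a b)) ->
  forall z, \sw_(a, y <- delta z) \sw_(b, x <- delta y) f a b x =
    \sw_(c, x <- delta z) \sw_(a, b <- Delta c) f a b x.
Proof.
move=> hD f1 f2 f3 z.
have L1 a : linear (fun t : (A ⊗ F)%type => \sw_(b, x <- t) f a b x) by lin_tac.
have L2 t : linear (fun a => \sw_(b, x <- t) f a b x) by lin_tac.
have := congr1 (fun T : (A ⊗ (A ⊗ F))%type =>
  \sw_(a, t <- T) \sw_(b, x <- t) f a b x) (hD z).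
rewrite /= sw_sw//.
have LT : linear (fun T : (A ⊗ (A ⊗ F))%type =>
  \sw_(a, t <- T) \sw_(b, x <- t) f a b x) by lin_tac.
move=> ->; rewrite (lin_sw _ _ LT); apply: eq_sw => c x.
by rewrite sw_sw//; apply: eq_sw => a b; rewrite sw_pure.
Qed.

Lemma counitE (A F : lmodType C) (eps : A -> C) (delta : F -> (A ⊗ F)%type) W
    (f : F -> W) : counital eps delta -> linear f ->
  forall z, \sw_(a, x <- delta z) eps a *: f x = f z.
Proof.
move=> he lf z; rewrite -[in RHS](he z) lin_sw//.
by apply: eq_sw => a x; rewrite linZ.
Qed.

End Sweedler.

(** * Antipode identities *)

Section Hopf.
Context {C : numClosedFieldType} (A : hopf_star_alg C).
Implicit Types (a b : A) (W : lmodType C).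

Lemma eps_lin : linear (eps : A -> C^o).
Proof. by move=> c x y; rewrite linearP. Qed.

Lemma tprod_sw (U V U' V' W X : lmodType C) (f : U -> V -> W)
    (g : U' -> V' -> X) (Z : lmodType C) (k : W -> X -> Z)
    (s : (U ⊗ U')%type) (t : (V ⊗ V')%type) :
  (forall x, linear (k^~ x)) -> (forall w, linear (k w)) ->
  vlift k (tprod f g s t) =
  \sw_(a, x <- s) \sw_(b, y <- t) k (f a b) (g x y).
Proof.
move=> kl kr; have lk : linear (fun T : (W ⊗ X)%type => vlift k T) by lin_tac.
rewrite /tprod (lin_sw _ _ lk); apply: eq_sw => a x.
by rewrite (lin_sw _ _ lk); apply: eq_sw => b y; rewrite sw_pure.
Qed.

Lemma sw_DeltaM W (f : A -> A -> W) a b :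
  (forall x, linear (f^~ x)) -> (forall w, linear (f w)) ->
  \sw_(p, q <- Delta (a * b)) f p q =
  \sw_(a1, a2 <- Delta a) \sw_(b1, b2 <- Delta b) f (a1 * b1) (a2 * b2).
Proof. by move=> fl fr; rewrite DeltaM tprod_sw. Qed.

Lemma sw_mull (U V : lmodType C) (D : algType C) (f : U -> V -> D) t (d : D) :
  vlift f t * d = \sw_(a, x <- t) f a x * d.
Proof. by rewrite (lin_sw _ _ (lin_mull _ (@lin_id _ D))). Qed.

Lemma sw_mulr (U V : lmodType C) (D : algType C) (f : U -> V -> D) t (d : D) :
  d * vlift f t = \sw_(a, x <- t) d * f a x.
Proof. by rewrite (lin_sw _ _ (lin_mulr _ (@lin_id _ D))). Qed.

Lemma counitrE W (f : A -> W) : linear f -> forall z : A,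
  \sw_(a, x <- Delta z) eps x *: f a = f z.
Proof.
move=> lf z; rewrite -[in RHS](Delta_counitr z) lin_sw//.
by apply: eq_sw => a x; rewrite linZ.
Qed.

(** Immediate if the antipode reverses products, but that is not an axiom here. Instead y_(2)
    S(y_(3)) is inserted on the right; then S(b_(1) y_(1)) b_(2) y_(2) is the antipode axiom at the
    product of [b] and y_(1). *)
Lemma antipodeMl b (y : A) :
  \sw_(b1, b2 <- Delta b) antipode (b1 * y) * b2 = eps b *: antipode y.
Proof.
have -> : \sw_(b1, b2 <- Delta b) antipode (b1 * y) * b2 =
  \sw_(c, y3 <- Delta y) \sw_(y1, y2 <- Delta c) \sw_(b1, b2 <- Delta b)
    antipode (b1 * y1) * b2 * (y2 * antipode y3).
  rewrite -[RHS](@coassocE _ _ _ Delta Delta _ (fun y1 y2 y3 =>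
    \sw_(b1, b2 <- Delta b) antipode (b1 * y1) * b2 * (y2 * antipode y3)));
    [|exact: Delta_coassoc|lin_tac..].
  rewrite -(@counitrE _ (fun y => \sw_(b1, b2 <- Delta b) antipode (b1 * y) *
    b2)
    _ y); last by lin_tac.
  apply: eq_sw => y1 y2; rewrite sw_exchange swE scaler_sumr.
  apply: eq_bigr => p _ /=; rewrite -sw_mulr antipoder -scalerAr mulr1 //.
have -> : \sw_(c, y3 <- Delta y) \sw_(y1, y2 <- Delta c) \sw_(b1, b2 <- Delta b)
    antipode (b1 * y1) * b2 * (y2 * antipode y3) =
  \sw_(c, y3 <- Delta y) (eps b * eps c) *: antipode y3.
  apply: eq_sw => c y3; rewrite -epsM -[antipode y3 in RHS]mul1r scalerAl.
  rewrite -antipodel sw_DeltaM; [|lin_tac..].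
  rewrite sw_exchange sw_mull; apply: eq_sw => b1 b2.
  by rewrite sw_mull; apply: eq_sw => y1 y2; rewrite !mulrA.
rewrite -(counitE (Delta_counitl (h := A))
  (f := fun y3 => eps b *: antipode y3)).
  by apply: eq_sw => c y3; rewrite scalerA mulrC.
lin_tac.
Qed.

(** Replaces the rule that the antipode reverses coproducts. After inserting x_(3) S(x_(4)) in the
    second leg, the expression becomes Delta(S(x_(1)) x_(2)) times 1 ⊗ S(x_(3)), and the antipode
    axiom applies inside [Delta]. *)
Lemma antipode_Delta (x : A) :
  \sw_(x1, x2 <- Delta x) \sw_(s1, s2 <- Delta (antipode x1))
    (s1 * x2) ⊗ s2 = 1 ⊗ antipode x.
Proof.
pose F x1 p q1 q2 : (A ⊗ A)%type := \sw_(s1, s2 <- Delta (antipode x1))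
  (s1 * p) ⊗ (s2 * (q1 * antipode q2)).
transitivity (\sw_(x1, x2 <- Delta x) \sw_(c, q2 <- Delta x2)
   \sw_(p, q1 <- Delta c) F x1 p q1 q2).
  apply: eq_sw => x1 x2.
  rewrite -[RHS](@coassocE _ _ _ Delta Delta _ (F x1));
    [|exact: Delta_coassoc|rewrite /F; lin_tac..].
  rewrite -(@counitrE _ (fun x2 => \sw_(s1, s2 <- Delta (antipode x1))
    (s1 * x2) ⊗ s2) _ x2); last by lin_tac.
  apply: eq_sw => p q; rewrite sw_exchange swE scaler_sumr.
  apply: eq_bigr => s _ /=.
  rewrite -(lin_sw (fun q1 q2 => q1 * antipode q2) _
    (f := fun z => (s.1 * p) ⊗ (s.2 * z))); last by lin_tac.
  by rewrite antipoder -scalerAr mulr1 vpureZr.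
rewrite (@coassocE _ _ _ Delta Delta _ (fun x1 c q2 =>
  \sw_(p, q1 <- Delta c) F x1 p q1 q2));
    [|exact: Delta_coassoc|rewrite /F; lin_tac..].
rewrite -[RHS](counitE (Delta_counitl (h := A))
  (f := fun q2 => (1 : A) ⊗ antipode q2)); last by lin_tac.
apply: eq_sw => c q2.
pose R (t : (A ⊗ A)%type) : (A ⊗ A)%type
  := \sw_(u, v <- t) u ⊗ (v * antipode q2).
have lR : linear R by rewrite /R; lin_tac.
have -> : eps c *: ((1 : A) ⊗ antipode q2) = R (Delta (eps c *: 1)).
  rewrite linearZ /= (linZ lR) Delta1 /R sw_pure ?mul1r//; lin_tac.
rewrite -antipodel !(lin_sw _ _ (linearP _)) (lin_sw _ _ lR).
apply: eq_sw => x1 c2; rewrite /R sw_DeltaM; [|lin_tac..].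
rewrite sw_exchange; apply: eq_sw => s1 s2; apply: eq_sw => p q1.
by rewrite mulrA.
Qed.

End Hopf.

(** * The projection of A onto B *)

Section Projection.
Context {C : numClosedFieldType} (K : qhs C).
Local Notation A := (qhsA K).
Local Notation H := (qhsH K).
Local Notation B := (base K).
Local Notation pi := (@qpi C K).
Local Notation Delta := (@Delta C A).

Definition base_avg_val (a : A) : A :=
  \sw_(a1, a2 <- Delta a) haar (pi a2) *: a1.

(** By coassociativity this is invariance of the Haar functional of H, in the form h_(1) haar(h_(2))
    = haar(h) 1. *)
Fact base_avg_coinv a : base_avg_val a \in @coinv C K.
Proof.
apply/coinvP; rewrite /base_avg_val.
have lD : linear (fun z : A => id_pi (Delta z)) by rewrite /id_pi /tmap;
  lin_tac.
rewrite (lin_sw _ _ lD).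
transitivity (\sw_(c, a2 <- Delta a) \sw_(p, q <- Delta c)
   haar (pi a2) *: (p ⊗ pi q)).
  apply: eq_sw => c a2; by rewrite (linZ lD) /id_pi /tmap swE scaler_sumr.
rewrite -(@coassocE _ _ _ Delta Delta _
  (fun p q a2 => haar (pi a2) *: (p ⊗ pi q)));
  [|exact: Delta_coassoc|lin_tac..].
rewrite (lin_sw _ _ (f := fun x : A => x ⊗ (1 : H))); last by lin_tac.
apply: eq_sw => p x; rewrite vpureZ -haarr hm_Delta.
rewrite /tmap sw_sw; [|lin_tac..].
rewrite (lin_sw _ _ (f := fun x : H => p ⊗ x)); last by lin_tac.
by apply: eq_sw => q a2; rewrite vpureZr.
Qed.

(* The conditional expectation of A onto B, [a |-> a_(1) haar (pi a_(2))]. *)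
Definition base_avg (a : A) : B := Base (base_avg_coinv a).

Lemma base_avg_lin : linear base_avg.
Proof.
move=> c x y; apply: val_inj; rewrite /= /base_avg_val.
by have -> // : linear (fun z : A => \sw_(a1, a2 <- Delta z) haar (pi a2) *: a1)
  by lin_tac.
Qed.

Lemma sw_coinv (W : lmodType C) (f : A -> H -> W) (b : B) :
  (forall x, linear (f^~ x)) -> (forall w, linear (f w)) ->
  \sw_(p, q <- Delta (base_val b)) f p (pi q) = f (base_val b) 1.
Proof.
move=> fl fr; have /coinvP e := base_valP b.
by rewrite -sw_pure// -e /id_pi /tmap sw_sw.
Qed.

Lemma base_avgMr a (b : B) : base_avg (a * base_val b) = base_avg a * b.
Proof.
apply: val_inj; rewrite /= /base_avg_val sw_DeltaM; [|lin_tac..].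
rewrite sw_mull; apply: eq_sw => a1 a2.
rewrite -scalerAl -[pi a2 in RHS]mulr1.
rewrite -(@sw_coinv _ (fun p q => haar (pi a2 * q) *: (a1 * p))); [|lin_tac..].
by apply: eq_sw => p q; rewrite rmorphM.
Qed.

Lemma base_avgMl a (b : B) : base_avg (base_val b * a) = b * base_avg a.
Proof.
apply: val_inj; rewrite /= /base_avg_val sw_DeltaM; [|lin_tac..].
rewrite sw_exchange sw_mulr; apply: eq_sw => a1 a2.
rewrite -scalerAr -[pi a2 in RHS]mul1r.
rewrite -(@sw_coinv _ (fun p q => haar (q * pi a2) *: (p * a1))); [|lin_tac..].
by apply: eq_sw => p q; rewrite rmorphM.
Qed.

Lemma base_avg_val_id (b : B) : base_avg (base_val b) = b.
Proof.
rewrite -[base_val b]mul1r base_avgMr -[RHS]mul1r; congr (_ * _).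
apply: val_inj; rewrite /= /base_avg_val Delta1 sw_pure ?rmorph1 ?haar1
  ?scale1r //; lin_tac.
Qed.

Lemma base_val_lin : linear (@base_val C K).
Proof. by []. Qed.

(** [base_coact] picks a preimage and defaults to 0, so a preimage must be exhibited: [Delta] with
    its second leg averaged. Averaging changes nothing, because b_(1) ⊗ b_(2) haar(pi b_(3)) is
    Delta(b_(1)) haar(pi b_(2)) and [b] is coinvariant. *)
Lemma base_coactK (b : B) :
  tmap idfun (@base_val C K) (base_coact b) = Delta (base_val b).
Proof.
apply: (@xgetPex _ 0 (fun t => tmap idfun (@base_val C K) t = Delta
  (base_val b))).
exists (tmap idfun base_avg (Delta (base_val b))).
rewrite {2}/tmap tmap_sw//.
transitivity (\sw_(p, q <- Delta (base_val b)) haar (pi q) *: (Delta p)).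
  transitivity (\sw_(c, q <- Delta (base_val b)) \sw_(x, y <- Delta c)
    haar (pi q) *: (x ⊗ y)).
    rewrite -(@coassocE _ _ _ Delta Delta _
      (fun x y q => haar (pi q) *: (x ⊗ y)));
      [|exact: Delta_coassoc|lin_tac..].
    apply: eq_sw => x y /=; rewrite /base_avg_val.
    rewrite (lin_sw _ _ (f := fun z : A => x ⊗ z)); last by lin_tac.
    by apply: eq_sw => y1 y2; rewrite vpureZr.
  apply: eq_sw => p q; rewrite swE -scaler_sumr; congr (_ *: _).
  exact: sw_id.
rewrite (@sw_coinv _ (fun p q => haar q *: Delta p)) ?haar1 ?scale1r//; lin_tac.
Qed.

Lemma sw_base_coact (W : lmodType C) (f : A -> A -> W) (b : B) :
  (forall x, linear (f^~ x)) -> (forall w, linear (f w)) ->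
  \sw_(p, q <- base_coact b) f p (base_val q) =
  \sw_(p, q <- Delta (base_val b)) f p q.
Proof.
by move=> fl fr; rewrite -base_coactK /tmap sw_sw.
Qed.

(** The preimage is unique, since [base_avg] splits the inclusion of B into A; the choice in
    [base_coact] disappears. *)
Lemma base_coactE b : base_coact b = tmap idfun base_avg (Delta (base_val b)).
Proof.
have la := base_avg_lin.
rewrite -base_coactK {2}/tmap tmap_sw// -[LHS]sw_id.
by apply: eq_sw => x y /=; rewrite base_avg_val_id.
Qed.

(** Colinearity of the expectation: it averages over the right leg and so commutes with the coaction
    on the left. *)
Lemma base_coact_avg a :
  base_coact (base_avg a) = \sw_(p, q <- Delta a) p ⊗ base_avg q.
Proof.
have la := base_avg_lin.
have lt : linear (fun z : A => \sw_(p, q <- Delta z) p ⊗ base_avg q) by lin_tac.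
rewrite base_coactE /= -[LHS]/(\sw_(p, q <- _) p ⊗ base_avg q) /base_avg_val.
rewrite (lin_sw _ _ lt).
transitivity (\sw_(c, z <- Delta a) \sw_(p, q <- Delta c)
    haar (pi z) *: (p ⊗ base_avg q)).
  by apply: eq_sw => c z; rewrite (linZ lt) swE scaler_sumr.
rewrite -(@coassocE _ _ _ Delta Delta _
  (fun p q z => haar (pi z) *: (p ⊗ base_avg q)));
  [|exact: Delta_coassoc|lin_tac..].
apply: eq_sw => p y; rewrite -[base_avg y in RHS]base_avg_val_id /=
  /base_avg_val.
rewrite (lin_sw _ _ (f := fun z => p ⊗ base_avg z)); last by lin_tac.
by apply: eq_sw => q z; rewrite (linZ la) vpureZr.
Qed.

Lemma base_coact1 : base_coact (1 : B) = 1 ⊗ 1.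
Proof.
have la := base_avg_lin.
rewrite base_coactE /= Delta1 /tmap sw_pure; [|lin_tac..].
by rewrite -[X in _ ⊗ base_avg X]/(base_val (1 : B)) base_avg_val_id.
Qed.

End Projection.

(** * Relative Hopf modules *)

Section RelHopf.
Context {C : numClosedFieldType} (K : qhs C).
Local Notation A := (qhsA K).
Local Notation B := (base K).
Context (F : bimodule B) (delta : F -> (A ⊗ F)%type) (hF : rel_hopf delta).

Let dlin : linear delta := rh_linear hF.
Let alin : linear (@base_avg C K) := @base_avg_lin C K.
Let vlin : linear (@base_val C K) := @base_val_lin C K.

Lemma sw_coact_lact (W : lmodType C) (f : A -> F -> W) b w :
  (forall x, linear (f^~ x)) -> (forall a, linear (f a)) ->
  \sw_(a, x <- delta (lact b w)) f a x =
  \sw_(p, q <- base_coact b) \sw_(a, x <- delta w) f (p * a)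
    (lact (q : B) (x : F)).
Proof.
move=> fl fr; rewrite -[w in LHS]ract1 rh_compat// tprod_sw//.
rewrite tprod_sw//; [|lin_tac..]; apply: eq_sw => p q; apply: eq_sw => a x.
by rewrite base_coact1 sw_pure ?mulr1 ?ract1//; lin_tac.
Qed.

Lemma sw_coact_ract (W : lmodType C) (f : A -> F -> W) b w :
  (forall x, linear (f^~ x)) -> (forall a, linear (f a)) ->
  \sw_(a, x <- delta (ract w b)) f a x =
  \sw_(p, q <- base_coact b) \sw_(a, x <- delta w) f (a * p)
    (ract (x : F) (q : B)).
Proof.
move=> fl fr; rewrite -[ract w b in LHS]lact1 rh_compat// tprod_sw//.
rewrite tprod_sw//; [|lin_tac..]; rewrite base_coact1 sw_pure; [|lin_tac..].
rewrite sw_exchange; apply: eq_sw => p q; apply: eq_sw => a x.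
by rewrite mul1r lact1.
Qed.

(* The left inverse of [w |-> w_(-1) ⊗ [w_(0)]], as a map
   [A ⊗ F/B^+F -> F] evaluated on representatives. *)
Definition unfiber (a : A) (w : F) : F :=
  \sw_(u, x <- delta w) lact (base_avg (a * antipode u)) (x : F).

Lemma unfiber_linl w : linear (unfiber^~ w).
Proof. by rewrite /unfiber; lin_tac. Qed.

Lemma unfiber_linr a : linear (unfiber a).
Proof. by rewrite /unfiber; lin_tac. Qed.

(** The left inverse property: w_(-2) S(w_(-1)) collapses to the counit, and the expectation fixes
    1. *)
Lemma unfiber_coact w : \sw_(a, x <- delta w) unfiber a x = w.
Proof.
rewrite /unfiber (@coassocE _ _ _ Delta delta _
  (fun a u x => lact (base_avg (a * antipode u)) (x : F)));
  [|exact: rh_coassoc hF|lin_tac..].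
have l1 : linear (fun x : F => x) by [].
rewrite -[RHS](counitE (rh_counital hF) l1).
apply: eq_sw => c x; rewrite -(lin_sw _ _ (f := fun z => lact (base_avg z) x));
  last by lin_tac.
rewrite antipoder (linZ alin) lact_scalel; congr (_ *: _).
by rewrite -[1]/(base_val (1 : B)) base_avg_val_id lact1.
Qed.

(** The reason why [unfiber a] is defined on the fibre. The factor b_(2) acting on the module moves
    into the expectation, which is right B-linear, and there it meets S(b_(1) u), so that
    [antipodeMl] applies. *)
Lemma unfiber_lact a b w :
  unfiber a (lact b w) = eps (base_val b) *: unfiber a w.
Proof.
rewrite /unfiber sw_coact_lact; [|lin_tac..].
rewrite sw_exchange swE scaler_sumr; apply: eq_bigr => z _.
transitivity (\sw_(p, q <- base_coact b)
    lact (base_avg (a * (antipode (p * z.1) * base_val q))) z.2).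
  by apply: eq_sw => p q; rewrite mulrA base_avgMr lactA.
rewrite (@sw_base_coact _ _ _ (fun p q =>
  lact (base_avg (a * (antipode (p * z.1) * q))) z.2)); [|lin_tac..].
rewrite -(lin_sw _ _ (f := fun t => lact (base_avg (a * t)) z.2));
  last by lin_tac.
by rewrite antipodeMl -scalerAr (linZ alin) lact_scalel.
Qed.

Lemma unfiber_base a b w : unfiber (base_val b * a) w = lact b (unfiber a w).
Proof.
rewrite /unfiber (lin_sw _ _ (f := fun z : F => lact b z)); last by lin_tac.
by apply: eq_sw => u x; rewrite -mulrA base_avgMl lactA.
Qed.

Lemma unfiber_lspan P a w : augm_lspan P w -> unfiber a w = 0.
Proof.
case=> s hs ->; rewrite (lin_sumE _ _ (unfiber_linr a)) big_seq big1// => z.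
by case/hs => e _; rewrite unfiber_lact e scale0r.
Qed.

(** Here the axiom B^+ F = F B^+ enters: [w] times b - eps(b) lies in F B^+, hence in B^+ F, which
    [unfiber] kills. *)
Lemma unfiber_ract a b w :
  unfiber a (ract w b) = eps (base_val b) *: unfiber a w.
Proof.
have h : augm_rspan (fun=> True) (ract w (- eps (base_val b) *: 1 + b)).
  exists [:: (w, - eps (base_val b) *: 1 + b)]; last by rewrite big_seq1.
  move=> z; rewrite inE => /eqP -> /=; split=> //.
  by rewrite /augm vlin linearP /= eps1 [_ * _]mulr1 addNr.
move/(rh_augm hF)/(unfiber_lspan a): h.
rewrite ractPr ract1 unfiber_linr scaleNr.
by move/eqP; rewrite addrC subr_eq0 => /eqP.
Qed.

(** Together with [unfiber_coinvariant], this makes [unfiber 1] a projection onto the coinvariants;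
    [antipode_Delta] is exactly the identity required. *)
Lemma coact_unfiber1 w : delta (unfiber 1 w) = 1 ⊗ unfiber 1 w.
Proof.
rewrite /unfiber (lin_sw _ _ dlin) (lin_sw _ _ (f := fun z : F => (1 : A) ⊗ z));
  last by lin_tac.
transitivity (\sw_(u, x <- delta w) \sw_(v, y <- delta x)
  \sw_(s1, s2 <- Delta (antipode u)) (s1 * v) ⊗ lact (base_avg s2) y).
  apply: eq_sw => u x; rewrite -[LHS]sw_id sw_coact_lact; [|lin_tac..].
  rewrite base_coact_avg mul1r sw_sw; [|lin_tac..].
  by rewrite sw_exchange.
rewrite (@coassocE _ _ _ Delta delta _ (fun u v y =>
   \sw_(s1, s2 <- Delta (antipode u)) (s1 * v) ⊗ lact (base_avg s2) (y : F)));
  [|exact: rh_coassoc hF|lin_tac..].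
apply: eq_sw => c y; rewrite mul1r.
have ly : linear (fun t : (A ⊗ A)%type =>
  \sw_(s1, s2 <- t) s1 ⊗ lact (base_avg s2) (y : F)) by lin_tac.
rewrite -[RHS](sw_pure (f := fun s1 s2 => s1 ⊗ lact (base_avg s2) (y : F)));
  [|lin_tac..].
rewrite -antipode_Delta (lin_sw _ _ ly); apply: eq_sw => u v.
by rewrite sw_sw//; lin_tac.
Qed.

Definition coinvariant (w : F) : Prop := delta w = 1 ⊗ w.

Lemma unfiber_coinvariant w : coinvariant w -> unfiber 1 w = w.
Proof.
move=> hw; rewrite -[RHS]unfiber_coact hw sw_pure//.
  exact: unfiber_linl.
exact: unfiber_linr.
Qed.

(** Left and right actions agree on the fibre, so both sides are recovered from it as
    [unfiber (base_val b) w]. *)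
Lemma coinvariant_central w b : coinvariant w -> ract w b = lact b w.
Proof.
move=> hw; have ll := unfiber_linl; have lr := unfiber_linr.
rewrite -[LHS]unfiber_coact sw_coact_ract//.
rewrite hw /coinvariant.
transitivity (\sw_(p, q <- base_coact b) eps (base_val q) *: unfiber p w).
  apply: eq_sw => p q; rewrite sw_pure; [|lin_tac..].
  by rewrite mul1r unfiber_ract.
rewrite (@sw_base_coact _ _ _ (fun p q => eps q *: unfiber p w)); [|lin_tac..].
rewrite (counitrE (f := fun p => unfiber p w))//.
by rewrite -[base_val b]mulr1 unfiber_base unfiber_coinvariant.
Qed.

(** Nakayama's lemma: [x] is recovered by [unfiber] from its coaction, whose right legs lie in [P],
    hence in B^+ P, where [unfiber] vanishes. *)
Lemma rel_hopf_sub_nakayama (P : F -> Prop) : rel_hopf_sub delta P ->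
  (forall x, P x -> augm_lspan P x) -> forall x, P x -> x = 0.
Proof.
move=> hP hN x Px; have [s hs e] := rhs_coact hP Px.
rewrite -[x]unfiber_coact e sw_sum; [|exact: unfiber_linl|exact: unfiber_linr].
rewrite big_seq big1// => z zs.
rewrite sw_pure; [|exact: unfiber_linl|exact: unfiber_linr].
by apply: unfiber_lspan; apply: hN; have [] := hs z zs.
Qed.

End RelHopf.

(** * Schur's lemma *)

Section Schur.
Context {C : numClosedFieldType} (K : qhs C).
Local Notation A := (qhsA K).
Local Notation B := (base K).
Context (F : bimodule B) (delta : F -> (A ⊗ F)%type) (hF : rel_hopf delta).
Context (P : F -> Prop) (hP : rel_hopf_sub delta P).

Let dlin : linear delta := rh_linear hF.

(** An endomorphism of the subobject [P], encoded as a map on all of [F]. Linearity is asked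
    everywhere so that [tmap idfun T] is well behaved; the other conditions concern [P] only. *)
Record sub_endo (T : F -> F) : Prop := SubEndo {
  se_linear : linear T;
  se_stable : forall x, P x -> P (T x);
  se_lact : forall b x, P x -> T (lact b x) = lact b (T x);
  se_ract : forall b x, P x -> T (ract x b) = ract (T x) b;
  se_coact : forall x, P x -> delta (T x) = tmap idfun T (delta x)
}.

Definition sub_image (T : F -> F) (y : F) : Prop := exists2 x, P x & y = T x.

Lemma sub_endo_sub T c : sub_endo T -> sub_endo (fun x => T x - c *: x).
Proof.
case=> lT sT laT raT cT; have [P0 PD] := rhs_subspace hP; split.
- by lin_tac.
- by move=> x Px; rewrite addrC -scaleNr; apply: PD => //; apply: sT.
- by move=> b x Px; rewrite laT// -!scaleNr lactDr lact_scaler.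
- by move=> b x Px; rewrite raT// -!scaleNr ractDl ract_scalel.
- move=> x Px; rewrite -scaleNr addrC dlin cT// -{1}[delta x]sw_id /tmap.
  rewrite swE scaler_sumr swE -big_split; apply: eq_bigr => p _ /=.
  by rewrite -vpureZr -vpureDr scaleNr addrC.
Qed.

Lemma sub_image_lspan T : sub_endo T -> forall x,
  augm_lspan (sub_image T) x <-> exists2 y, augm_lspan P y & x = T y.
Proof.
case=> lT sT laT raT cT x; split=> [[s + ->]|[y [s hs ->] ->]].
  elim: s => [|z s IHs] hs.
    exists 0; first by exists [::]; rewrite ?big_nil.
    by rewrite big_nil (lin0 lT).
  have [z' z's|y [s' hs' ->] e] := IHs; first by apply: hs;
    rewrite inE z's orbT.
  have [|z1 [u Pu z2]] := hs z; first by rewrite inE eqxx.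
  exists (lact z.1 u + \sum_(z <- s') lact z.1 z.2).
    exists ((z.1, u) :: s'); last by rewrite big_cons.
    by move=> t; rewrite inE => /orP[/eqP->|/hs'].
  by rewrite big_cons e z2 (linD lT) laT.
exists [seq (z.1, T z.2) | z <- s].
  by move=> _ /mapP[z /hs[z1 z2] ->]; split=> //; exists z.2.
rewrite big_map (lin_sumE _ _ lT) big_seq [RHS]big_seq; apply: eq_bigr => z zs.
by rewrite laT//; have [] := hs z zs.
Qed.

Lemma sub_image_rspan T : sub_endo T -> forall x,
  augm_rspan (sub_image T) x <-> exists2 y, augm_rspan P y & x = T y.
Proof.
case=> lT sT laT raT cT x; split=> [[s + ->]|[y [s hs ->] ->]].
  elim: s => [|z s IHs] hs.
    exists 0; first by exists [::]; rewrite ?big_nil.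
    by rewrite big_nil (lin0 lT).
  have [z' z's|y [s' hs' ->] e] := IHs; first by apply: hs;
    rewrite inE z's orbT.
  have [|[u Pu z2] z1] := hs z; first by rewrite inE eqxx.
  exists (ract u z.2 + \sum_(z <- s') ract z.1 z.2).
    exists ((u, z.2) :: s'); last by rewrite big_cons.
    by move=> t; rewrite inE => /orP[/eqP->|/hs'].
  by rewrite big_cons e z2 (linD lT) raT.
exists [seq (T z.1, z.2) | z <- s].
  by move=> _ /mapP[z /hs[z1 z2] ->]; split=> //; exists z.1.
rewrite big_map (lin_sumE _ _ lT) big_seq [RHS]big_seq; apply: eq_bigr => z zs.
by rewrite raT//; have [] := hs z zs.
Qed.

Lemma sub_image_hopf T : sub_endo T -> rel_hopf_sub delta (sub_image T).
Proof.
move=> hT; have [lT sT laT raT cT] := hT; have [P0 PD] := rhs_subspace hP;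
  split.
- split=> [|c x y [u Pu ->] [v Pv ->]].
    by exists 0; [|rewrite (lin0 lT)].
  by exists (c *: u + v); [exact: PD|rewrite lT].
- move=> b x [u Pu ->]; exists (lact b u);
  [exact: (rhs_lact hP)|by rewrite laT].
- move=> x b [u Pu ->]; exists (ract u b);
  [exact: (rhs_ract hP)|by rewrite raT].
- move=> x [u Pu ->]; rewrite cT//; have [s hs ->] := rhs_coact hP Pu.
  exists [seq (z.1, T z.2) | z <- s].
    by move=> _ /mapP[z /hs[z1 z2] ->]; split=> //; exists z.2.
  have lid : linear (@idfun A) by [].
  rewrite big_map (lin_sumE _ _ (lin_tmap lid lT)).
  by apply: eq_bigr => z _; rewrite tmap_pure.
- have [n [e Pe he]] := rhs_fingen hP; exists n, (T \o e).
    by move=> i; exists (e i).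
  move=> _ [u Pu ->]; have [b ->] := he _ Pu; exists b.
  by rewrite (lin_sumE _ _ lT); apply: eq_bigr => i _; rewrite laT.
- move=> x; rewrite sub_image_lspan// sub_image_rspan//.
  by split=> -[y /(rhs_augm hP) hy ->]; exists y.
Qed.

Lemma augm_lspan_subspace : subspace (augm_lspan P).
Proof.
split=> [|c x y [s hs ->] [s' hs' ->]]; first by exists [::]; rewrite ?big_nil.
exists ([seq (c *: z.1, z.2) | z <- s] ++ s').
  move=> z; rewrite mem_cat => /orP[/mapP[t /hs[t1 t2] ->]|/hs'//]; split=> //=.
  by rewrite /augm (linZ (@base_val_lin _ K)) linearZ /= t1 [_ * _]mulr0.
rewrite big_cat big_map scaler_sumr; congr (_ + _).
by apply: eq_bigr => z _; rewrite lact_scalel.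
Qed.

Lemma augm_lspan_endo T x : sub_endo T -> augm_lspan P x -> augm_lspan P (T x).
Proof.
move=> hT hx; have [s hs ->] : augm_lspan (sub_image T) (T x).
  by apply/sub_image_lspan => //; exists x.
exists s => // z /hs[z1 [u Pu ->]]; split=> //; exact: (se_stable hT).
Qed.

(* Cayley-Hamilton for the matrix of [T] on generators modulo [B^+ P] shows
   that a product of the [T - c] maps [P] into [B^+ P]. *)
Lemma sub_endo_not_surj T : sub_endo T -> (exists2 x, P x & x != 0) ->
  exists c, ~ forall x, P x -> sub_image (fun y => T y - c *: y) x.
Proof.
move=> hT [x0 Px0 /eqP x0N0]; apply: contrapT => hs.
(* The assumption to refute: every T - c maps [P] onto itself. *)
have {}hs c x : P x -> sub_image (fun y => T y - c *: y) x.
  by apply: contrapT => h; apply: hs; exists c => /(_ x).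
have [n [e Pe he]] := rhs_fingen hP.
case: n e Pe he => [|n] e Pe he.
  by have [b] := he _ Px0; rewrite big_ord0 => /x0N0.
have [lT sT laT raT cT] := hT; have [Q0 QD] := augm_lspan_subspace.
have [M hM] : exists M : 'I_n.+1 -> 'I_n.+1 -> B, forall i,
    T (e i) = \sum_j lact (M i j) (e j).
  have /choice[M hM] : forall i, exists b : 'I_n.+1 -> B,
      T (e i) = \sum_j lact (b j) (e j) by move=> i; apply/he/sT.
  by exists M.
pose E (u : 'rV[C]_n.+1) : F := \sum_j u ord0 j *: e j.
have lE : linear E.
  move=> c u v; rewrite /E scaler_sumr -big_split; apply: eq_bigr => j _.
  by rewrite !mxE scalerDl scalerA.
pose N := \matrix_(i, j) (eps (base_val (M i j)) : C).
(* The row [u] gives coordinates of [x] modulo B^+ P. This is a relation, not a function, since the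
   generators may be dependent in the fibre. *)
pose ev x u := augm_lspan P (x - E u).
have evD c x u y v : ev x u -> ev y v -> ev (c *: x + y) (c *: u + v).
  by move=> h1 h2; rewrite /ev lE opprD addrACA -scalerBr; apply: QD.
have ev1 b j : ev (lact b (e j)) (eps (base_val b) *: delta_mx ord0 j).
  exists [:: (b - eps (base_val b) *: 1, e j)].
    move=> z; rewrite inE => /eqP ->; split=> //=; rewrite /augm -scaleNr addrC.
    by rewrite (@base_val_lin _ K) linearP /= eps1 [_ * _]mulr1 addNr.
  rewrite big_seq1 /= -(scaleNr _ (1 : B)) [b + _]addrC lactPl lact1 scaleNr
    [RHS]addrC.
  congr (_ - _); rewrite (linZ lE); congr (_ *: _);
    rewrite /E (bigD1 j)//= big1 ?addr0 => [|i ij].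
    by rewrite mxE !eqxx scale1r.
  by rewrite mxE (negbTE ij) andbF scale0r.
have evS (I : finType) (f : I -> F) u : (forall i, ev (f i) (u i)) ->
    ev (\sum_i f i) (\sum_i u i).
  move=> h; apply: (big_ind2 ev) => //; first by rewrite /ev (lin0 lE) subr0.
  by move=> x u' y v hx hy; rewrite -[x]scale1r -[u']scale1r; apply: (evD).
have ev0 x u : ev x u -> ev (T x) (u *m N).
  move=> h; rewrite /ev.
  have -> : T x - E (u *m N) = 1 *: T (x - E u) + (T (E u) - E (u *m N)).
    by rewrite scale1r (linD lT) -[- E u]scaleN1r (linZ lT) scaleN1r addrA
      subrK.
  apply: QD; first exact: augm_lspan_endo.
  rewrite -/(ev _ _).
  have -> : T (E u) = \sum_i u ord0 i *: T (e i).
    by rewrite (lin_sumE _ _ lT); apply: eq_bigr => i _; rewrite (linZ lT).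
  have -> : u *m N = \sum_i u ord0 i *: row i N.
    by rewrite mulmx_sum_row.
  apply: (evS) => i; rewrite hM -[_ *: _ in X in ev X]addr0
    -[_ *: _ in X in ev _ X]addr0.
  apply: (evD); last by rewrite /ev (lin0 lE) subr0.
  have -> : row i N = \sum_j N i j *: delta_mx ord0 j.
    by rewrite {1}[row i N]row_sum_delta; apply: eq_bigr => j _; rewrite mxE.
  by apply: (evS) => j; rewrite mxE; apply: (ev1).
(* The eigenvalues of [N], with multiplicity, are the scalars at which surjectivity is exploited. *)
have [cs hcs] := closed_field_poly_normal (char_poly N).
rewrite (monicP (char_poly_monic N)) scale1r in hcs.
(* By surjectivity [x] comes from some [y] through the product of the T - c, so coordinates of [y]
   times the product of the N - c are coordinates of [x]. *)
have key (s : seq C) x : P x -> exists y, P y /\ forall u, ev y u ->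
    ev x (u *m \prod_(c <- s) (N - c%:M)).
  elim: s x => [|c s IHs] x Px.
    by exists x; split=> // u; rewrite big_nil mulmx1.
  have [y Py ->] := hs c x Px; have [z [Pz hz]] := IHs _ Py.
  exists z; split=> // u /hz h; rewrite big_cons.
  (* Coordinates are rows, so the operator applied last contributes the rightmost factor, whereas
     [big_cons] puts it on the left. *)
  have -> : (N - c%:M) * \prod_(c <- s) (N - c%:M) =
    (\prod_(c <- s) (N - c%:M)) * (N - c%:M).
    apply: commr_prod => d _; apply: commrB; apply: commr_sym; apply: commrB.
    - by [].
    - exact: scalar_mxC.
    - exact/commr_sym/scalar_mxC.
    - exact: scalar_mxC.
  rewrite mulmxA mulmxBr mul_mx_scalar.
  have := evD (- c) _ _ _ _ h (ev0 _ _ h).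
  by rewrite !scaleNr ![- (c *: _) + _]addrC.
(* The product over all eigenvalues is zero by Cayley-Hamilton, so every element of [P] lies in B^+
   P, and Nakayama's lemma gives P = 0. *)
apply: x0N0; apply: (rel_hopf_sub_nakayama hF hP) => // x Px.
have [y [Py hy]] := key cs x Px; have [b yE] := he _ Py.
have evy : ev y (\sum_j eps (base_val (b j)) *: delta_mx ord0 j).
  by rewrite yE; apply: (evS) => j; apply: (ev1).
have := hy _ evy.
have -> : \prod_(c <- cs) (N - c%:M) = horner_mx N (char_poly N).
  rewrite hcs rmorph_prod; apply: eq_bigr => c _ /=.
  by rewrite rmorphB /= horner_mx_X horner_mx_C.
by rewrite Cayley_Hamilton mulmx0 /ev (lin0 lE) subr0.
Qed.

(** For a scalar with T - c not onto, the image of T - c is a subobject different from [P], hence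
    zero by simplicity. *)
Lemma schur T : irreducible_sub delta P -> sub_endo T ->
  exists c, forall x, P x -> T x = c *: x.
Proof.
case=> _ hne hirr hT; have [c hc] := sub_endo_not_surj hT hne; exists c.
have hTc := sub_endo_sub c hT.
have [||h] := hirr _ (sub_image_hopf hTc).
- by move=> _ [x Px ->]; apply: (se_stable hTc).
- by move=> h x Px; apply/eqP; rewrite -subr_eq0; apply/eqP/h; exists x.
- by case: hc.
Qed.

End Schur.

(** * Bidegrees *)

Section Bidegree.
Context {C : numClosedFieldType} {B : star_alg C} {Om : star_calculus B}.
Variable cs : complex_structure Om.
Local Notation emb := (emb Om).
Local Notation dif := (dif Om).
Local Notation deg := (deg Om).
Local Notation bideg := (bideg cs).
Local Notation cstar := (@cstar C B Om).

Lemma bideg_bihom a b a' b' w : bihom cs a' b' w ->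
  bideg a b w = if (a == a') && (b == b') then w else 0.
Proof.
by rewrite /bihom => e; rewrite -e bideg_bideg;
  case: andP => // -[/eqP-> /eqP->].
Qed.

Lemma bihom_bideg a b w : bihom cs a b (bideg a b w).
Proof. by rewrite /bihom bideg_bideg !eqxx. Qed.

Lemma deg_bihom k a b w : bihom cs a b w -> deg k w = if k == (a + b)%N then w
  else 0.
Proof.
move=> hw; rewrite (deg_bideg cs).
under eq_bigr do rewrite (bideg_bihom _ _ hw).
case: eqP => [->|kab].
  have ha : (a < (a + b).+1)%N by rewrite ltnS leq_addr.
  rewrite (bigD1 (Ordinal ha))//= big1 => [|i]; last first.
    by rewrite -val_eqE /= => /negbTE ->.
  by rewrite eqxx addKn eqxx addr0.
rewrite big1// => i _; case: andP => // -[/eqP ia /eqP kb]; case: kab.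
by rewrite -kb -ia subnKC// -ltnS.
Qed.

Lemma form_ind (P : Om -> Prop) :
  (forall a b w, bihom cs a b w -> P w) ->
    (forall v w, P v -> P w -> P (v + w)) ->
  forall w, P w.
Proof.
move=> hb hD w; have P0 : P 0 by apply: (hb 0%N 0%N); rewrite /bihom linear0.
have [m ->] := deg_sum w; apply: (big_ind P) => // k _.
rewrite (deg_bideg cs); apply: (big_ind P) => // a _; apply: hb.
exact: bihom_bideg.
Qed.

Lemma bihomZ a b c w : bihom cs a b w -> bihom cs a b (c *: w).
Proof. by rewrite /bihom linearZ /= => ->. Qed.

Lemma bihomN a b w : bihom cs a b w -> bihom cs a b (- w).
Proof. by rewrite /bihom linearN /= => ->. Qed.

Lemma bihomM a b a' b' v w : bihom cs a b v -> bihom cs a' b' w ->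
  bihom cs (a + a') (b + b') (v * w).
Proof. exact: bidegM. Qed.

Lemma bihom_star a b w : bihom cs a b w -> bihom cs b a (cstar w).
Proof. exact: bideg_star. Qed.

Lemma deg_emb b : deg 0 (emb b) = emb b.
Proof. by apply/deg0P; exists b. Qed.

Lemma bihom_emb b : bihom cs 0 0 (emb b).
Proof. by rewrite /bihom -{2}[emb b]deg_emb (deg_bideg cs) big_ord1 subn0. Qed.

Lemma bideg_embl a b c w : bideg a b (emb c * w) = emb c * bideg a b w.
Proof.
elim/form_ind: w => [a' b' w hw|v w hv hw].
  rewrite (bideg_bihom _ _ (bihomM (bihom_emb c) hw)) (bideg_bihom _ _ hw)
    !add0n.
  by case: ifP; rewrite ?mulr0.
by rewrite mulrDr !linearD /= hv hw mulrDr.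
Qed.

Lemma bideg_embr a b c w : bideg a b (w * emb c) = bideg a b w * emb c.
Proof.
elim/form_ind: w => [a' b' w hw|v w hv hw].
  rewrite (bideg_bihom _ _ (bihomM hw (bihom_emb c))) (bideg_bihom _ _ hw)
    !addn0.
  by case: ifP; rewrite ?mul0r.
by rewrite mulrDl !linearD /= hv hw mulrDl.
Qed.

Lemma deg_embr k c w : deg k (w * emb c) = deg k w * emb c.
Proof.
rewrite !(deg_bideg cs) mulr_suml; apply: eq_bigr => i _; exact: bideg_embr.
Qed.

Lemma cstar0 : cstar 0 = 0.
Proof. by have := semilinZ (@cstar_semilin _ _ Om) 0 0;
  rewrite conjC0 !scale0r. Qed.

Lemma bideg_cstar a b w : bideg a b (cstar w) = cstar (bideg b a w).
Proof.
have s0 := cstar0.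
elim/form_ind: w => [a' b' w hw|v w hv hw].
  rewrite (bideg_bihom _ _ (bihom_star hw)) (bideg_bihom _ _ hw) andbC.
  by case: ifP => // _; rewrite s0.
rewrite (semilinD (@cstar_semilin _ _ Om)) !linearD /= hv hw.
by rewrite (semilinD (@cstar_semilin _ _ Om)).
Qed.

Lemma cstar_embl c w : cstar (emb c * w) = cstar w * emb (star c).
Proof.
elim/form_ind: w => [a b w hw|v w hv hw].
  rewrite (@cstarM _ _ Om 0 (a + b)) ?deg_emb//.
    by rewrite mul0n scale1r cstar_emb.
  by rewrite (deg_bihom _ hw) eqxx.
by rewrite mulrDr !(semilinD (@cstar_semilin _ _ Om)) hv hw mulrDl.
Qed.

Lemma cstar_embr c w : cstar (w * emb c) = emb (star c) * cstar w.
Proof.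
elim/form_ind: w => [a b w hw|v w hv hw].
  rewrite (@cstarM _ _ Om (a + b) 0) ?deg_emb//.
    by rewrite muln0 scale1r cstar_emb.
  by rewrite (deg_bihom _ hw) eqxx.
by rewrite mulrDl !(semilinD (@cstar_semilin _ _ Om)) hv hw mulrDr.
Qed.

Lemma cstarM1 v w : deg 1 v = v -> deg 1 w = w ->
  cstar (v * w) = - (cstar w * cstar v).
Proof.
by move=> hv hw; rewrite (cstarM hv hw) expr1 scaleN1r.
Qed.

Lemma dif_embl b w : dif (emb b * w) = dif (emb b) * w + emb b * dif w.
Proof. by rewrite (difM _ (deg_emb b)) expr0 scale1r. Qed.

Lemma deg1_dif b : deg 1 (dif (emb b)) = dif (emb b).
Proof. exact/deg_dif/deg_emb. Qed.

Lemma one_form_split w : deg 1 w = w -> w = bideg 1 0 w + bideg 0 1 w.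
Proof.
by move=> hw; rewrite -{1}[w]hw (deg_bideg cs) !big_ord_recr big_ord0 /= add0r
  addrC.
Qed.

Lemma deg1_cstar w : deg 1 w = w -> deg 1 (cstar w) = cstar w.
Proof.
move=> /one_form_split ->;
  rewrite (semilinD (@cstar_semilin _ _ Om)) linearD /=.
by congr (_ + _); rewrite (deg_bihom _ (bihom_star (bihom_bideg _ _ _))).
Qed.

Lemma two_form_split w : deg 2 w = w ->
  w = bideg 0 2 w + bideg 1 1 w + bideg 2 0 w.
Proof.
by move=> hw; rewrite -{1}[w]hw (deg_bideg cs) !big_ord_recr big_ord0 /= add0r.
Qed.

Lemma bihom_deg k a b w : bihom cs a b w -> k = (a + b)%N -> deg k w = w.
Proof. by move=> hw ->; rewrite (deg_bihom _ hw) eqxx. Qed.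

Lemma bideg02_dif w : deg 1 w = w -> bideg 0 2 (dif w) = bideg 0 2
  (dif (bideg 0 1 w)).
Proof.
move=> hw; rewrite {1}(one_form_split hw) !linearD /=.
rewrite (bideg_dif (bihom_bideg 1 0 w)) linearD /=.
rewrite (bideg_bihom _ _ (bihom_bideg 2 0 _))
  (bideg_bihom _ _ (bihom_bideg 1 1 _)).
by rewrite /= addr0 add0r.
Qed.

Lemma bideg02M v w : deg 1 v = v -> deg 1 w = w ->
  bideg 0 2 (v * w) = bideg 0 1 v * bideg 0 1 w.
Proof.
move=> hv hw; rewrite {1}(one_form_split hv) {1}(one_form_split hw).
rewrite mulrDl !mulrDr !linearD /=.
rewrite !(bideg_bihom _ _ (bihomM (bihom_bideg _ _ _) (bihom_bideg _ _ _))).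
by rewrite /= !add0r.
Qed.

Lemma delbar_bihom m a b w : (a <= m)%N -> (b <= m)%N -> bihom cs a b w ->
  delbar cs m w = bideg a b.+1 (dif w).
Proof.
move=> am bm hw; rewrite /delbar.
rewrite (bigD1 (Ordinal (am : (a < m.+1)%N)))//=
  (bigD1 (Ordinal (bm : (b < m.+1)%N)))//=.
rewrite (_ : bideg a b w = w)// !big1 ?addr0// => i ia.
  rewrite big1// => j _; rewrite (bideg_bihom _ _ hw).
  by rewrite -val_eqE /= in ia; rewrite (negbTE ia) !linear0.
rewrite (bideg_bihom _ _ hw).
by rewrite -val_eqE /= in ia; rewrite (negbTE ia) andbF !linear0.
Qed.

Lemma delbar_lin m : linear (delbar cs m).
Proof.
move=> c v w; rewrite /delbar scaler_sumr -big_split; apply: eq_bigr => a _ /=.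
rewrite scaler_sumr -big_split; apply: eq_bigr => b _ /=.
by rewrite !linearP.
Qed.

End Bidegree.

(** * Covariant calculi *)

Section SemilinearSweedler.
Context {C : numClosedFieldType}.
Implicit Types (U V W : lmodType C).

Lemma add_sumE (V W : zmodType) (f : V -> W) (I : Type) (r : seq I)
  (g : I -> V) :
  (forall x y, f (x + y) = f x + f y) ->
  f (\sum_(i <- r) g i) = \sum_(i <- r) f (g i).
Proof.
move=> fD; have f0 : f 0 = 0 by apply: (addrI (f 0)); rewrite -fD !addr0.
by elim: r => [|i r IHr]; rewrite ?big_nil// !big_cons fD IHr.
Qed.

Lemma add_sw U V (W X : zmodType) (f : W -> X) (g : U -> V -> W) (t : U ⊗ V) :
  (forall x y, f (x + y) = f x + f y) ->
  f (vlift g t) = \sw_(a, x <- t) f (g a x).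
Proof. by move=> fD; rewrite swE add_sumE. Qed.

Lemma bal_sw U V U' V' (W : zmodType) (f : U -> V -> W) (u : U' -> V' -> U)
    (v : U' -> V' -> V) (t : U' ⊗ V') : balanced (M := vs U) (N := vs V) f ->
  vlift f (\sw_(a, x <- t) u a x ⊗ v a x) = \sw_(a, x <- t) f (u a x) (v a x).
Proof.
move=> bf; rewrite (add_sw _ _ (f := fun s : (U ⊗ V)%type => vlift f s)).
  by apply: eq_sw => a x; rewrite tlift_pure.
by move=> x y; rewrite tliftD.
Qed.

End SemilinearSweedler.

Section CovariantCalculus.
Context {C : numClosedFieldType} {K : qhs C} {Om : star_calculus (base K)}.
Local Notation A := (qhsA K).
Local Notation B := (base K).
Local Notation emb := (emb Om).
Local Notation dif := (dif Om).
Local Notation deg := (deg Om).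
Local Notation cstar := (@cstar C B Om).
Variables (delta : Om -> (A ⊗ Om)%type) (cov : covariant_calculus delta).
Variables (cs : complex_structure Om) (ccs : covariant_cs delta cs).

Let dlin : linear delta := cov_linear cov.
Let lid : linear (@idfun A). Proof. by []. Qed.

(** The summands are subcomodules, which amounts to colinearity of the projections onto them. *)
Lemma cov_bideg a b w :
  delta (bideg cs a b w) = tmap idfun (bideg cs a b) (delta w).
Proof.
have lb : linear (bideg cs a b) by exact: linearP.
elim/(form_ind (cs := cs)): w => [a' b' w hw|v w hv hw]; last first.
  by rewrite linearD /= !(linD dlin) hv hw (linD (lin_tmap lid lb)).
have [s hs e] := ccs hw; rewrite (bideg_bihom _ _ hw) e.
rewrite (lin_sumE _ _ (lin_tmap lid lb)).
transitivity (\sum_(x <- s) x.1 ⊗ (if (a == a') && (b == b') then x.2 else 0)).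
  case: ifP => _; first by rewrite e.
  rewrite (lin0 dlin) big1// => z _.
  exact: (lin0 (lin_purer _ (@lin_id _ Om))).
rewrite big_seq [RHS]big_seq; apply: eq_bigr => z /hs[_ hz].
by rewrite tmap_pure//= (bideg_bihom _ _ hz).
Qed.

Lemma sw_delta_emb (W : lmodType C) (f : A -> Om -> W) b :
  (forall x, linear (f^~ x)) -> (forall a, linear (f a)) ->
  \sw_(a, x <- delta (emb b)) f a x = \sw_(p, q <- base_coact b) f p
    (emb (q : B)).
Proof.
move=> fl fr; by rewrite cov_emb// /tmap sw_sw.
Qed.

Lemma base_coact_star (b : B) :
  base_coact (star b) = \sw_(p, q <- base_coact b) star p ⊗ star (q : B).
Proof.
have la := @base_avg_lin C K;
  rewrite base_coactE /= Delta_star -(base_coactK b).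
have sb : balanced (M := vs A) (N := vs A) (fun u v => star u ⊗ star v).
  by apply: balanced_semilin; apply: star_semilin.
rewrite {2}/tmap (bal_sw _ _ _ sb) tmap_sw//; apply: eq_sw => p q /=.
by rewrite -[star (base_val q)]/(base_val (base_star q)) base_avg_val_id.
Qed.

Lemma deg1M v w : deg 1 (v * w) = deg 0 v * deg 1 w + deg 1 v * deg 0 w.
Proof.
elim/(form_ind (cs := cs)): v => [a b v hv|v v' hv hv']; last first.
  by rewrite mulrDl !linearD /= hv hv' !mulrDl addrACA.
elim/(form_ind (cs := cs)): w => [a' b' w hw|w w' hw hw']; last first.
  by rewrite mulrDr !linearD /= hw hw' !mulrDr addrACA.
rewrite (deg_bihom _ (bihomM hv hw)) addnACA.
rewrite !(deg_bihom _ hv) !(deg_bihom _ hw).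
case: (a + b)%N (a' + b')%N => [|[|k]] [|[|l]] //=;
  by rewrite ?(mulr0, mul0r, addr0, add0r).
Qed.

(** Induction over the algebra generators, applied to the degree 1 part of an arbitrary form;
    [deg1M] handles products. A right factor is moved to the left by the Leibniz rule, (a db) c = a
    d(bc) - ab dc. *)
Lemma one_form_span w : deg 1 w = w ->
  exists s : seq (B * B), w = \sum_(z <- s) emb z.1 * dif (emb z.2).
Proof.
pose Q v := exists s : seq (B * B), v = \sum_(z <- s) emb z.1 * dif (emb z.2).
have Q0 : Q 0 by exists [::]; rewrite big_nil.
have QD u v : Q u -> Q v -> Q (u + v).
  by move=> [s ->] [t ->]; exists (s ++ t); rewrite big_cat.
have Ql b v : Q v -> Q (emb b * v).
  move=> [s ->]; exists [seq (b * z.1, z.2) | z <- s];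
    rewrite big_map mulr_sumr.
  by apply: eq_bigr => z _; rewrite rmorphM mulrA.
have Q1 a b : Q (emb a * dif (emb b)) by exists [:: (a, b)]; rewrite big_seq1.
have Qr v b : Q v -> Q (v * emb b).
  move=> [s ->]; rewrite mulr_suml; apply: (big_ind Q) => // z _.
  have -> : emb z.1 * dif (emb z.2) * emb b = emb z.1 * dif (emb (z.2 * b)) +
      emb (- (z.1 * z.2)) * dif (emb b).
    rewrite [emb (z.2 * b)]rmorphM dif_embl mulrDr rmorphN rmorphM mulNr !mulrA.
    by rewrite addrK.
  by apply: QD.
move=> <-; apply: (cal_gen (P := fun w => Q (deg 1 w))) => {w}.
- by move=> b /=; rewrite -(deg_emb b) deg_deg; exact: Q0.
- by move=> b /=; rewrite deg1_dif -[dif _]mul1r -(rmorph1 emb); exact: Q1.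
- move=> c v w hv hw; rewrite linearP; apply: QD => //=.
  by rewrite -[deg 1 v]mul1r scalerAl -(rmorph1 emb) -linearZ; apply: Ql.
- move=> v w hv hw; rewrite deg1M.
  have [b ->] : exists b, deg 0 v = emb b by apply/deg0P; rewrite deg_deg.
  have [b' ->] : exists b, deg 0 w = emb b by apply/deg0P; rewrite deg_deg.
  by apply: QD; [apply: Ql|apply: Qr].
Qed.

Lemma star_bal : balanced (M := vs A) (N := vs Om)
  (fun a x => star a ⊗ cstar x).
Proof. by apply: balanced_semilin; [apply: star_semilin|apply: cstar_semilin].
  Qed.

Lemma sw_cov_mul (W : lmodType C) (f : A -> Om -> W) v w :
  (forall x, linear (f^~ x)) -> (forall a, linear (f a)) ->
  \sw_(a, x <- delta (v * w)) f a x =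
  \sw_(a, x <- delta v) \sw_(b, y <- delta w) f (a * b) ((x : Om) * y).
Proof. by move=> fl fr; rewrite cov_mul// tprod_sw. Qed.

Lemma cov_dif_emb b :
  delta (dif (emb b)) = \sw_(p, q <- base_coact b) p ⊗ dif (emb (q : B)).
Proof.
have ld : linear dif by exact: linearP.
by rewrite cov_dif// cov_emb// {2}/tmap tmap_sw.
Qed.

(** Compatibility of star with the coaction is not part of a covariant calculus. On one-forms it
    follows from [base_coact_star], because they are sums of products a db and star commutes with
    [dif]. *)
Lemma cov_star1 w : deg 1 w = w ->
  delta (cstar w) = \sw_(a, x <- delta w) star a ⊗ cstar x.
Proof.
move=> /one_form_span[s ->].
rewrite (add_sumE _ _ (semilinD (@cstar_semilin _ _ Om))).
rewrite !(lin_sumE _ _ dlin).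
rewrite (add_sumE _ _ (fun x y => tliftD x y star_bal)).
apply: eq_bigr => z _.
rewrite (cstar_embl cs) -cstar_dif cstar_emb.
have -> : delta (emb z.1 * dif (emb z.2)) = \sw_(p, q <- base_coact z.1)
    \sw_(v, y <- base_coact z.2) (p * v) ⊗ (emb (q : B) * dif (emb (y : B))).
  rewrite -[LHS]sw_id sw_cov_mul; [|lin_tac..].
  rewrite sw_delta_emb; [|lin_tac..]; apply: eq_sw => p q.
  by rewrite cov_dif_emb sw_sw//; lin_tac.
rewrite -[LHS]sw_id sw_cov_mul; [|lin_tac..].
rewrite cov_dif_emb !base_coact_star sw_sw; [|lin_tac..].
transitivity (\sw_(a, x <- base_coact z.2) \sw_(b, y <- base_coact z.1)
   (star a * star b) ⊗ (dif (emb (star (x : B))) * emb (star (y : B)))).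
  rewrite sw_sw; [|lin_tac..]; apply: eq_sw => a x; rewrite sw_delta_emb;
    [|lin_tac..].
  by rewrite base_coact_star sw_sw//; lin_tac.
rewrite sw_exchange (add_sw _ _ (fun x y => tliftD x y star_bal)).
apply: eq_sw => b y; rewrite (bal_sw _ _ _ star_bal); apply: eq_sw => a x.
by rewrite starM (cstar_embl cs) -cstar_dif cstar_emb.
Qed.

End CovariantCalculus.

(** * Frames of Hermitian modules *)

Section Frame.
Context {C : numClosedFieldType} {B : star_alg C} (F : bimodule B).

Definition row_comb n (e : 'I_n -> F) (u : 'rV[B]_n) : left_mod F :=
  \sum_i lact (u ord0 i) (e i).

Fact row_comb_linear n (e : 'I_n -> F) : linear (row_comb e).
Proof.
move=> b u v; rewrite /row_comb scaler_sumr -big_split; apply: eq_bigr => i _.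
rewrite !mxE; have -> : b *: (lact (u ord0 i) (e i) : left_mod F) =
  lact (b * u ord0 i) (e i) by rewrite lactA.
exact: (left_scaleDl (F := F)).
Qed.

HB.instance Definition _ n (e : 'I_n -> F) :=
  GRing.isLinear.Build B 'rV[B]_n (left_mod F) _ (row_comb e)
    (row_comb_linear e).

(** The dual basis lemma: projectivity splits the map from the free module, and bijectivity of [h]
    represents the resulting coordinate functionals by elements [f i]. *)
Lemma hermitian_frame (h : conj_mod F -> dual F) : hermitian_module h ->
  exists n (e f : 'I_n -> F), forall x, x = \sum_i lact (h (cj (f i)) x) (e i).
Proof.
move=> hh; have [n [e _ he]] := hermm_fingen hh.
have surj y : exists u, row_comb e u = y.
  have [b ->] := he y I; exists (\row_i b i).
  by apply: eq_bigr => i _; rewrite mxE.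
have [s hs] := hermm_projective hh (p := row_comb e) idfun surj.
have sl i : left_linear (fun x : F => s (x : left_mod F) ord0 i).
  split=> [x y|b x].
    have -> : s (x + y : left_mod F) = s (x : left_mod F) + s (y : left_mod F)
      by exact: raddfD.
    by rewrite mxE.
  have -> : s (lact b x : left_mod F) = b *: s (x : left_mod F) by exact:
    linearZ.
  by rewrite mxE.
have [g hg gh] := hermm_bij hh.
exists n, e, (fun i => g (Dual (sl i))) => x; rewrite -{1}[x]hs.
by apply: eq_bigr => i _; rewrite /cj gh.
Qed.

End Frame.

(** * Hermitian pairing and connections *)

Section Pairing.
Context {C : numClosedFieldType} (X : cqh_hermitian C).
Local Notation K := (cqh_qhs X).
Local Notation B := (base K).
Local Notation Om := (cqh_om X).
Local Notation emb := (emb Om).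
Local Notation dif := (dif Om).
Local Notation deg := (deg Om).
Local Notation cs := (cqh_cs X).
Local Notation bideg := (bideg cs).
Local Notation n := (cqh_n X).
Local Notation cstar := (@cstar C B Om).
Context (E : bimodule B).

Lemma mformDl (v w : Om) (f : E) : mform (v + w) f = mform v f + mform w f.
Proof. by have [h _ _] := pure_balanced (cal_mod Om) E; apply: h. Qed.

Lemma mformDr (w : Om) (f g : E) : mform w (f + g) = mform w f + mform w g.
Proof. by have [_ h _] := pure_balanced (cal_mod Om) E; apply: h. Qed.

Lemma mform_emb (w : Om) b (f : E) : mform (w * emb b) f = mform w (lact b f).
Proof. by have [_ _ h] := pure_balanced (cal_mod Om) E; apply: (h w b f). Qed.

Lemma mformZ c (w : Om) (f : E) : mform (c *: w) f = c *: mform w f.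
Proof. by rewrite /mform scale_pure. Qed.

Lemma mform_linl (f : E) : linear (fun w : Om => mform w f).
Proof. by move=> c v w; rewrite mformDl mformZ. Qed.

Lemma mform_linr (w : Om) : linear (fun f : E => mform w f).
Proof.
move=> c f g; rewrite mformDr; congr (_ + _).
rewrite -[f in LHS]lact1 -lact_scalel -mform_emb linearZ /= rmorph1.
by rewrite -scalerAr mulr1 mformZ.
Qed.

Lemma wedge_bal (w : Om) :
  balanced (M := cal_mod Om) (N := E)
    (fun (v : cal_mod Om) f => mform (w * v) f).
Proof.
split=> [u v f|u f g|u b f].
- by rewrite -mformDl -mulrDr.
- exact: mformDr.
- by rewrite -mform_emb -mulrA.
Qed.

Lemma wedge_mform (w v : Om) (f : E) : wedge w (mform v f) = mform (w * v) f.
Proof. exact: (tlift_pure _ _ (wedge_bal w)). Qed.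

Lemma wedgeDr (w : Om) (t u : mforms E) : wedge w (t + u) = wedge w t + wedge w
  u.
Proof. exact: (tliftD _ _ (wedge_bal w)). Qed.

Lemma mforms_ind (P : mforms E -> Prop) : (forall w f, P (mform w f)) ->
  (forall t u, P t -> P u -> P (t + u)) -> forall t, P t.
Proof.
move=> Pp PD; apply: tensor_ind => //; have := Pp 0 0.
by have -> : mform 0 (0 : E) = 0 by rewrite (lin0 (mform_linl 0)).
Qed.

Lemma wedgeA (v w : Om) (t : mforms E) : wedge v (wedge w t) = wedge (v * w) t.
Proof.
elim/mforms_ind: t => [u f|t u ht hu]; first by rewrite !wedge_mform mulrA.
by rewrite !wedgeDr ht hu.
Qed.

Lemma wedgeDl (v w : Om) (t : mforms E) : wedge (v + w) t = wedge v t + wedge w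
  t.
Proof.
elim/mforms_ind: t => [u f|t u ht hu].
  by rewrite !wedge_mform mulrDl mformDl.
by rewrite !wedgeDr ht hu addrACA.
Qed.

Lemma gsign_deg k (w : Om) : deg k w = w -> gsign w = (-1) ^+ k *: w.
Proof.
move=> hw; rewrite /gsign.
have E1 (i : 'I_n.*2.+1) : (-1) ^+ i *: deg i w =
    if (i : nat) == k then (-1) ^+ k *: w else 0.
  rewrite -[w in deg i w]hw deg_deg; case: eqP => [->|_]; rewrite ?scaler0//.
  by rewrite hw.
under eq_bigr do rewrite E1.
case: (leqP k n.*2) => hk.
  rewrite (bigD1 (Ordinal (hk : k < n.*2.+1)%N))//= eqxx big1 ?addr0// => i.
  by rewrite -val_eqE /= => /negbTE ->.
rewrite -hw (cqh_total X).2// scaler0 big1// => i _.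
by case: ifP.
Qed.

Lemma gsign_lin : linear (@gsign C X).
Proof.
move=> c v w; rewrite /gsign scaler_sumr -big_split; apply: eq_bigr => k _.
by rewrite linearP /= scalerDr !scalerA mulrC.
Qed.

Lemma gsign_embr (w : Om) b : gsign (w * emb b) = gsign w * emb b.
Proof.
rewrite /gsign mulr_suml; apply: eq_bigr => k _.
by rewrite (deg_embr cs) scalerAl.
Qed.

Lemma dif_embr (w : Om) b : dif (w * emb b) = dif w * emb b + gsign w * dif
  (emb b).
Proof.
elim/(form_ind (cs := cs)): w => [a c w hw|v w hv hw].
  have hk := bihom_deg hw (erefl _).
  by rewrite (difM _ hk) (gsign_deg hk) scalerAl.
rewrite mulrDl !linearD /= (linD gsign_lin) hv hw !mulrDl.
by rewrite addrACA.
Qed.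

(** The component of bidegree (a, c+1) of the Leibniz rule: the (1,0)-part of db contributes only in
    (a+1, c). Since [delbar] is a truncated sum, forms of degree above 2n are treated apart; they
    vanish. *)
Lemma delb_embr (w : Om) b :
  delb (w * emb b) = delb w * emb b + gsign w * delb (emb b).
Proof.
have dl := delbar_lin cs n.*2.
elim/(form_ind (cs := cs)): w => [a c w hw|v w hv hw]; last first.
  rewrite mulrDl /delb !(linD dl) -/delb (linD gsign_lin).
  by rewrite /delb in hv hw *; rewrite hv hw !mulrDl addrACA.
case: (leqP (a + c) n.*2) => hac; last first.
  rewrite -(bihom_deg hw (erefl _)) (cqh_total X).2// mul0r /delb (lin0 dl).
  by rewrite (lin0 gsign_lin) !mul0r addr0.
have ha : (a <= n.*2)%N by apply: leq_trans hac; apply: leq_addr.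
have hc : (c <= n.*2)%N by apply: leq_trans hac; apply: leq_addl.
have hwb : bihom cs a c (w * emb b).
  by have := bihomM hw (bihom_emb cs b); rewrite !addn0.
rewrite /delb (delbar_bihom _ _ hwb)// (delbar_bihom _ _ hw)//.
rewrite (delbar_bihom _ _ (bihom_emb cs b))//.
rewrite dif_embr linearD /= bideg_embr; congr (_ + _).
rewrite (gsign_deg (bihom_deg hw (erefl _))) -!scalerAl linearZ /=;
  congr (_ *: _).
rewrite {1}(one_form_split cs (deg1_dif b)) mulrDr linearD /=.
rewrite (bideg_bihom _ _ (bihomM hw (bihom_bideg _ 1 0 _))).
rewrite (bideg_bihom _ _ (bihomM hw (bihom_bideg _ 0 1 _))).
by rewrite !addn0 !addn1 !eqxx (ltn_eqF (ltnSn a)) /= add0r.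
Qed.

(** * Extension of a connection to forms, for [dif] and [delb] alike *)

Section ConnExt.
Context (dd : Om -> Om) (nab : E -> mforms E).
Hypotheses (ddD : forall v w, dd (v + w) = dd v + dd w).
Hypothesis dd_embr : forall w b,
  dd (w * emb b) = dd w * emb b + gsign w * dd (emb b).
Hypothesis nabD : forall e f, nab (e + f) = nab e + nab f.
Hypothesis nab_lact : forall b f,
  nab (lact b f) = mform (dd (emb b)) f + wedge (emb b) (nab f).

Lemma conn_ext_bal : balanced (M := cal_mod Om) (N := E)
  (fun (w : cal_mod Om) f => mform (dd w) f + wedge (gsign (w : Om)) (nab f)).
Proof.
split=> [v w f|w f g|w b f].
- by rewrite ddD mformDl (linD gsign_lin) wedgeDl addrACA.
- by rewrite nabD wedgeDr mformDr addrACA.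
- rewrite /= /cal_ract dd_embr mformDl mform_emb nab_lact wedgeDr wedge_mform.
  by rewrite wedgeA gsign_embr addrA.
Qed.

Lemma conn_ext_mform (w : Om) f :
  conn_ext dd nab (mform w f) = mform (dd w) f + wedge (gsign w) (nab f).
Proof. exact: (tlift_pure _ _ conn_ext_bal). Qed.

Lemma conn_extD t u : conn_ext dd nab (t + u) = conn_ext dd nab t + conn_ext dd
  nab u.
Proof. exact: (tliftD _ _ conn_ext_bal). Qed.

End ConnExt.

Context (h : conj_mod E -> dual E) (hh : hermitian_module h).
Local Notation hp f g := (h (cj g) f : B).
Local Notation pair := (herm_pairing h).

Lemma hp_lactl b f g : hp (lact b f) g = b * hp f g.
Proof. exact: dual_lact. Qed.

Lemma hp_lactr b f g : hp f (lact b g) = hp f g * star b.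
Proof.
have -> : cj (lact b g) = ract (cj g) (star b) by rewrite /= /conj_ract starK.
by rewrite (hermm_ract hh).
Qed.

Lemma hpDl f f' g : hp (f + f') g = hp f g + hp f' g.
Proof. exact: dualD. Qed.

Lemma hpDr f g g' : hp f (g + g') = hp f g + hp f g'.
Proof. by have -> : h (cj (g + g')) = h (cj g) + h (cj g') by apply: hermm_add.
  Qed.

Lemma cstar1 : cstar 1 = 1.
Proof. by rewrite -(rmorph1 emb) cstar_emb star1. Qed.

Lemma pair_bal1 (w : Om) f : balanced (M := cal_mod Om) (N := E)
  (fun (v : cal_mod Om) g => w * emb (hp f g) * cstar (v : Om)).
Proof.
split=> [u v g|v g g'|v b g].
- by rewrite (semilinD (@cstar_semilin _ _ Om)) mulrDr.
- by rewrite hpDr raddfD mulrDr mulrDl.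
- by rewrite /= /cal_ract (cstar_embr cs) hp_lactr rmorphM !mulrA.
Qed.

Lemma pair_bal2 (u : mforms E) : balanced (M := cal_mod Om) (N := E)
  (fun (w : cal_mod Om) f => tlift (fun (v : cal_mod Om) g =>
    (w : Om) * emb (hp f g) * cstar (v : Om)) u).
Proof.
rewrite /tlift /formal_eval; split=> [w w' f|w f f'|w b f].
- by rewrite -big_split; apply: eq_bigr => z _ /=; rewrite !mulrDl.
- by rewrite -big_split; apply: eq_bigr => z _ /=;
  rewrite hpDl raddfD mulrDr mulrDl.
- apply: eq_bigr => z _; rewrite /= /cal_ract hp_lactl rmorphM !mulrA //.
Qed.

Lemma pair_mform (w v : Om) f g :
  pair (mform w f) (mform v g) = w * emb (hp f g) * cstar v.
Proof.
rewrite /herm_pairing (tlift_pure _ _ (pair_bal2 _)).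
by rewrite (tlift_pure _ _ (pair_bal1 _ _)).
Qed.

Lemma pairDl t t' u : pair (t + t') u = pair t u + pair t' u.
Proof. exact: (tliftD _ _ (pair_bal2 _)). Qed.

Lemma pairDr t u u' : pair t (u + u') = pair t u + pair t u'.
Proof.
rewrite /herm_pairing {1 3 5}/tlift /formal_eval -big_split;
  apply: eq_bigr => z _.
by rewrite /= (tliftD _ _ (pair_bal1 _ _)).
Qed.

Lemma pair_mform1 (w : Om) f g : pair (mform w f) (mform 1 g) = w * emb
  (hp f g).
Proof. by rewrite pair_mform cstar1 mulr1. Qed.

Lemma pair_wedge (w : Om) t u : pair (wedge w t) u = w * pair t u.
Proof.
elim/mforms_ind: t => [v f|t t' ht ht']; last first.
  by rewrite wedgeDr !pairDl ht ht' mulrDr.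
rewrite wedge_mform; elim/mforms_ind: u => [u g|u u' hu hu'].
  by rewrite !pair_mform !mulrA.
by rewrite !pairDr hu hu' mulrDr.
Qed.

Lemma pair_mforml (w : Om) f u : pair (mform w f) u = w * pair (mform 1 f) u.
Proof. by rewrite -pair_wedge wedge_mform mulr1. Qed.

Lemma pair_lactl b f u : pair (mform 1 (lact b f)) u = emb b * pair (mform 1 f)
  u.
Proof. by rewrite -mform_emb mul1r pair_mforml. Qed.

Lemma pair_lactr b t g : pair t (mform 1 (lact b g)) = pair t (mform 1 g) * emb
  (star b).
Proof.
elim/mforms_ind: t => [w f|t u ht hu]; last by rewrite !pairDl ht hu mulrDl.
by rewrite !pair_mform1 hp_lactr rmorphM mulrA.
Qed.

Lemma pair_scale c t u : pair (c *: t) u = c *: pair t u.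
Proof.
elim/mforms_ind: t => [w f|t t' ht ht']; last first.
  by rewrite scalerDr !pairDl ht ht' scalerDr.
rewrite -mformZ; elim/mforms_ind: u => [u g|u u' hu hu'].
  by rewrite !pair_mform -!scalerAl.
by rewrite !pairDr hu hu' scalerDr.
Qed.

Lemma pair_lin u : linear (fun t => pair t u).
Proof. by move=> c t t'; rewrite pairDl pair_scale. Qed.

Lemma pair_star t g : pair (mform 1 g) t = cstar (pair t (mform 1 g)).
Proof.
elim/mforms_ind: t => [w f|t u ht hu].
  by rewrite pair_mform1 pair_mform (cstar_embr cs) mul1r (hermm_sym hh).
by rewrite pairDr pairDl ht hu (semilinD (@cstar_semilin _ _ Om)).
Qed.

(** Module-valued forms are determined by their pairings with the frame, so identities between them
    can be tested on scalar forms. *)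
Lemma pair_frame m (e f : 'I_m -> E) :
  (forall x, x = \sum_i lact (hp x (f i)) (e i)) ->
  forall t, t = \sum_i mform (pair t (mform 1 (f i))) (e i).
Proof.
move=> hef; elim/mforms_ind => [w x|t u ht hu]; last first.
  rewrite {1}ht {1}hu -big_split; apply: eq_bigr => i _ /=.
  by rewrite pairDl mformDl.
rewrite {1}[x]hef (lin_sumE _ _ (mform_linr w)); apply: eq_bigr => i _.
by rewrite pair_mform1 mform_emb.
Qed.

Lemma tspan_ind (P : Om -> Prop) (Q : mforms E -> Prop) :
  (forall w f, P w -> Q (mform w f)) -> Q 0 ->
  (forall t u, Q t -> Q u -> Q (t + u)) ->
  forall t, tspan (M := cal_mod Om) (N := E) P (fun=> True) t -> Q t.
Proof.
move=> hp h0 hD t [s hs ->]; rewrite big_seq;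
  apply: (big_ind Q) => // z /hs[hz _].
exact: hp.
Qed.

End Pairing.

(** * The Chern curvature form *)

Section ChernCurvature.
Context {C : numClosedFieldType} (X : cqh_hermitian C).
Local Notation K := (cqh_qhs X).
Local Notation B := (base K).
Local Notation Om := (cqh_om X).
Local Notation emb := (emb Om).
Local Notation dif := (dif Om).
Local Notation deg := (deg Om).
Local Notation cs := (cqh_cs X).
Local Notation bideg := (bideg cs).
Local Notation n := (cqh_n X).
Local Notation cstar := (@cstar C B Om).
Context (E : bimodule B) (h : conj_mod E -> dual E) (hh : hermitian_module h).
Context (dbF nabla : E -> mforms E).
Hypotheses (hol : holomorphic dbF) (chern : chern_connection h dbF nabla).
Local Notation hp f g := (h (cj g) f : B).
Local Notation pair := (herm_pairing h).

Definition conn_form e g : Om := pair (nabla e) (mform 1 g).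
Definition conn_form_star e g : Om := pair (mform 1 e) (nabla g).
Definition dbar_form e g : Om := pair (dbF e) (mform 1 g).
Definition mixed_form e g : Om := pair (nabla e) (nabla g).
Definition curv_form e g : Om := pair (curvature dif nabla e) (mform 1 g).

Let nlin : linear nabla.
Proof. by case: chern => -[]. Qed.
Let nspan f : tspan (M := cal_mod Om) (N := E) (@one_form _ X) (fun _ => True)
  (nabla f).
Proof. by case: chern => -[]. Qed.
Let nlact b f : nabla (lact b f) = mform (dif (emb b)) f + wedge (emb b)
  (nabla f).
Proof. by case: chern => -[]. Qed.
Let dlin : linear dbF.
Proof. by case: hol => _ _ []. Qed.
Let dlact b f : dbF (lact b f) = mform (delb (emb b)) f + wedge (emb b) (dbF f).
Proof. by case: hol => _ _ []. Qed.

Lemma chern_leibniz e g :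
  dif (emb (hp e g)) = conn_form e g + conn_form_star e g.
Proof. by case: chern. Qed.

Lemma conn_form_starE e g : conn_form_star e g = cstar (conn_form g e).
Proof. exact: (pair_star hh). Qed.

Lemma conn_form_deg e g : deg 1 (conn_form e g) = conn_form e g.
Proof.
apply: (tspan_ind (Q := fun t =>
  deg 1 (pair t (mform 1 g)) = pair t (mform 1 g)) _ _ _ (nspan e)) =>
  [w f hw||t u ht hu].
- by rewrite (pair_mform1 hh) (deg_embr cs) hw.
- by rewrite (lin0 (pair_lin hh _)) linear0.
- by rewrite pairDl linearD /= ht hu.
Qed.

Lemma conn_form_star_deg e g : deg 1 (conn_form_star e g) = conn_form_star e g.
Proof.
have -> : conn_form_star e g = dif (emb (hp e g)) - conn_form e g.
  by rewrite chern_leibniz addrC addKr.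
by rewrite linearB /= conn_form_deg deg1_dif.
Qed.

(** [dbF] is the (0,1)-part of [nabla]; the principle follows both through the same decomposition
    into pure tensors. *)
Lemma dbF_ind (Q : mforms E -> mforms E -> Prop) e :
  (forall w f, deg 1 w = w -> Q (mform w f) (mform (bideg 0 1 w) f)) -> Q 0 0 ->
  (forall t u t' u', Q t t' -> Q u u' -> Q (t + u) (t' + u')) -> Q (nabla e)
    (dbF e).
Proof.
move=> hp h0 hD; have [_ _ ->] := chern.
have bal : balanced (M := cal_mod Om) (N := E)
    (fun (w : cal_mod Om) k => mform (bideg 0 1 w) k).
  split=> [v w f|w f g|w b f].
  - by rewrite linearD mformDl.
  - exact: mformDr.
  - by rewrite /= /cal_ract bideg_embr mform_emb.
apply: (tspan_ind (Q := fun t => Q t (tlift _ t)) _ _ _ (nspan e)) =>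
  [w f hw||t u ht hu].
- by rewrite (tlift_pure _ _ bal); exact: hp.
- by rewrite (tlift0 bal).
- by rewrite (tliftD _ _ bal); exact: hD.
Qed.

Lemma dbar_formE e g : dbar_form e g = bideg 0 1 (conn_form e g).
Proof.
rewrite /dbar_form /conn_form; apply: (dbF_ind (Q := fun t t' =>
  pair t' (mform 1 g) = bideg 0 1 (pair t (mform 1 g)))) =>
    [w f hw||t u t' u' ht hu].
- by rewrite !(pair_mform1 hh) bideg_embr.
- by rewrite (lin0 (pair_lin hh _)) linear0.
- by rewrite !pairDl linearD /= ht hu.
Qed.

(** The formula behind uniqueness of the Chern connection: the (0,1)-part is given by [dbF], and the
    Hermitian condition expresses the (1,0)-part through the star of a (0,1)-part. Covariance of the
    connection is read off from it. *)
Lemma conn_formE e g : conn_form e g =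
  bideg 1 0 (dif (emb (hp e g))) - cstar (dbar_form g e) + dbar_form e g.
Proof.
rewrite {1}(one_form_split cs (conn_form_deg e g)) -dbar_formE; congr (_ + _).
rewrite chern_leibniz linearD /= conn_form_starE (bideg_cstar cs) dbar_formE.
by rewrite addrK.
Qed.

Let extE := conn_ext_mform (fun v w => linearD dif v w) (@dif_embr _ X)
  (linD nlin) nlact.
Let extD := conn_extD (fun v w => linearD dif v w) (@dif_embr _ X) (linD nlin)
  nlact.
Let dextE := conn_ext_mform (linD (delbar_lin cs n.*2)) (@delb_embr _ X)
  (linD dlin) dlact.
Let dextD := conn_extD (linD (delbar_lin cs n.*2)) (@delb_embr _ X) (linD dlin)
  dlact.
Let ext0 : conn_ext dif nabla 0 = 0.
Proof. by apply: (addrI (conn_ext dif nabla 0)); rewrite -extD !addr0. Qed.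
Let dext0 : conn_ext (@delb _ X) dbF 0 = 0.
Proof. by apply: (addrI (conn_ext (@delb _ X) dbF 0)); rewrite -dextD !addr0.
  Qed.

(** Metric compatibility extended to one-forms. For a one-form [w], the Leibniz rule replaces -w
    h(nabla f, g) by -w d h(f, g) + w h(f, nabla g). *)
Lemma curv_formE e g : curv_form e g = dif (conn_form e g) + mixed_form e g.
Proof.
rewrite /curv_form /curvature /conn_form /mixed_form.
apply: (tspan_ind (Q := fun t => pair (conn_ext dif nabla t) (mform 1 g) =
  dif (pair t (mform 1 g)) + pair t (nabla g)) _ _ _ (nspan e)) =>
  [w f hw||t u ht hu].
- rewrite extE pairDl !(pair_mform1 hh) (pair_wedge hh) (gsign_deg hw) dif_embr.
  rewrite (gsign_deg hw) expr1 scaleN1r !mulNr -addrA; congr (_ + _).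
  rewrite -/(conn_form f g) chern_leibniz mulrDr opprD
    [pair _ (nabla g)](pair_mforml hh).
  by rewrite addrNK.
- by rewrite ext0 !(lin0 (pair_lin hh _)) linear0 addr0.
- by rewrite extD !pairDl linearD /= ht hu addrACA.
Qed.

Lemma conn_form_lactl b e g :
  conn_form (lact b e) g = dif (emb b) * emb (hp e g) + emb b * conn_form e g.
Proof. by rewrite /conn_form nlact pairDl (pair_mform1 hh) (pair_wedge hh). Qed.

Lemma conn_form_star_lactl b e g :
  conn_form_star (lact b e) g = emb b * conn_form_star e g.
Proof. exact: (pair_lactl hh). Qed.

(** The terms in db cancel: those of [conn_form] and [conn_form_star] add up to db d h(e, g), while
    d(db h(e, g)) gives its negative. *)
Lemma curv_form_lactl b e g : curv_form (lact b e) g = emb b * curv_form e g.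
Proof.
rewrite !curv_formE conn_form_lactl linearD /= dif_embl dif_embr dif_dif mul0r.
rewrite /mixed_form nlact pairDl (pair_mforml hh) (pair_wedge hh).
rewrite (gsign_deg (deg1_dif b)) expr1 scaleN1r mulNr add0r chern_leibniz.
rewrite -/(conn_form_star e g) -/(mixed_form e g) !mulrDr.
by rewrite -addrA [in X in _ + X]addrACA addKr.
Qed.

Lemma curv_form_lactr b e g : curv_form e (lact b g) = curv_form e g * emb
  (star b).
Proof. exact: (pair_lactr hh). Qed.

Lemma curv_formDl e e' g : curv_form (e + e') g = curv_form e g + curv_form e'
  g.
Proof. by rewrite /curv_form /curvature (linD nlin) extD pairDl. Qed.

Lemma curv_formDr e g g' : curv_form e (g + g') = curv_form e g + curv_form e
  g'.
Proof. by rewrite /curv_form mformDr (pairDr hh). Qed.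

Lemma mixed_form_star e g : cstar (mixed_form e g) = - mixed_form g e.
Proof.
have s0 : cstar 0 = 0 by exact: cstar0.
have sD := semilinD (@cstar_semilin _ _ Om).
have p0 t : pair t 0 = 0 by apply: (addrI (pair t 0));
  rewrite -(pairDr hh) !addr0.
rewrite /mixed_form.
apply: (tspan_ind (Q := fun t => cstar (pair t (nabla g)) = - pair (nabla g) t)
  _ _ _ (nspan e)) => [w f hw||t u ht hu].
- apply: (tspan_ind (Q := fun t => cstar (pair (mform w f) t) = - pair t
  (mform w f))
    _ _ _ (nspan g)) => [v k hv||t u ht hu].
  + rewrite !(pair_mform hh) (cstarM1 (v := w * emb (hp f k))).
    * by rewrite cstarK (cstar_embr cs) -(hermm_sym hh) mulrA.
    * by rewrite (deg_embr cs) hw.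
    * exact: (deg1_cstar cs).
  + by rewrite p0 (lin0 (pair_lin hh _)) s0 oppr0.
  + by rewrite (pairDr hh) pairDl sD ht hu opprD.
- by rewrite p0 (lin0 (pair_lin hh _)) s0 oppr0.
- by rewrite (pairDr hh) pairDl sD ht hu opprD.
Qed.

(** The differentials of h(nabla e, g) and h(e, nabla g) are opposite, since their sum is the square
    of [dif] on h(e, g). *)
Lemma curv_form_star e g : cstar (curv_form e g) = - curv_form g e.
Proof.
rewrite !curv_formE (semilinD (@cstar_semilin _ _ Om)) -cstar_dif.
rewrite -conn_form_starE mixed_form_star opprD; congr (_ - _).
apply/eqP; rewrite -addr_eq0 -linearD /= addrC -chern_leibniz.
by rewrite dif_dif.
Qed.

Lemma curv_form_deg e g : deg 2 (curv_form e g) = curv_form e g.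
Proof.
rewrite curv_formE linearD /= (deg_dif (conn_form_deg e g)); congr (_ + _).
rewrite /mixed_form.
apply: (tspan_ind (Q := fun t => deg 2 (pair t (nabla g)) = pair t (nabla g))
  _ _ _ (nspan e)) => [w f hw||t u ht hu].
- by rewrite (pair_mforml hh) (degM hw (conn_form_star_deg f g)).
- by rewrite (lin0 (pair_lin hh _)) linear0.
- by rewrite pairDl linearD /= ht hu.
Qed.

Lemma curv_form02 e g : bideg 0 2 (curv_form e g) = 0.
Proof.
have [_ _ _ fl] := hol.
suff -> : bideg 0 2 (curv_form e g) =
    pair (curvature (@delb _ X) dbF e) (mform 1 g).
  by rewrite fl (lin0 (pair_lin hh _)).
rewrite /curv_form /curvature; apply: (dbF_ind (Q := fun t t' =>
  bideg 0 2 (pair (conn_ext dif nabla t) (mform 1 g)) =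
  pair (conn_ext (@delb _ X) dbF t') (mform 1 g))) => [w f hw||t u t' u' ht hu].
- rewrite extE dextE !pairDl !(pair_mform1 hh) !(pair_wedge hh).
  rewrite (gsign_deg hw) (gsign_deg
    (bihom_deg (bihom_bideg cs 0 1 w) (erefl _))).
  rewrite !expr1 !scaleN1r !mulNr linearB /= bideg_embr.
  rewrite (bideg02M cs hw (conn_form_deg f g)) -dbar_formE; congr (_ * _ - _).
  rewrite bideg02_dif// /delb (delbar_bihom _ _ (bihom_bideg cs 0 1 w))//.
  (* Bidegree (0,1) is within the truncation of [delb] at 2n because n > 0. *)
  by rewrite -muln2 muln_gt0 cqh_n_gt0.
- by rewrite ext0 dext0 !(lin0 (pair_lin hh _)) linear0.
- by rewrite extD dextD !pairDl linearD /= ht hu.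
Qed.

Lemma curv_form_bihom e g : bihom cs 1 1 (curv_form e g).
Proof.
rewrite /bihom {2}(two_form_split cs (curv_form_deg e g)) curv_form02 add0r.
suff -> : bideg 2 0 (curv_form e g) = 0 by rewrite addr0.
rewrite -[curv_form e g]opprK -(curv_form_star g e) linearN /= (bideg_cstar cs).
rewrite curv_form02; by rewrite cstar0 oppr0.
Qed.

End ChernCurvature.

(** * Covariance of the curvature form *)

Section CovariantForms.
Context {C : numClosedFieldType} (X : cqh_hermitian C).
Local Notation K := (cqh_qhs X).
Local Notation A := (qhsA K).
Local Notation B := (base K).
Local Notation Om := (cqh_om X).
Local Notation emb := (emb Om).
Local Notation dif := (dif Om).
Local Notation deg := (deg Om).
Local Notation cs := (cqh_cs X).
Local Notation bideg := (bideg cs).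
Local Notation cstar := (@cstar C B Om).
Local Notation delta := (@cqh_coact C X).
Let cov := cqh_cov X.
Let ccs := @cqh_cov_cs C X.
Let olin : linear delta := cov_linear cov.
Let elin : linear emb. Proof. exact: linearP. Qed.

Context (E : bimodule B) (dE : E -> (A ⊗ E)%type) (h : conj_mod E -> dual E).
Context (hE : rel_hopf dE) (hh : hermitian_module h).
Context (dE' : dual E -> (A ⊗ dual E)%type).
Hypotheses (hdual : dual_coaction dE dE')
  (hmor : rel_hopf_mor (conj_coact dE) dE' h).
Local Notation hp f g := (h (cj g) f : B).
Local Notation pair := (herm_pairing h).
Let dlin : linear dE := rh_linear hE.

(** Colinearity of [h] combined with colinearity of the evaluation on the dual. *)
Lemma herm_coact e g : base_coact (hp e g) =
  \sw_(a, x <- dE e) \sw_(b, y <- dE g) (a * star b) ⊗ (hp x y).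
Proof.
have lh : linear h := rhm_linear hmor.
have [_ <-] := hdual; rewrite (rhm_coact hmor) /tprod; apply: eq_sw => a x.
rewrite /conj_coact tmap_sw// sw_sw//; first by lin_tac.
by move=> b c psi psi' /=; rewrite -vpureZr -vpureDr.
Qed.

(* Colinearity of a map that is conjugate-linear in its second argument, whence
   [star b]. *)
Definition covariant2 (Z : E -> E -> Om) : Prop := forall e g,
  delta (Z e g) = \sw_(a, x <- dE e) \sw_(b, y <- dE g) (a * star b) ⊗ Z x y.

Lemma covariant2D Z Z' : covariant2 Z -> covariant2 Z' ->
  covariant2 (fun e g => Z e g + Z' e g).
Proof.
move=> hZ hZ' e g; rewrite (linD olin) hZ hZ' !swE -big_split.
apply: eq_bigr => p _; rewrite !swE -big_split; apply: eq_bigr => q _ /=.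
by rewrite -vpureDr.
Qed.

Lemma covariant2_map (f : Om -> Om) Z : linear f ->
  (forall w, delta (f w) = tmap idfun f (delta w)) ->
  covariant2 Z -> covariant2 (fun e g => f (Z e g)).
Proof.
move=> lf hf hZ e g; have lid : linear (@idfun A) by [].
rewrite hf hZ (lin_sw _ _ (lin_tmap lid lf)); apply: eq_sw => a x.
by rewrite (lin_sw _ _ (lin_tmap lid lf)); apply: eq_sw => b y;
  rewrite tmap_pure.
Qed.

Lemma covariant2N Z : covariant2 Z -> covariant2 (fun e g => - Z e g).
Proof.
apply: (covariant2_map (f := fun w => - w)); first by lin_tac.
move=> w; rewrite -scaleN1r (linZ olin) -[delta w in LHS]sw_id /tmap.
rewrite swE scaler_sumr; apply: eq_bigr => p _.
by rewrite -vpureZr scaleN1r.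
Qed.

Lemma covariant2_dif Z : covariant2 Z -> covariant2 (fun e g => dif (Z e g)).
Proof. by apply: covariant2_map; [exact: linearP|exact: cov_dif]. Qed.

Lemma covariant2_bideg a b Z : covariant2 Z -> covariant2
  (fun e g => bideg a b (Z e g)).
Proof. by apply: covariant2_map; [exact: linearP|exact: cov_bideg]. Qed.

Lemma covariant2_emb : covariant2 (fun e g => emb (hp e g)).
Proof.
move=> e g; have lid : linear (@idfun A) by [].
rewrite cov_emb// herm_coact (lin_sw _ _ (lin_tmap lid elin));
  apply: eq_sw => a x.
rewrite (lin_sw _ _ (lin_tmap lid elin)); apply: eq_sw => b y.
by rewrite tmap_pure.
Qed.

Lemma mforms_coact_bal : balanced (M := cal_mod Om) (N := E)
  (fun (w : cal_mod Om) f => tprod *%R (@mform _ X E) (cqh_coact w) (dE f)).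
Proof.
have ml := @mform_linl _ X E; have mr := @mform_linr _ X E.
split=> [v w f|w f g|w c f].
- by rewrite (linD olin) /tprod
  (linD (f := fun t => \sw_(a, x <- t) \sw_(b, y <- dE f)
    (a * b) ⊗ mform x y))//; lin_tac.
- by rewrite (linD dlin) /tprod
  (linD (f := fun t => \sw_(a, x <- _) \sw_(b, y <- t)
    (a * b) ⊗ mform x y))//; lin_tac.
- rewrite /tprod /= /cal_ract (sw_cov_mul cov); [|lin_tac..].
  apply: eq_sw => a x; rewrite (sw_delta_emb cov); [|lin_tac..].
  rewrite (sw_coact_lact hE); [|lin_tac..].
  apply: eq_sw => p q; apply: eq_sw => b y.
  by rewrite mulrA mform_emb.
Qed.

Lemma mforms_coact_mform w f : mforms_coact dE (mform w f) =
  \sw_(a, x <- delta w) \sw_(b, y <- dE f) (a * b) ⊗ mform x y.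
Proof. exact: (tlift_pure _ _ mforms_coact_bal). Qed.

Lemma mforms_coactD t u :
  mforms_coact dE (t + u) = mforms_coact dE t + mforms_coact dE u.
Proof. exact: (tliftD _ _ mforms_coact_bal). Qed.

Lemma pair_coact t g : delta (pair t (mform 1 g)) =
  \sw_(a, u <- mforms_coact dE t) \sw_(b, y <- dE g)
    (a * star b) ⊗ pair (u : mforms E) (mform 1 y).
Proof.
have pl := pair_lin hh.
elim/(@mforms_ind _ X E): t => [w f|t u ht hu]; last first.
  rewrite mforms_coactD pairDl (linD olin) ht hu.
  by rewrite [RHS](linD (f := fun T => \sw_(a, u <- T) \sw_(b, y <- dE g)
    (a * star b) ⊗ pair u (mform 1 y)))//; lin_tac.
rewrite (pair_mform1 hh) -[LHS]sw_id (sw_cov_mul cov); [|lin_tac..].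
rewrite mforms_coact_mform.
rewrite (lin_sw _ _ (f := fun T => \sw_(a, u <- T) \sw_(b, y <- dE g)
    (a * star b) ⊗ pair u (mform 1 y))); last by lin_tac.
apply: eq_sw => a x; rewrite sw_sw; [|lin_tac..].
rewrite (sw_delta_emb cov); [|lin_tac..].
rewrite herm_coact (lin_sw _ _ (f := fun T => \sw_(p, q <- T)
  (a * p) ⊗ (x * emb (q : B)))); last by lin_tac.
apply: eq_sw => b y; rewrite sw_sw; [|lin_tac..].
by apply: eq_sw => c z; rewrite mulrA (pair_mform1 hh).
Qed.

Context (dbF nabla : E -> mforms E).
Hypothesis chern : chern_connection h dbF nabla.
Hypothesis dbF_coact : forall f,
  mforms_coact dE (dbF f) = tmap idfun dbF (dE f).

Lemma covariant2_dbar : covariant2 (dbar_form h dbF).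
Proof.
have pl := pair_lin hh.
move=> e g; rewrite pair_coact dbF_coact /tmap sw_sw; [|lin_tac..].
by [].
Qed.

(** Colinearity of [nabla] is not among the hypotheses; every term of [conn_formE] is covariant. The
    star is applied to a form of bidegree (0,1), where [cov_star1] is available. *)
Lemma covariant2_conn : covariant2 (conn_form h nabla).
Proof.
have -> : conn_form h nabla = (fun e g => (bideg 1 0 (dif (emb (hp e g))) -
    cstar (dbar_form h dbF g e)) + dbar_form h dbF e g).
  by apply: funext => e; apply: funext => g; exact: conn_formE.
apply: covariant2D; last exact: covariant2_dbar.
apply: covariant2D; first exact/covariant2_bideg/covariant2_dif/covariant2_emb.
apply: covariant2N => e g; rewrite (cov_star1 cov cs); last first.
  by rewrite (dbar_formE hh chern) (bihom_deg (bihom_bideg _ _ _ _)).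
have SB := star_bal (Om := Om).
have SD := (fun x y => tliftD x y SB).
rewrite covariant2_dbar sw_exchange (add_sw _ _ SD).
apply: eq_sw => a x; rewrite (add_sw _ _ SD).
by apply: eq_sw => b y; rewrite (tlift_pure _ _ SB) starM starK.
Qed.

Lemma covariant2_conn_star : covariant2 (conn_form_star h nabla).
Proof.
have -> : conn_form_star h nabla =
    (fun e g => dif (emb (hp e g)) - conn_form h nabla e g).
  apply: funext => e; apply: funext => g.
  by rewrite (chern_leibniz chern) addrC addKr.
apply: covariant2D; first exact/covariant2_dif/covariant2_emb.
exact/covariant2N/covariant2_conn.
Qed.

(* Coinvariance of the Casimir element [\sum_j conj (f j) ⊗_B e j]. *)
Lemma frame_coinvariant m (e f : 'I_m -> E) :
  (forall x, x = \sum_i lact (hp x (f i)) (e i)) -> forall x,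
  \sum_j \sw_(b, y <- dE (f j)) \sw_(c, z <- dE (e j))
    (star b * c) ⊗ lact (hp x y) (z : E) = 1 ⊗ x.
Proof.
move=> hef x.
pose Fr (s : A) (v : E) : (A ⊗ E)%type
  := \sum_j \sw_(b, y <- dE (f j)) \sw_(c, z <- dE (e j))
    (s * (star b * c)) ⊗ lact (hp v y) (z : E).
(* The coaction applied to the frame expansion of [u]; the wanted identity appears with an
   additional left factor from dE(u). *)
have dEF u : dE u = \sw_(s, v <- dE u) Fr s v.
  rewrite {1}[u]hef (lin_sumE _ _ dlin) swE.
  rewrite /Fr exchange_big /=; apply: eq_bigr => j _.
  rewrite -[LHS]sw_id (sw_coact_lact hE); [|lin_tac..].
  rewrite herm_coact (lin_sw _ _
    (f := fun T => \sw_(p, q <- T) \sw_(a, z <- dE (e j))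
    (p * a) ⊗ lact (q : B) (z : E))); last by lin_tac.
  rewrite swE; apply: eq_bigr => p _; rewrite sw_sw; [|lin_tac..].
  by apply: eq_sw => b y; apply: eq_sw => c z; rewrite mulrA.
(* The additional factor is removed by multiplying with the antipode of one more coaction leg. *)
transitivity (\sw_(a, u <- dE x) \sw_(s, v <- dE u) Fr (antipode a * s) v).
  transitivity (Fr 1 x).
    apply: eq_bigr => j _; apply: eq_sw => b y; apply: eq_sw => c z.
    by rewrite mul1r.
  rewrite (@coassocE _ _ _ Delta dE _ (fun a s v => Fr (antipode a * s) v));
    [|exact: rh_coassoc hE|rewrite /Fr; lin_tac..].
  rewrite -(counitE (rh_counital hE) (f := fun v => Fr 1 v)); last first.
    by rewrite /Fr; lin_tac.
  apply: eq_sw => c v.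
  rewrite -(lin_sw (fun a s => antipode a * s) _ (f := fun s => Fr s v));
    last first.
    by rewrite /Fr; lin_tac.
  by rewrite antipodel (linZ (f := fun s => Fr s v))//; rewrite /Fr; lin_tac.
rewrite -[RHS](counitE (rh_counital hE) (f := fun v => (1 : A) ⊗ v));
  last by lin_tac.
transitivity (\sw_(a, u <- dE x) \sw_(s, v <- dE u) (antipode a * s) ⊗ v).
  apply: eq_sw => a u; rewrite [in RHS]dEF.
  rewrite (lin_sw _ _ (f := fun T => \sw_(s, v <- T) (antipode a * s) ⊗ v));
    last by lin_tac.
  apply: eq_sw => s v; rewrite /Fr (lin_sumE _ _ (f := fun T => \sw_(s, v <- T)
    (antipode a * s) ⊗ v)); last by lin_tac.
  apply: eq_bigr => j _; rewrite (lin_sw _ _ (f := fun T => \sw_(s, v <- T)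
    (antipode a * s) ⊗ v)); last by lin_tac.
  apply: eq_sw => b y; rewrite sw_sw; [|lin_tac..].
  by apply: eq_sw => c z; rewrite !mulrA.
rewrite (@coassocE _ _ _ Delta dE _ (fun a s v => (antipode a * s) ⊗ v));
    [|exact: rh_coassoc hE|lin_tac..].
apply: eq_sw => c v.
rewrite -(lin_sw (fun a s => antipode a * s) _ (f := fun s => s ⊗ v));
  last by lin_tac.
by rewrite antipodel (linZ (f := fun s => s ⊗ v))//; lin_tac.
Qed.

(** A frame between the two connections turns the form into a sum of products h(nabla x, f_j) h(e_j,
    nabla g) of covariant forms. The coaction legs of f_j and e_j then stand next to each other and
    cancel by [frame_coinvariant]. *)
Lemma covariant2_mixed : covariant2 (mixed_form h nabla).
Proof.
have [m [e [f hef]]] := hermitian_frame hh.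
have star_lact := conn_form_star_lactl hh nabla.
have lst w g : linear (fun z => w * conn_form_star h nabla z g).
  move=> c z z'; rewrite /conn_form_star (mform_linr 1) (pair_lin hh).
  by rewrite mulrDr scalerAr.
have mixE t g : pair t (nabla g) =
    \sum_j pair t (mform 1 (f j)) * conn_form_star h nabla (e j) g.
  elim/(@mforms_ind _ X E): t => [w x|t u ht hu]; last first.
    by rewrite pairDl ht hu -big_split; apply: eq_bigr => j _;
      rewrite pairDl mulrDl.
  rewrite (pair_mforml hh) -/(conn_form_star h nabla x g) {1}[x]hef.
  rewrite (lin_sumE _ _ (lst w g)); apply: eq_bigr => j _.
  by rewrite (pair_mform1 hh) star_lact mulrA.
move=> x g; rewrite /mixed_form mixE (lin_sumE _ _ olin).
transitivity (\sum_j \sw_(a, x <- dE x) \sw_(b, y <- dE (f j))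
  \sw_(c, z <- dE (e j)) \sw_(d, g <- dE g)
  ((a * star b) * (c * star d)) ⊗
  (conn_form h nabla x y * conn_form_star h nabla z g)).
  apply: eq_bigr => j _; rewrite -[LHS]sw_id (sw_cov_mul cov); [|lin_tac..].
  rewrite covariant2_conn (lin_sw _ _ (f := fun T => \sw_(a, x <- T)
    \sw_(b, y <- delta (conn_form_star h nabla (e j) g)) (a * b) ⊗
      ((x : Om) * y)));
    last by lin_tac.
  apply: eq_sw => a x'; rewrite (lin_sw _ _ (f := fun T => \sw_(a, x <- T)
    \sw_(b, y <- delta (conn_form_star h nabla (e j) g)) (a * b) ⊗
      ((x : Om) * y)));
    last by lin_tac.
  apply: eq_sw => b y; rewrite sw_pure; [|lin_tac..].
  rewrite covariant2_conn_star (lin_sw _ _ (f := fun T => \sw_(b0, y0 <- T)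
    ((a * star b) * b0) ⊗ (conn_form h nabla x' y * y0))); last by lin_tac.
  apply: eq_sw => c z; rewrite sw_sw//; lin_tac.
rewrite swE exchange_big /=; apply: eq_bigr => p _.
transitivity (\sw_(d, g' <- dE g) \sum_j \sw_(b, y <- dE (f j))
  \sw_(c, z <- dE (e j)) ((p.1 * star b) * (c * star d)) ⊗
  (conn_form h nabla p.2 y * conn_form_star h nabla z g')).
  rewrite swE [RHS]exchange_big /=; apply: eq_bigr => j _.
  rewrite -[RHS]/(\sw_(d, g' <- dE g) \sw_(b, y <- dE (f j))
  \sw_(c, z <- dE (e j)) ((p.1 * star b) * (c * star d)) ⊗
  (conn_form h nabla p.2 y * conn_form_star h nabla z g')).
  rewrite [RHS]sw_exchange; apply: eq_sw => b y.
  by rewrite sw_exchange.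
apply: eq_sw => d g'; rewrite /conn_form.
elim/(@mforms_ind _ X E): (nabla p.2) => [w k|t u ht hu]; last first.
  rewrite pairDl vpureDr -ht -hu -big_split; apply: eq_bigr => j _ /=.
  rewrite !swE -big_split; apply: eq_bigr => b _ /=.
  rewrite !swE -big_split; apply: eq_bigr => c _ /=.
  by rewrite pairDl mulrDl vpureDr.
(* On a pure tensor w ⊗ k the claim is the image under this map of [frame_coinvariant] at [k]. *)
pose Psi (T : (A ⊗ E)%type) : (A ⊗ Om)%type := \sw_(s, z <- T)
  (p.1 * s * star d) ⊗ (w * conn_form_star h nabla z g').
have lPsi : linear Psi by rewrite /Psi; lin_tac.
have := congr1 Psi (frame_coinvariant hef k).
rewrite (lin_sumE _ _ lPsi) {2}/Psi sw_pure; [|lin_tac..].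
rewrite mulr1 (pair_mforml hh) => <-; apply: eq_bigr => j _.
rewrite (lin_sw _ _ lPsi); apply: eq_sw => b y.
rewrite /Psi sw_sw; [|lin_tac..]; apply: eq_sw => c z.
by rewrite (pair_mform1 hh) star_lact !mulrA.
Qed.

Lemma covariant2_curv : covariant2 (curv_form h nabla).
Proof.
have -> : curv_form h nabla =
    (fun e g => dif (conn_form h nabla e g) + mixed_form h nabla e g).
  apply: funext => e; apply: funext => g; exact: (curv_formE hh chern).
by apply: covariant2D; [exact/covariant2_dif/covariant2_conn|exact:
  covariant2_mixed].
Qed.

End CovariantForms.

(** * Curvature of line modules *)

(** Uniqueness of the counit: sending [a] to the conjugate of [eps (star a)] gives another left
    counit, which must agree with the right counit [eps]. *)
Lemma eps_star (C : numClosedFieldType) (A : hopf_star_alg C) (a : A) :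
  eps (star a) = (eps a)^*.
Proof.
have sb : balanced (M := vs A) (N := vs A) (fun u v : A => star u ⊗ star v).
  by apply: balanced_semilin; apply: star_semilin.
have e1 : \sw_(p, q <- Delta a) (eps (star p))^* *: q = a.
  rewrite -[RHS]starK -[star a in RHS](Delta_counitl (star a)) Delta_star /tmap.
  rewrite sw_sw; [|lin_tac..].
  rewrite (add_sw _ _ (semilinD (@star_semilin _ A))); apply: eq_sw => p q.
  by rewrite (semilinZ (@star_semilin _ A)) starK.
have e2 := @Delta_counitr C A a.
rewrite -[in RHS]e1 -[in LHS]e2.
rewrite (add_sw _ _ (semilinD (@star_semilin _ A))).
rewrite !(lin_sw _ _ (f := eps : A -> C^o)) ?swE; [|exact: eps_lin..].
rewrite rmorph_sum; apply: eq_bigr => p _ /=.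
rewrite (semilinZ (@star_semilin _ A)) !linearZ /=.
by rewrite rmorphM /= conjCK mulrC.
Qed.

Section Line.
Context {C : numClosedFieldType} (X : cqh_hermitian C).
Local Notation K := (cqh_qhs X).
Local Notation A := (qhsA K).
Local Notation B := (base K).
Local Notation Om := (cqh_om X).
Local Notation emb := (emb Om).
Local Notation cs := (cqh_cs X).
Local Notation bideg := (bideg cs).
Local Notation delta := (@cqh_coact C X).
Let cov := cqh_cov X.
Let ccs := @cqh_cov_cs C X.
Let hO : rel_hopf (F := cal_mod Om) delta := @cqh_mod0 C X.
Local Notation unf := (unfiber (F := cal_mod Om) delta).

Lemma bideg_unfiber a b (x : A) (w : Om) : bideg a b (unf x w : Om) = unf x
  (bideg a b w).
Proof.
have la := @base_avg_lin C K.
rewrite /unfiber (cov_bideg cov ccs) /tmap sw_sw; [|lin_tac..].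
rewrite (lin_sw _ _ (f := fun z : Om => bideg a b z)); last by lin_tac.
by apply: eq_sw => u v; rewrite /= /cal_lact bideg_embl.
Qed.

Context (E : bimodule B) (dE : E -> (A ⊗ E)%type) (h : conj_mod E -> dual E).
Context (hE : rel_hopf dE) (hh : hermitian_module h).
Context (dE' : dual E -> (A ⊗ dual E)%type).
Hypotheses (hdual : dual_coaction dE dE')
  (hmor : rel_hopf_mor (conj_coact dE) dE' h).
Local Notation hp f g := (h (cj g) f : B).

(** [lam] is merely a choice of coordinates, and no linearity is claimed. If [v] were 0, every
    scalar would be a coordinate of 0, against uniqueness. *)
Lemma dim_Phi1 : dim_Phi E 1 -> exists (v : E) (lam : E -> C), v != 0 /\
  forall f, augm_lspan (fun=> True) (f - lam f *: v).
Proof.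
case=> v hv; have /choice[lam hlam] : forall f, exists l : C,
    augm_lspan (fun=> True) (f - l *: v ord0).
  by move=> f; have [c [hc _]] := hv f; exists (c ord0 ord0);
    rewrite big_ord1 in hc.
exists (v ord0), lam; split=> //; apply/eqP => v0.
have [c [_ hc]] := hv 0.
have h0 (d : 'rV[C]_1) : augm_lspan (fun=> True) (0 - \sum_i d ord0 i *: v i).
  rewrite big_ord1 v0 scaler0 subr0; exists [::] => //.
  by rewrite big_nil.
have : (const_mx 1 : 'rV[C]_1) = 0 by rewrite -(hc _ (h0 (const_mx 1)))
  -(hc _ (h0 0)).
move/(congr1 (fun M : 'rV[C]_1 => M ord0 ord0)); rewrite !mxE => /eqP.
by rewrite oner_eq0.
Qed.

(** Such a map factors through the one-dimensional fibre in both variables. It is applied to the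
    curvature form and to the metric, which thus get the same coefficients. *)
Lemma fiber_sesquilinear (V : lmodType C) (Psi : E -> E -> V) (v : E)
  (lam : E -> C) :
  (forall f, augm_lspan (fun=> True) (f - lam f *: v)) ->
  (forall e e' g, Psi (e + e') g = Psi e g + Psi e' g) ->
  (forall e g g', Psi e (g + g') = Psi e g + Psi e g') ->
  (forall b e g, Psi (lact b e) g = eps (base_val b) *: Psi e g) ->
  (forall b e g, Psi e (lact b g) = (eps (base_val b))^* *: Psi e g) ->
  forall e g, Psi e g = (lam e * (lam g)^*) *: Psi v v.
Proof.
move=> hl Dl Dr Ll Lr e g.
have epsC (c : C) : eps (base_val (c *: 1 : B)) = c.
  by rewrite (linZ (@base_val_lin _ K)) linearZ /= eps1 [_ * _]mulr1.
have Pl x g' : augm_lspan (fun=> True) x -> Psi x g' = 0.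
  move=> [s hs ->]; rewrite (add_sumE _ _ (fun x y => Dl x y g')).
  by rewrite big_seq big1// => z /hs[z1 _]; rewrite Ll z1 scale0r.
have Pr x e' : augm_lspan (fun=> True) x -> Psi e' x = 0.
  move=> [s hs ->]; rewrite (add_sumE _ _ (Dr e')).
  by rewrite big_seq big1// => z /hs[z1 _]; rewrite Lr z1 conjC0 scale0r.
rewrite -(subrK (lam e *: v) e) Dl Pl// add0r.
rewrite -[v in lam e *: v]lact1 -lact_scalel Ll epsC.
rewrite -(subrK (lam g *: v) g) Dr Pr// add0r.
rewrite -[v in lam g *: v]lact1 -lact_scalel Lr epsC.
by rewrite subrK scalerA subrK.
Qed.

Context (dbF nabla : E -> mforms E).
Hypotheses (hol : holomorphic dbF) (chern : chern_connection h dbF nabla).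
Hypothesis dbF_coact : forall f,
  mforms_coact dE (dbF f) = tmap idfun dbF (dE f).
Local Notation S := (curv_form h nabla).

Lemma line_curv_form : dim_Phi E 1 -> exists rho : Om,
  [/\ coinvariant (F := cal_mod Om) delta rho, bihom cs 1 1 rho &
      forall e g, S e g = emb (hp e g) * rho].
Proof.
move=> /dim_Phi1[v [lam [v0 hlam]]].
have ul := unfiber_linl (F := cal_mod Om) delta; have ur := unfiber_linr hO.
have SE a e g : unf a (S e g) = (lam e * (lam g)^*) *: unf a (S v v).
  apply: (fiber_sesquilinear (Psi := fun e g => unf a (S e g)) hlam).
  - by move=> x y z; rewrite (curv_formDl chern) (linD (ur a)).
  - by move=> x y z; rewrite (curv_formDr hh) (linD (ur a)).
  - by move=> b x y; rewrite (curv_form_lactl hh chern) (unfiber_lact hO).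
  - move=> b x y; rewrite (curv_form_lactr hh).
    by rewrite (unfiber_ract hO) /= eps_star.
have HE e g : eps (base_val (hp e g)) = lam e * (lam g)^* * eps
  (base_val (hp v v)).
  have lv := @base_val_lin C K.
  apply: (fiber_sesquilinear (V := C^o)
    (Psi := fun e g => eps (base_val (hp e g))) hlam).
  - by move=> x y z; rewrite hpDl (linD lv) linearD.
  - by move=> x y z; rewrite (hpDr hh) (linD lv) linearD.
  - by move=> b x y; rewrite hp_lactl /= epsM.
  - by move=> b x y; rewrite (hp_lactr hh) /= epsM eps_star mulrC.
set c0 := eps (base_val (hp v v)) in HE.
(* The metric rebuilt from its values on the fibre, by the counit axiom and covariance. *)
have valE e g : base_val (hp e g) = c0 *:
   \sw_(a, x <- dE e) \sw_(b, y <- dE g) (lam x * (lam y)^*) *: (a * star b).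
  rewrite -[LHS](counitrE (f := fun p => p)); last by lin_tac.
  rewrite -(@sw_base_coact _ _ _ (fun p q => eps q *: p)); [|lin_tac..].
  have lv := @base_val_lin C K.
  rewrite (herm_coact hdual hmor) (lin_sw _ _ (f := fun T =>
    \sw_(p, q <- T) eps (base_val (q : B)) *: p)); last by lin_tac.
  rewrite [RHS](lin_sw _ _ (f := fun z : A => c0 *: z)); last by lin_tac.
  apply: eq_sw => a x; rewrite sw_sw; [|lin_tac..].
  rewrite (lin_sw _ _ (f := fun z : A => c0 *: z)); last by lin_tac.
  by apply: eq_sw => b y; rewrite HE scalerA mulrC.
have c0N0 : c0 != 0.
  apply/eqP => e0; have [_ /eqP] := hermm_pos hh v0; apply.
  by apply: val_inj; rewrite /= valE e0 scale0r.
(* The curvature form rebuilt in the same way by [unfiber_coact]; its coefficients are those of the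
   metric up to [c0]. *)
have S0 e g : c0 *: S e g = unf (base_val (hp e g)) (S v v).
  rewrite valE (linZ (ul _)); congr (_ *: _).
  rewrite -[LHS](unfiber_coact hO).
  rewrite (covariant2_curv hE hh hdual hmor chern dbF_coact).
  rewrite (lin_sw _ _ (f := fun T => \sw_(a, x <- T) unf a x)); last by lin_tac.
  rewrite (lin_sw _ _ (f := fun z => unf z (S v v))); last by lin_tac.
  apply: eq_sw => a x; rewrite sw_sw; [|lin_tac..].
  rewrite (lin_sw _ _ (f := fun z => unf z (S v v))); last by lin_tac.
  by apply: eq_sw => b y; rewrite SE (linZ (ul _)).
(* Left B-linearity of [unf] in its first argument takes h(e, g) out of [S0]; what remains is the
   coinvariant projection of S(v, v), normalised by the metric at [v]. *)
exists (unf 1 (c0^-1 *: S v v)); split.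
- exact: coact_unfiber1.
- by rewrite /bihom bideg_unfiber linearZ /= (curv_form_bihom hh hol chern).
- move=> e g; rewrite -[_ * _]/(lact (F := cal_mod Om) (hp e g) (unf 1 _)).
  rewrite -(unfiber_base (F := cal_mod Om) delta) mulr1 (linZ (ur _)) -S0
    scalerA mulVf//.
  by rewrite scale1r.
Qed.

End Line.

(** * Contraction of forms *)

Section TopForms.
Context {C : numClosedFieldType} (X : cqh_hermitian C).
Local Notation K := (cqh_qhs X).
Local Notation A := (qhsA K).
Local Notation B := (base K).
Local Notation Om := (cqh_om X).
Local Notation emb := (emb Om).
Local Notation deg := (deg Om).
Local Notation cs := (cqh_cs X).
Local Notation bideg := (bideg cs).
Local Notation cstar := (@cstar C B Om).
Local Notation delta := (@cqh_coact C X).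
Local Notation n := (cqh_n X).
Local Notation sigma := (cqh_sigma X).
Local Notation hs := (@cqh_hodge C X).
Let cov := cqh_cov X.
Let ccs := @cqh_cov_cs C X.
Let dlin : linear delta := cov_linear cov.
Let hslin : linear hs. Proof. by case: (cqh_hodgeP X). Qed.
Let elin : linear emb. Proof. exact: linearP. Qed.
Let n_gt0 : (0 < n)%N := cqh_n_gt0 X.

Lemma iter_lefschetz k (w : Om) : iter k (lefschetz sigma) w = sigma ^+ k * w.
Proof.
elim: k => [|k IHk]; first by rewrite expr0 mul1r.
by rewrite iterS IHk /lefschetz exprS mulrA.
Qed.

Lemma sigma_bihom k : bihom cs k k (sigma ^+ k).
Proof.
elim: k => [|k IHk]; first by rewrite expr0 -(rmorph1 emb); exact: bihom_emb.
have hs1 : bihom cs 1 1 sigma := sigma_bideg (cqh_herm X).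
by rewrite exprS; have := bihomM hs1 IHk; rewrite !add1n.
Qed.

Lemma bihom_big a b (w : Om) : (n.*2 < a + b)%N -> bihom cs a b w -> w = 0.
Proof. by move=> hab hw; rewrite -(bihom_deg hw (erefl _)) (cqh_total X).2. Qed.

Lemma top_form (v : Om) : deg n.*2 v = v -> exists b, v = sigma ^+ n * emb b.
Proof.
move=> hv; rewrite -[X in deg X _]subn0 in hv.
have [w hw <-] := lefschetz_surj (cqh_herm X) n_gt0 hv; have [b ->]
  := (deg0P w).1 hw.
by exists b; rewrite iter_lefschetz subn0.
Qed.

Lemma sigma_top_neq0 b : sigma ^+ n * emb b = 0 -> b = 0.
Proof.
move=> hb; apply: (emb_inj (c := Om)); rewrite rmorph0.
apply: (lefschetz_inj (cqh_herm X) n_gt0 (deg_emb b)).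
by rewrite iter_lefschetz subn0.
Qed.

(** The defining formula at j = n and bidegree (0,0); primitivity of [emb b] holds because
    sigma^(n+1) has degree 2n+2. *)
Lemma hodge_top b : hs (sigma ^+ n * emb b) = n`!%:R *: emb b.
Proof.
have [_ _ hP] := cqh_hodgeP X.
have hp : primitive cs n sigma 0 0 (emb b).
  rewrite /primitive /=; split; first exact: bihom_emb.
  rewrite -iterS iter_lefschetz addn0 subn0.
  apply: (bihom_big _ (bihomM (sigma_bihom n.+1) (bihom_emb cs b))).
  by rewrite !addn0 -addnn addnS ltnS addSn leqnSn.
have := hP 0%N 0%N _ n hp; rewrite !addn0 leqnn => /(_ isT).
rewrite iter_lefschetz subnn subn0 mul0n /= expr0 mul1r subrr expr0z mul1r.
by rewrite fact0 divr1.
Qed.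

Lemma top_form_offdiag a b (w : Om) : (a + b = n.*2)%N -> a != n ->
  bihom cs a b w -> w = 0.
Proof.
move=> hab an hw; have [c wE] := top_form (bihom_deg hw (esym hab)).
have := bihomM (sigma_bihom n) (bihom_emb cs c); rewrite -wE !addn0 => hw'.
by rewrite -hw (bideg_bihom _ _ hw') (negbTE an).
Qed.

(** All (0,1)-forms are primitive, since sigma^n w has degree 2n+1. What matters about the constant
    is that it does not depend on [w]. *)
Lemma hodge01 : exists c, forall w : Om,
  bihom cs 0 1 w -> hs w = c *: (sigma ^+ n.-1 * w).
Proof.
have [_ _ hP] := cqh_hodgeP X; eexists => w hw.
have hp : primitive cs n sigma 0 1 w.
  rewrite /primitive /= add0n n_gt0; split => //.
  rewrite -iterS iter_lefschetz subn1 prednK//.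
  apply: (bihom_big _ (bihomM (sigma_bihom n) hw)).
  by rewrite addn0 addnA addnn addn1.
have /= := hP 0%N 1%N w 0%N hp n_gt0.
by rewrite iter_lefschetz subn0 add0n subn1 => ->.
Qed.

Lemma cov_sigma k : delta (sigma ^+ k) = 1 ⊗ sigma ^+ k.
Proof.
elim: k => [|k IHk].
  by rewrite !expr0 -(rmorph1 emb) cov_emb// base_coact1 tmap_pure.
rewrite exprS -[LHS]sw_id (sw_cov_mul cov); [|lin_tac..].
rewrite IHk cqh_cov_sigma sw_pure; [|lin_tac..].
by rewrite sw_pure ?mulr1//; lin_tac.
Qed.

(** In top degree colinearity of the Hodge map reduces to coinvariance of [sigma], because every top
    form is sigma^n times an element of B. *)
Lemma cov_hodge_top (v : Om) : deg n.*2 v = v -> delta (hs v) = tmap idfun hs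
  (delta v).
Proof.
move=> /top_form[b ->]; rewrite hodge_top (linZ dlin) -[delta (emb b)]sw_id.
rewrite (sw_delta_emb cov); [|lin_tac..].
have lid : linear (@idfun A) by [].
rewrite -[delta (_ * _)]sw_id (sw_cov_mul cov); [|lin_tac..].
rewrite cov_sigma sw_pure; [|lin_tac..].
rewrite (sw_delta_emb cov); [|lin_tac..].
rewrite (lin_sw _ _ (lin_tmap lid hslin)) swE scaler_sumr swE.
by apply: eq_bigr => p _; rewrite mul1r tmap_pure// hodge_top -vpureZr.
Qed.

(** * The contraction pairing of (1,0)-forms with (0,1)-forms *)

Section Contraction.
Context (hM : conj_mod (cal_mod Om) -> dual (cal_mod Om))
  (hhM : hermitian_module hM).
Hypothesis hMP : forall v w : Om,
  emb (hM (cj (F := cal_mod Om) w) v) = metric n hs v w.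

(** The star undoes the conjugate-linearity of the metric, so the pairing is bilinear. *)
Definition contract (w b : Om) : B :=
  hM (cj (F := cal_mod Om) (cstar (bideg 0 1 b))) w.

Lemma emb_contract_hodge w b : emb (contract w b) = hs
  (deg 1 w * hs (bideg 0 1 b)).
Proof.
rewrite /contract hMP /metric.
have hb : bihom cs 1 0 (cstar (bideg 0 1 b)) by exact/bihom_star/bihom_bideg.
have h1 : (1 < n.*2.+1)%N by rewrite ltnS -muln2 muln_gt0 n_gt0.
rewrite (bigD1 (Ordinal h1))//= big1 => [|i].
  by rewrite addr0 (deg_bihom _ hb) cstarK.
rewrite -val_eqE /= => /negbTE i1.
by rewrite (deg_bihom _ hb) i1 cstar0 (lin0 hslin) mulr0 (lin0 hslin).
Qed.

(** Writes the pairing as the Hodge map of a top form, where linearity and covariance are available.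
    The (0,1)-part of [w] would contribute bidegree (n-1, n+1), which is zero. *)
Lemma contractE : exists c, forall w b,
  emb (contract w b) = hs (bideg 1 0 w * (c *: (sigma ^+ n.-1 * bideg 0 1 b))).
Proof.
have [c hc] := hodge01; exists c => w b.
rewrite emb_contract_hodge (hc _ (bihom_bideg _ _ _ _)).
have -> : deg 1 w = bideg 1 0 w + bideg 0 1 w.
  by rewrite (deg_bideg cs) !big_ord_recr big_ord0 /= add0r addrC.
rewrite mulrDl (linD hslin) [X in _ + hs X](_ : _ = 0).
  by rewrite (lin0 hslin) addr0.
rewrite -scalerAr; apply: (top_form_offdiag (a := n.-1) (b := n.+1)).
- by rewrite -addSnnS prednK// addnn.
- by rewrite neq_ltn prednK// leqnn.
- apply: bihomZ; have := bihomM (bihom_bideg cs 0 1 w)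
    (bihomM (sigma_bihom n.-1) (bihom_bideg cs 0 1 b)).
  by rewrite add0n addn0 addnA add1n addn1 prednK.
Qed.

Lemma contract_linl b : linear (contract^~ b).
Proof. by rewrite /contract => c v w; rewrite dualD dual_scale. Qed.

Lemma contract_linr w : linear (contract w).
Proof.
have [c hc] := contractE => k v v'; apply: (emb_inj (c := Om)).
have -> : emb (k *: contract w v + contract w v') =
  k *: emb (contract w v) + emb (contract w v') by rewrite linearP.
rewrite !hc; move: k v v'.
rewrite -/(linear (fun b => hs
  (bideg 1 0 w * (c *: (sigma ^+ n.-1 * bideg 0 1 b))))).
lin_tac.
Qed.

Lemma contract_embl b w v : contract (emb b * w) v = b * contract w v.
Proof. exact: (dual_lact (hM _) b w). Qed.

Lemma contract_embr b w v : contract w (v * emb b) = contract w v * b.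
Proof.
rewrite /contract bideg_embr (cstar_embr cs).
have := hp_lactr hhM (star b) w (cstar (bideg 0 1 v)).
by rewrite starK.
Qed.

(** Holds because the Hodge map is left B-linear; right B-linearity of [form_endo] rests on it. *)
Lemma contract_bal b w v : contract (w * emb b) v = contract w (emb b * v).
Proof.
have [_ hmul _] := cqh_hodgeP X.
apply: (emb_inj (c := Om));
  rewrite !emb_contract_hodge (deg_embr cs) bideg_embl.
have := hmul b (bideg 0 1 v) 1; rewrite rmorph1 !mulr1 => ->.
by rewrite mulrA.
Qed.

Lemma contract10 w v : contract (bideg 1 0 w) v = contract w v.
Proof.
have [c hc] := contractE; apply: (emb_inj (c := Om)); rewrite !hc.
by rewrite bideg_bideg.
Qed.

Lemma contract_coact w v : delta (emb (contract w v)) =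
  \sw_(a, x <- delta w) \sw_(b, y <- delta v) (a * b) ⊗ emb (contract x y).
Proof.
have [c hc] := contractE.
have lid : linear (@idfun A) by [].
pose f x y := hs (bideg 1 0 x * (c *: (sigma ^+ n.-1 * bideg 0 1 y))).
have fl y : linear (f^~ y) by rewrite /f; lin_tac.
have fr x : linear (f x) by rewrite /f; lin_tac.
have lT := lin_tmap lid hslin.
rewrite hc cov_hodge_top; last first.
  apply: (bihom_deg (cs := cs) (a := n) (b := n)); last by rewrite addnn.
  rewrite -scalerAr; apply: bihomZ; have := bihomM (bihom_bideg cs 1 0 w)
    (bihomM (sigma_bihom n.-1) (bihom_bideg cs 0 1 v)).
  by rewrite add0n addn0 add1n addn1 prednK.
have -> : delta (bideg 1 0 w * (c *: (sigma ^+ n.-1 * bideg 0 1 v))) =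
    \sw_(a, x <- delta w) \sw_(b, y <- delta v)
    (a * b) ⊗ (bideg 1 0 x * (c *: (sigma ^+ n.-1 * bideg 0 1 y))).
  rewrite -[LHS]sw_id (sw_cov_mul cov); [|lin_tac..].
  rewrite (cov_bideg cov ccs) /tmap sw_sw; [|lin_tac..].
  apply: eq_sw => a x; rewrite scalerAl [delta (_ * _)](_ : _ =
      \sw_(b, y <- delta v) b ⊗ (c *: sigma ^+ n.-1 * bideg 0 1 y)).
    rewrite sw_sw; [|lin_tac..].
    by apply: eq_sw => b y; rewrite -scalerAl.
  rewrite -[LHS]sw_id (sw_cov_mul cov); [|lin_tac..].
  rewrite (linZ dlin) cov_sigma -vpureZr sw_pure; [|lin_tac..].
  rewrite (cov_bideg cov ccs) /tmap sw_sw; [|lin_tac..].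
  by apply: eq_sw => b y; rewrite mul1r.
rewrite (lin_sw _ _ lT); apply: eq_sw => a x.
rewrite (lin_sw _ _ lT); apply: eq_sw => b y.
by rewrite tmap_pure// hc.
Qed.

End Contraction.
End TopForms.

(** * Coinvariant (1,1)-forms *)

Section TensorSpan.
Context {C : numClosedFieldType} {B : algType C} (M N : bimodule B).
Context (P : M -> Prop) (Q : N -> Prop).

Lemma tspan_pure m n : P m -> Q n -> tspan P Q (pure m n).
Proof.
move=> hm hn; exists [:: (m, n)]; last by rewrite big_seq1.
by move=> x; rewrite inE => /eqP ->.
Qed.

Lemma tspan0 : tspan P Q 0.
Proof. by exists [::]; rewrite ?big_nil. Qed.

Lemma tspanD t u : tspan P Q t -> tspan P Q u -> tspan P Q (t + u).
Proof.
move=> [s hs ->] [s' hs' ->]; exists (s ++ s'); last by rewrite big_cat.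
by move=> x; rewrite mem_cat => /orP[/hs|/hs'].
Qed.

Lemma tspan_sum (I : Type) (r : seq I) (t : I -> tensor M N) :
  (forall i, tspan P Q (t i)) -> tspan P Q (\sum_(i <- r) t i).
Proof.
by move=> ht; apply: (big_ind (tspan P Q)) => //; [exact: tspan0|exact: tspanD].
Qed.

End TensorSpan.

(** * Haar averages and the endomorphism attached to a coinvariant form *)

Section CoinvariantForms.
Context {C : numClosedFieldType} (X : cqh_hermitian C).
Local Notation K := (cqh_qhs X).
Local Notation A := (qhsA K).
Local Notation B := (base K).
Local Notation Om := (cqh_om X).
Local Notation emb := (emb Om).
Local Notation deg := (deg Om).
Local Notation cs := (cqh_cs X).
Local Notation bideg := (bideg cs).
Local Notation cstar := (@cstar C B Om).
Local Notation delta := (@cqh_coact C X).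
Local Notation n := (cqh_n X).
Local Notation hs := (@cqh_hodge C X).
Let cov := cqh_cov X.
Let ccs := @cqh_cov_cs C X.
Let hO : rel_hopf (F := cal_mod Om) delta := @cqh_mod0 C X.
Let dlin : linear delta := cov_linear cov.
Let blin i j : linear (bideg i j). Proof. exact: linearP. Qed.

Context (hM : conj_mod (cal_mod Om) -> dual (cal_mod Om))
  (hhM : hermitian_module hM).
Hypothesis hMP : forall v w : Om,
  emb (hM (cj (F := cal_mod Om) w) v) = metric n hs v w.
Local Notation ctr := (contract hM).
Let cl b : linear (ctr^~ b) := contract_linl hM b.
Let cr w : linear (ctr w) := contract_linr hMP w.

(* Multiplication of forms is injective only on [Om^(0,1) ⊗_B Om^(1,0)], which
   the terms of a Haar average need not respect one by one; hence the explicit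
   bidegree projections. *)
Definition haar_sum (V : lmodType C) (s : seq (Om * Om)) (f : Om -> Om -> V) :
  V :=
  \sum_(z <- s) \sw_(b, y <- delta z.1) \sw_(c, x <- delta z.2)
    haar (b * c) *: f (bideg 0 1 y) (bideg 1 0 x).

Lemma haar_sum_map (V W : lmodType C) s (f : Om -> Om -> V) (g : V -> W) :
  linear g -> g (haar_sum s f) = haar_sum s (fun y x => g (f y x)).
Proof.
move=> lg; rewrite /haar_sum (lin_sumE _ _ lg); apply: eq_bigr => z _.
rewrite (lin_sw _ _ lg); apply: eq_sw => b y.
by rewrite (lin_sw _ _ lg); apply: eq_sw => c x; rewrite (linZ lg).
Qed.

Lemma eq_haar_sum (V : lmodType C) s (f g : Om -> Om -> V) :
  (forall y x, f (bideg 0 1 y) (bideg 1 0 x) = g (bideg 0 1 y) (bideg 1 0 x)) ->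
  haar_sum s f = haar_sum s g.
Proof.
move=> fg; apply: eq_bigr => z _; apply: eq_sw => b y; apply: eq_sw => c x.
by rewrite fg.
Qed.

Variables (s : seq (Om * Om)).
Hypothesis hs01 : forall z, z \in s -> bihom cs 0 1 z.1 /\ bihom cs 1 0 z.2.

(** The coaction preserves bidegrees, so for bilinear [f] the projections may be dropped. *)
Lemma haar_sumE (V : lmodType C) (f : Om -> Om -> V) :
  (forall x, linear (f^~ x)) -> (forall y, linear (f y)) ->
  haar_sum s f = \sum_(z <- s) \sw_(b, y <- delta z.1) \sw_(c, x <- delta z.2)
    haar (b * c) *: f y x.
Proof.
move=> fl fr; rewrite /haar_sum big_seq [RHS]big_seq;
  apply: eq_bigr => z /hs01[z1 z2].
rewrite -[in RHS](z1 : bideg 0 1 z.1 = z.1) -[in RHS](z2 : bideg 1 0 z.2 = z.2).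
rewrite !(cov_bideg cov ccs) /tmap sw_sw; [|lin_tac..].
by apply: eq_sw => b y; rewrite sw_sw//; lin_tac.
Qed.

(** Coinvariance of the averaged tensor, from haar(t_(1)) t_(2) = haar(t) 1 at a product [k * l] of
    coaction legs. The factor [a] carries the leg of a further form, such as the argument of
    [form_endo]. *)
Lemma haar_sum_coact (V : lmodType C) (f : Om -> Om -> V) a d :
  (forall x, linear (f^~ x)) -> (forall y, linear (f y)) ->
  haar_sum s (fun y x => \sw_(q, y' <- delta y) \sw_(r, x' <- delta x)
     (a * (q * r) * d) ⊗ f y' x') = (a * d) ⊗ haar_sum s f.
Proof.
move=> fl fr; rewrite haar_sumE; [|lin_tac..]; rewrite haar_sumE//.
rewrite (lin_sumE _ _ (f := fun v : V => (a * d) ⊗ v)); last by lin_tac.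
apply: eq_bigr => z _.
transitivity (\sw_(b, y <- delta z.1) \sw_(q, y' <- delta y)
    \sw_(c, x <- delta z.2) \sw_(r, x' <- delta x)
    haar (b * c) *: ((a * (q * r) * d) ⊗ f y' x')).
  apply: eq_sw => b y; rewrite [RHS]sw_exchange; apply: eq_sw => c x.
  rewrite swE scaler_sumr; apply: eq_bigr => p _ /=.
  by rewrite swE scaler_sumr.
rewrite (@coassocE _ _ _ Delta delta _ (fun b q y' => \sw_(c, x <- delta z.2)
  \sw_(r, x' <- delta x) haar (b * c) *: ((a * (q * r) * d) ⊗ f y' x')));
  [|exact: cov_coassoc cov|lin_tac..].
rewrite (lin_sw _ _ (f := fun v : V => (a * d) ⊗ v)); last by lin_tac.
apply: eq_sw => k y'.
transitivity (\sw_(c, x' <- delta z.2) \sw_(c1, r <- Delta c)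
    \sw_(b, q <- Delta k) haar (b * c1) *: ((a * (q * r) * d) ⊗ f y' x')).
  rewrite -(@coassocE _ _ _ Delta delta _ (fun c r x' => \sw_(b, q <- Delta k)
     haar (b * c) *: ((a * (q * r) * d) ⊗ f y' x')));
    [|exact: cov_coassoc cov|lin_tac..].
  rewrite sw_exchange; apply: eq_sw => c x; exact: sw_exchange.
rewrite (lin_sw _ _ (f := fun v : V => (a * d) ⊗ v)); last by lin_tac.
apply: eq_sw => l x'.
have := haarl (k * l); rewrite sw_DeltaM; [|lin_tac..] => hl.
pose g (t : A) : (A ⊗ V)%type := (a * t * d) ⊗ f y' x'.
have lg : linear g by rewrite /g; lin_tac.
have := congr1 g hl; rewrite (linZ lg) {2}/g mulr1 -vpureZr => <-.
rewrite (lin_sw _ _ lg) sw_exchange; apply: eq_sw => b q.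
by rewrite (lin_sw _ _ lg); apply: eq_sw => c r; rewrite (linZ lg).
Qed.

Lemma haar_sum_mul (rho : Om) : rho = \sum_(z <- s) z.1 * z.2 ->
  delta rho = 1 ⊗ rho -> haar_sum s (fun y x => y * x) = rho.
Proof.
move=> e he; rewrite haar_sumE; [|lin_tac..].
have lh : linear (fun w : Om => \sw_(a, x <- delta w) haar a *: x) by lin_tac.
transitivity (\sw_(a, x <- delta rho) haar a *: x).
  rewrite [in RHS]e (lin_sumE _ _ lh); apply: eq_bigr => z _.
  by rewrite (sw_cov_mul cov) //; lin_tac.
by rewrite he sw_pure ?haar1 ?scale1r//; lin_tac.
Qed.

(** The contraction of [w] with the first leg of the averaged tensor. *)
Definition form_endo (w : Om) : Om := haar_sum s (fun y x => emb (ctr w y) * x).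

Lemma form_endo_lin : linear form_endo.
Proof. by rewrite /form_endo /haar_sum; lin_tac. Qed.

Lemma form_endo_bihom w : bihom cs 1 0 (form_endo w).
Proof.
rewrite /bihom /form_endo (haar_sum_map _ _ (blin 1 0)).
by apply: eq_haar_sum => y x; rewrite bideg_embl bideg_bideg.
Qed.

Lemma form_endo_embl b w : form_endo (emb b * w) = emb b * form_endo w.
Proof.
rewrite /form_endo (haar_sum_map _ _ (g := fun v : Om => emb b * v));
  last by lin_tac.
by apply: eq_haar_sum => y x; rewrite contract_embl rmorphM mulrA.
Qed.

Lemma form_endo10 w : form_endo (bideg 1 0 w) = form_endo w.
Proof. by apply: eq_haar_sum => y x; rewrite (contract10 hMP). Qed.

Lemma form_endo_coact w : delta (form_endo w) = tmap idfun form_endo (delta w).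
Proof.
rewrite /form_endo (haar_sum_map _ _ dlin).
transitivity (haar_sum s (fun y x => \sw_(p, v <- delta w)
  \sw_(q, y' <- delta y)
  \sw_(r, x' <- delta x) (p * (q * r) * 1) ⊗ (emb (ctr v y') * x'))).
  apply: eq_haar_sum => y x; rewrite -[LHS]sw_id (sw_cov_mul cov); [|lin_tac..].
  rewrite (contract_coact hMP) (lin_sw _ _ (f := fun T => \sw_(p, v <- T)
    \sw_(r, x' <- delta (bideg 1 0 x)) (p * r) ⊗ (v * x'))); last by lin_tac.
  apply: eq_sw => p v; rewrite sw_sw; [|lin_tac..].
  by apply: eq_sw => q y'; apply: eq_sw => r x'; rewrite mulr1 mulrA.
transitivity (\sw_(p, v <- delta w) haar_sum s
  (fun y x => \sw_(q, y' <- delta y)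
  \sw_(r, x' <- delta x) (p * (q * r) * 1) ⊗ (emb (ctr v y') * x'))).
  rewrite swE /haar_sum exchange_big /=; apply: eq_bigr => z _.
  rewrite [RHS]exchange_big /=; apply: eq_bigr => b _.
  rewrite [RHS]exchange_big /=; apply: eq_bigr => c _.
  by rewrite -scaler_sumr.
apply: eq_sw => p v; rewrite haar_sum_coact ?mulr1//; lin_tac.
Qed.

Variable rho : Om.
Hypotheses (hfact : factorisable X) (srho : rho = \sum_(z <- s) z.1 * z.2).
Hypothesis crho : coinvariant (F := cal_mod Om) delta rho.

(** [D] is the commutator of [b] with the averaged tensor. Its product is b rho - rho b, zero since
    coinvariant forms are central, so factorisability gives D = 0. Contracting [D] with [w] yields
    the claim. *)
Lemma form_endo_embr b w : form_endo (w * emb b) = form_endo w * emb b.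
Proof.
pose M := cal_mod Om.
pose D : tensor M M := haar_sum s (fun y x =>
  pure (emb b * y : M) (x : M) + pure (- y : M) (x * emb b : M)).
have Dspan : tspan (M := M) (N := M) (bihom cs 0 1) (bihom cs 1 0) D.
  rewrite /D /haar_sum; apply: tspan_sum => z; apply: tspan_sum => p.
  apply: tspan_sum => q; rewrite scalerDr !scale_pure; apply: tspanD.
    apply: tspan_pure; last exact: bihom_bideg.
    by apply: bihomZ; rewrite /bihom bideg_embl bideg_bideg.
  apply: tspan_pure; first exact/bihomZ/bihomN/bihom_bideg.
  by rewrite /bihom bideg_embr bideg_bideg.
have fbal : balanced (M := M) (N := M) (fun u v : Om => u * v).
  split=> [u u' v|u v v'|u c v]; [exact: mulrDl|exact: mulrDr|].
  by rewrite /= /cal_ract /cal_lact mulrA.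
have lf (V : lmodType C) (f : M -> M -> V) : balanced f ->
    (forall v, linear (f^~ v)) -> linear (tlift f).
  move=> bf fl c t u; rewrite (tliftD _ _ bf) (tlift_scale _ _ bf).
  rewrite /tlift /formal_eval scaler_sumr; congr (_ + _).
  by apply: eq_bigr => p _; rewrite (linZ (fl _)).
have D0 : D = 0.
  have [_ [hinj _]] := hfact 1 1; apply: hinj => //; rewrite /form_mul /D.
  have lfm := lf _ _ fbal (fun v => lin_mull v (@lin_id _ Om)).
  rewrite (haar_sum_map _ _ lfm).
  transitivity (haar_sum s (fun y x => emb b * (y * x) + - (y * x * emb b))).
    apply: eq_haar_sum => y x.
    by rewrite (tliftD _ _ fbal) !(tlift_pure _ _ fbal) mulNr !mulrA.
  pose g (v : Om) : Om := emb b * v + - (v * emb b).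
  have lg : linear g by rewrite /g; lin_tac.
  rewrite -[LHS](haar_sum_map _ (fun y x => y * x) lg) (haar_sum_mul srho crho)
    /g.
  have := coinvariant_central hO b crho; rewrite /= /cal_ract /cal_lact => ->.
  exact: subrr.
pose psi (u v : Om) : Om := emb (ctr w u) * v.
have psib : balanced (M := M) (N := M) psi.
  split=> [u u' v|u v v'|u c v]; rewrite /psi.
  - by rewrite (linD (cr w)) raddfD mulrDl.
  - exact: mulrDr.
  - by rewrite /= /cal_ract /cal_lact (contract_embr hhM) rmorphM mulrA.
have psil v : linear (psi^~ v) by rewrite /psi; lin_tac.
have := congr1 (@tlift _ _ M M Om psi) D0; rewrite (tlift0 psib) /D.
rewrite (haar_sum_map _ _ (lf _ _ psib psil)) => h0.
apply/eqP; rewrite -subr_eq0; apply/eqP; rewrite -[RHS]h0.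
rewrite /form_endo (haar_sum_map _ _ (g := fun v : Om => v * emb b));
  last by lin_tac.
rewrite /haar_sum -sumrB; apply: eq_bigr => z _.
rewrite !swE -sumrB; apply: eq_bigr => p _.
rewrite !swE -sumrB; apply: eq_bigr => q _ /=.
rewrite -scalerBr (tliftD _ _ psib) !(tlift_pure _ _ psib) /psi
  (contract_bal hMP).
have -> : ctr w (- bideg 0 1 p.2) = - ctr w (bideg 0 1 p.2).
  by rewrite -scaleN1r (linZ (cr w)) scaleN1r.
by rewrite raddfN mulNr mulrA.
Qed.

Lemma form_endo_sub_endo :
  sub_endo (F := cal_mod Om) delta (bihom cs 1 0) form_endo.
Proof.
split.
- exact: form_endo_lin.
- by move=> x _; exact: form_endo_bihom.
- by move=> b x _; exact: form_endo_embl.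
- by move=> b x _; exact: form_endo_embr.
- by move=> x _; exact: form_endo_coact.
Qed.

(** Recovers [rho] from its contraction: expanding the star of the first leg in the frame and taking
    the star again turns the frame coefficients into contractions with the [f i]. *)
Lemma form_endo_frame m (e f : 'I_m -> Om) :
  (forall x : Om, x = \sum_i emb (hM (cj (F := cal_mod Om) (f i)) x) * e i) ->
  rho = \sum_i cstar (e i) * form_endo (f i).
Proof.
move=> hef; rewrite -(haar_sum_mul srho crho).
transitivity (haar_sum s (fun y x => \sum_i cstar (e i) *
  (emb (ctr (f i) y) * x))).
  apply: eq_haar_sum => y x; rewrite -{1}[bideg 0 1 y](@cstarK _ _ Om).
  rewrite {1}(hef (cstar (bideg 0 1 y)))
    (add_sumE _ _ (semilinD (@cstar_semilin _ _ Om))).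
  rewrite mulr_suml; apply: eq_bigr => i _; rewrite (cstar_embl cs) mulrA.
  rewrite /contract bideg_bideg /=; congr (_ * emb _ * _).
  exact: esym (hermm_sym hhM _ _).
rewrite /haar_sum [RHS](eq_bigr (fun i => haar_sum s (fun y x =>
   cstar (e i) * (emb (ctr (f i) y) * x)))); last first.
  move=> i _; rewrite (haar_sum_map _ _ (g := fun v : Om => cstar (e i) * v))//.
  by lin_tac.
rewrite [RHS]exchange_big /=; apply: eq_bigr => z _.
rewrite [RHS]exchange_big /=; apply: eq_bigr => p _.
rewrite [RHS]exchange_big /=; apply: eq_bigr => q _.
by rewrite scaler_sumr.
Qed.

End CoinvariantForms.

Lemma coinvariant_11 (C : numClosedFieldType) (X : cqh_hermitian C) :
  factorisable X -> irreducible X ->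
  exists u : cqh_om X, forall rho : cqh_om X,
    coinvariant (F := cal_mod (cqh_om X)) (@cqh_coact C X) rho ->
    bihom (cqh_cs X) 1 1 rho -> exists c, rho = c *: u.
Proof.
move=> hfact hirr; have [hM hhM hMP] := cqh_metric X.
have [m [e [f hef]]] := hermitian_frame hhM.
(* The formula of [form_endo_frame] with the projection onto Om^(1,0) in place of [form_endo]; it
   does not mention [rho]. *)
exists (\sum_i cstar (e i : cqh_om X) * bideg (cqh_cs X) 1 0 (f i)) => rho crho
  hrho.
have [_ [_ hsurj]] := hfact 1 1; have [t [s hs ->] tE] := (hsurj rho).1 hrho.
have srho : rho = \sum_(z <- s) (z.1 : cqh_om X) * z.2.
  have fbal : balanced (M := cal_mod (cqh_om X)) (N := cal_mod (cqh_om X))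
      (fun u v : cqh_om X => u * v).
    split=> [u u' v|u v v'|u c v]; [exact: mulrDl|exact: mulrDr|].
    by rewrite /= /cal_ract /cal_lact mulrA.
  rewrite -tE /form_mul (add_sumE _ _ (fun x y => tliftD x y fbal)).
  by apply: eq_bigr => z _; rewrite (tlift_pure _ _ fbal).
have [hP _ _] := hirr.
have endo := form_endo_sub_endo hhM hMP hs hfact srho crho.
have [c hc] := schur (cqh_mod0 X) hP hirr endo; exists c.
rewrite {1}(form_endo_frame hhM hs srho crho hef) scaler_sumr.
apply: eq_bigr => i _; rewrite -(form_endo10 hMP) hc; last exact: bihom_bideg.
by rewrite -scalerAr.
Qed.

(** * The trichotomy *)

Section Trichotomy.
Context {C : numClosedFieldType} (X : cqh_hermitian C).
Local Notation B := (base (cqh_qhs X)).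
Local Notation Om := (cqh_om X).
Local Notation emb := (emb Om).
Local Notation sigma := (cqh_sigma X).

Lemma sigma_emb_neq0 b : sigma * emb b = 0 -> b = 0.
Proof.
move=> hb; apply: (sigma_top_neq0 (X := X)).
by rewrite -(prednK (cqh_n_gt0 X)) exprSr -mulrA hb mulr0.
Qed.

Lemma coinvariant_11_sigma : factorisable X -> irreducible X -> forall rho : Om,
  coinvariant (F := cal_mod Om) (@cqh_coact C X) rho -> bihom (cqh_cs X) 1 1
    rho ->
  exists k, rho = k *: sigma.
Proof.
move=> hfact hirr; have [u hu] := coinvariant_11 hfact hirr => rho crho hrho.
have [c' sE] := hu _ (cqh_cov_sigma X) (sigma_bideg (cqh_herm X)).
have [c ->] := hu _ crho hrho; exists (c / c').
(* Otherwise [sigma] would vanish, against injectivity of the Lefschetz map on 1. *)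
have c'0 : c' != 0.
  apply/eqP => c'0; have /eqP := oner_neq0 B; apply.
  by apply: sigma_emb_neq0; rewrite sE c'0 scale0r mul0r.
by rewrite [in RHS]sE scalerA divfK.
Qed.

Variables (E : herm_hol_line X) (nabla : E -> mforms E).
Hypothesis chern : chern_connection (line_h E) (line_delbar E) nabla.
Hypotheses (hfact : factorisable X) (hirr : irreducible X).
Let h := line_h E.

Lemma line_curvature : exists k, k^* = - k /\
  forall e, curvature (dif Om) nabla e = k *: mform sigma e.
Proof.
have [hE hh [dE' hdual hmor]] := line_hermitian E.
have [_ hol dbc] := line_holomorphic E.
have [rho [crho hrho SE]] :=
  line_curv_form hE hh hdual hmor hol chern dbc (line_dim E).
have [k rhoE] := coinvariant_11_sigma hfact hirr crho hrho.
have scentral w := sigma_central (cqh_herm X) w.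
exists k; split; last first.
  (* The identity for S determines the curvature itself, by expansion in a frame. *)
  move=> e; have [m [x [y hxy]]] := hermitian_frame hh.
  rewrite [LHS](pair_frame hh hxy) [RHS](pair_frame hh hxy);
    apply: eq_bigr => j _.
  congr mform; rewrite (pair_scale hh) (pair_mform1 hh) scentral scalerAr -rhoE.
  exact: SE.
(* Skew-symmetry of S at a single v with h(v, v) sigma nonzero forces [k] to be imaginary. *)
have [v [lam [v0 _]]] := dim_Phi1 (line_dim E).
have h0 : emb (h (cj v) v) * sigma != 0.
  apply/eqP; rewrite -scentral => /sigma_emb_neq0.
  by have [_ /eqP] := hermm_pos hh v0.
have := curv_form_star hh chern v v.
rewrite SE rhoE -!scalerAr (semilinZ (@cstar_semilin _ _ Om))
  (cstar_embl (cqh_cs X)).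
rewrite (sigma_real (cqh_herm X)) -(hermm_sym hh) scentral -scaleNr => /eqP.
by rewrite -subr_eq0 -scalerBl scaler_eq0 (negbTE h0) orbF subr_eq0 => /eqP.
Qed.

Lemma mform_sigma_neq0 : exists e : E, mform sigma e != 0.
Proof.
have [hE hh _] := line_hermitian E.
have [v [lam [v0 _]]] := dim_Phi1 (line_dim E); exists v; apply/eqP => h0.
have [_ /eqP] := hermm_pos hh v0; apply; apply: sigma_emb_neq0.
by rewrite -(pair_mform1 hh) h0 (lin0 (pair_lin hh _)).
Qed.

Lemma line_trichotomy :
  exactly_one (positive_conn nabla) (flat_conn nabla) (negative_conn nabla).
Proof.
have [k [kim kE]] := line_curvature.
have [v v0] := mform_sigma_neq0.
have kP (c : C) : curvature (dif Om) nabla v = c *: mform sigma v -> k = c.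
  rewrite kE => /eqP; rewrite -subr_eq0 -scalerBl scaler_eq0 (negbTE v0) orbF.
  by rewrite subr_eq0 => /eqP.
have kflat : flat_conn nabla -> k = 0.
  by move=> fl; apply: kP; rewrite fl scale0r.
have sqi (x : C) : x * 'i * 'i = - x by rewrite -mulrA -expr2 sqrCi mulrN1.
have inj (x y : C) : x * 'i = y * 'i -> x = y by move/(mulIf (neq0Ci C)).
split; last first.
  split=> -[].
  - move=> [t t0 ht] /kflat k0; move: t0; have := kP _ (ht v).
    by rewrite k0 => /esym/eqP;
      rewrite mulf_eq0 (negbTE (neq0Ci C)) orbF oppr_eq0
      => /eqP->; rewrite ltxx.
  - move=> [t t0 ht] [t' t'0 ht']; have := kP _ (ht v);
    rewrite (kP _ (ht' v)) => /inj.
    move=> e; move: t'0; rewrite e oppr_gt0 => /(lt_trans t0); by rewrite ltxx.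
  - move=> /kflat k0 [t t0 ht]; move: t0; have := kP _ (ht v).
    by rewrite k0 => /esym/eqP; rewrite mulf_eq0 (negbTE (neq0Ci C)) orbF
      => /eqP->; rewrite ltxx.
(* With theta = k i one has k = - theta i, so the sign of this real number selects the case. *)
have treal : k * 'i \is Num.real.
  by rewrite CrealE rmorphM /= conjCi kim mulrNN.
have kT : k = - (k * 'i) * 'i by rewrite mulNr sqi opprK.
case: (real_ltgt0P treal) => [t0|t0|t0].
- by constructor 1; exists (k * 'i) => // f; rewrite kE -kT.
- by constructor 3; exists (- (k * 'i)); rewrite ?oppr_gt0// => f;
  rewrite kE -kT.
- by constructor 2 => f; rewrite kE kT t0 oppr0 mul0r scale0r.
Qed.

End Trichotomy.

Unset Implicit Arguments.

Theorem theorem3p5 (R : realType) (X : cqh_hermitian R[i])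
    (hkaehler : kaehler X) (hfact : factorisable X) (hirr : irreducible X)
    (E : herm_hol_line X) (nabla : E -> mforms E)
    (hchern : chern_connection (line_h E) (line_delbar E) nabla) :
  exactly_one (positive_conn nabla) (flat_conn nabla) (negative_conn nabla).
Proof. exact: line_trichotomy. Qed.
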